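(* $A$-FSPP $\in\mathsf{NC}$ for each $A\in\{\{0,4\},\{1,4\},\{0,1,4\},\{2,4\},\{0,3,4\},\{2,3,4\}\}$.
   Context: Configurations are maps $c:\mathbb{Z}^2\to\mathbb{N}\cup\{-\infty\}$. For $(i,j)\in\mathbb{Z}^2$ let $N(i,j)=\{(i,j+1),(i+1,j),(i,j-1),(i-1,j)\}$. The freezing sandpile map $F$ is defined for all $v$ by $F(c)_v=-\infty$ if $c_v\ge 4$, and $F(c)_v=c_v+\sum_{u\in N(v)}\mathbf{1}[c_u\ge 4]$ otherwise (with $-\infty+k=-\infty$ and $-\infty\ge4$ false). A finite configuration of size $n\times m$ has $c_v\in\mathbb{N}$ for $v\in R=\{0,\dots,n-1\}\times\{0,\dots,m-1\}$ and $c_v=-\infty$ outside $R$; it is given as input by its restriction to $R$. For $A\subseteq\{0,1,2,3,4\}$, $c$ is $A$-simple if $c_v\in A$ for all $v\in R$. The problem $A$-FSPP: given an $A$-simple finite configuration $c$ and a cell $v$, decide whether there exists $t\ge0$ with $F^t(c)_v\ge4$. *)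

(* Defs.v *)
From mathcomp Require Import all_boot all_order all_algebra.
Set Implicit Arguments. Unset Strict Implicit. Unset Printing Implicit Defensive.
Import Order.TTheory GRing.Theory Num.Theory.

(* A configuration Z^2 -> N ∪ {-oo}; [None] stands for -oo. *)
Definition config := int -> int -> option nat.

Definition active (o : option nat) : bool :=
  if o is Some k then (4 <= k)%N else false.

Definition F (c : config) : config := fun i j =>
  match c i j with
  | None => None
  | Some k =>
      if (4 <= k)%N then None
      else Some (k + active (c i (j + 1)%R) + active (c (i + 1)%R j)
                   + active (c i (j - 1)%R) + active (c (i - 1)%R j))%N
  end.

Definition finite_config (n m : nat) (g : nat -> nat -> nat) : config :=
  fun i j =>
    match i, j with
    | Posz a, Posz b => if (a < n)%N && (b < m)%N then Some (g a b) else None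
    | _, _ => None
    end.

Definition fspp_yes (c : config) (vi vj : int) : Prop :=
  exists t : nat, active (iter t F c vi vj).

(* Self-delimiting binary encoding of a natural number:
   each bit b (little-endian) is written b b, terminated by "01". *)
Fixpoint bits_of_aux (fuel k : nat) : seq bool :=
  match fuel with
  | 0 => [::]
  | fuel'.+1 => if k is 0 then [::] else odd k :: bits_of_aux fuel' k./2
  end.
Definition bits_of (k : nat) : seq bool := bits_of_aux k k.
Definition enc_nat (k : nat) : seq bool :=
  flatten [seq [:: b; b] | b <- bits_of k] ++ [:: false; true].

(* A cell value in {0,..,4} is written with 3 bits. *)
Definition enc_cell (k : nat) : seq bool := [:: odd k; odd k./2; odd (k %/ 4)].

Definition enc_instance (n m i j : nat) (g : nat -> nat -> nat) : seq bool :=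
  enc_nat n ++ enc_nat m ++ enc_nat i ++ enc_nat j ++
  flatten [seq enc_cell (g a b) | a <- iota 0 n, b <- iota 0 m].

Definition FSPP (A : seq nat) : seq bool -> Prop := fun x =>
  exists n m i j (g : nat -> nat -> nat),
        [/\ (forall a b, (a < n)%N -> (b < m)%N -> g a b \in A),
            (i < n)%N, (j < m)%N,
            x = enc_instance n m i j g &
            fspp_yes (finite_config n m g) i%:Z j%:Z].

Inductive move := MoveL | MoveS | MoveR.

Definition do_move (mv : move) (p : nat) : nat :=
  match mv with MoveL => p.-1 | MoveS => p | MoveR => p.+1 end.

(* States 'I_Q.+1 (start state ord0), work alphabet 'I_S.+1 (blank ord0).
   The input tape is read-only with endmarkers at positions 0 and n+1
   (read as None); the work tape is one-sided; the output tape is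
   write-only and one-way. A transition reads (state, input symbol,
   work symbol) and either halts (None) or gives
   (new state, written work symbol, input move, work move, output bit). *)
Record LTM := {
  ltm_Q : nat;
  ltm_S : nat;
  ltm_delta : 'I_ltm_Q.+1 -> option bool -> 'I_ltm_S.+1 ->
              option ('I_ltm_Q.+1 * 'I_ltm_S.+1 * move * move * option bool)
}.

Record ltm_conf (M : LTM) := LConf {
  lc_st : 'I_(ltm_Q M).+1;
  lc_ih : nat;
  lc_wt : nat -> 'I_(ltm_S M).+1;
  lc_wh : nat;
  lc_out : seq bool
}.

Definition read_input (x : seq bool) (p : nat) : option bool :=
  if (0 < p)%N && (p <= size x)%N then Some (nth false x p.-1) else None.

Definition ltm_init (M : LTM) : ltm_conf M :=
  @LConf M ord0 0 (fun _ => ord0) 0 [::].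

Definition ltm_step (M : LTM) (x : seq bool) (cf : ltm_conf M)
  : option (ltm_conf M) :=
  match ltm_delta (lc_st cf) (read_input x (lc_ih cf)) (lc_wt cf (lc_wh cf)) with
  | None => None
  | Some (q, a, mi, mw, o) =>
      Some (@LConf M q
              (minn (do_move mi (lc_ih cf)) (size x).+1)
              (fun p => if p == lc_wh cf then a else lc_wt cf p)
              (do_move mw (lc_wh cf))
              (lc_out cf ++ (if o is Some b then [:: b] else [::])))
  end.

Fixpoint ltm_run (M : LTM) (x : seq bool) (t : nat) : option (ltm_conf M) :=
  match t with
  | 0 => Some (ltm_init M)
  | t'.+1 => if ltm_run M x t' is Some cf then ltm_step x cf else None
  end.

Definition ltm_computes_on (M : LTM) (s : nat) (x y : seq bool) : Prop :=
  exists t cf,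
    [/\ ltm_run M x t = Some cf, ltm_step x cf = None, lc_out cf = y &
        forall t' cf', (t' <= t)%N -> ltm_run M x t' = Some cf' ->
                       (lc_wh cf' < s)%N].

Definition logspace_computable (f : seq bool -> seq bool) : Prop :=
  exists (M : LTM) (c : nat),
    forall x, ltm_computes_on M (c * (trunc_log 2 (size x)).+1) x (f x).

Inductive gate :=
| GInput of nat
| GConst of bool
| GNot of nat            (* references earlier gates by index *)
| GAnd of nat & nat
| GOr of nat & nat.

(* A circuit is a list of gates in topological order; the output is the
   last gate. *)
Definition circuit := seq gate.

Definition gate_val (x : seq bool) (vals : seq bool) (g : gate) : bool :=
  match g with
  | GInput i => nth false x i
  | GConst b => b
  | GNot j => ~~ nth false vals j
  | GAnd j k => nth false vals j && nth false vals k
  | GOr j k => nth false vals j || nth false vals k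
  end.

Definition circuit_vals (C : circuit) (x : seq bool) : seq bool :=
  foldl (fun vals g => rcons vals (gate_val x vals g)) [::] C.

Definition circuit_eval (C : circuit) (x : seq bool) : bool :=
  last false (circuit_vals C x).

Definition gate_depth (ds : seq nat) (g : gate) : nat :=
  match g with
  | GInput _ | GConst _ => 0
  | GNot j => (nth 0 ds j).+1
  | GAnd j k | GOr j k => (maxn (nth 0 ds j) (nth 0 ds k)).+1
  end.

Definition circuit_depth (C : circuit) : nat :=
  \max_(d <- foldl (fun ds g => rcons ds (gate_depth ds g)) [::] C) d.

Definition enc_gate (g : gate) : seq bool :=
  match g with
  | GInput i => [:: false; false; false] ++ enc_nat i
  | GConst b => [:: false; false; true; b]
  | GNot j => [:: false; true; false] ++ enc_nat j
  | GAnd j k => [:: false; true; true] ++ enc_nat j ++ enc_nat k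
  | GOr j k => [:: true; false; false] ++ enc_nat j ++ enc_nat k
  end.
Definition enc_circuit (C : circuit) : seq bool := flatten (map enc_gate C).

Definition in_NC (L : seq bool -> Prop) : Prop :=
  exists (C : nat -> circuit) (k : nat),
    [/\ forall n, (size (C n) <= n ^ k + k)%N,
        forall n, (circuit_depth (C n) <= k * (trunc_log 2 n).+1 ^ k)%N,
        logspace_computable (fun u => enc_circuit (C (size u))) &
        forall x, circuit_eval (C (size x)) x <-> L x].

(* Main.v *)
(* A cell topples at most once, so the toppled cells are those of bootstrap
   percolation in which cell v has threshold 4 - c_v. In each case this reduces to
   derivability of an item by rules with at most two premises, with polynomially many
   items and derivations of polynomial size:
   - without values 2 and 3, a 0-cell topples iff its four neighbours do, and a 1-cell
     iff three of them do, hence the cells avoiding toppling start long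
     walks that turn back only at cells of value 0, and the items are walks;
   - without values 1 and 2, toppling spreads along paths of cells of value 3 that
     start at a 4, and the items are cells;
   - without values 0 and 1, two neighbours suffice, so toppled sets grow by merging
     nearby rectangles into their hull and by absorbing adjacent cells of value 3; each
     step accounts for a new part of the board.
   A derivation of size s is found in O(log s) rounds by splitting it along its heavy
   path: each round is a first-order formula in the table of the items and of the
   one-gap derivations found so far. A round is a circuit of logarithmic depth, and a
   logspace register machine, simulated by a Turing machine, prints the gates. *)

(* The circuit depends only on the input length [N] and must be printed by a concrete machine, so
   the index of every gate has to be an arithmetic expression in [N] and loop counters. Hence
   quantifier bounds depend on [N] alone, and all entries of a round share one formula and thus one
   number of gates. The dimensions of the board being unknown to the circuit, it treats all triples
   (rows, columns, start of the body) in parallel; decoding numbers is one more kind of table entry,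
   and only the last entry guesses the decoding. Without 2 and 3 the walks are certificates against
   toppling. Time replaces a search for cycles: toppling times strictly decrease along a walk and
   are at most [n * m], so a walk of length [N + 1] is proof enough, while towards a cell that never
   topples walks of every length exist. Doubling the size of derivations takes two rounds, since
   splitting a gap derivation leaves a side branch of uncontrolled size: derivations double first,
   gap derivations next. *)
Require Import Defs.
From mathcomp Require Import all_boot all_order all_algebra.
From mathcomp Require Import zify.
Set Implicit Arguments. Unset Strict Implicit. Unset Printing Implicit Defensive.

(** * Turing machines on finite types *)

Lemma bits_of_aux_fuel f k : k <= f -> bits_of_aux f k = bits_of k.
Proof.
rewrite /bits_of; elim/ltn_ind: f k => -[|f] IH [|k] //= le_kf.
congr (_ :: _); have le : uphalf k <= k by lia.
by rewrite IH //; [rewrite [RHS]IH | lia].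
Qed.

Lemma bits_ofE k : bits_of k = if k is 0 then [::] else odd k :: bits_of k./2.
Proof.
rewrite {1}/bits_of; case: k => //= k.
by rewrite bits_of_aux_fuel //; lia.
Qed.

Lemma bits_of_double (b : bool) k : 0 < b + k -> bits_of (b + k.*2) = b :: bits_of k.
Proof.
rewrite bits_ofE => bk; have : 0 < b + k.*2 by lia.
case E: (b + k.*2) => // _; rewrite -E oddD odd_double addbF oddb.
by congr (_ :: bits_of _); lia.
Qed.

Fixpoint inc_bits s :=
  match s with
  | [::] => [:: true]
  | true :: s' => false :: inc_bits s'
  | false :: s' => true :: s'
  end.

(** Carry propagation: the leading ones and the bit after them are flipped. This is the single sweep
    that the machine makes for [IInc]. *)
Lemma bits_ofS k : bits_of k.+1 = inc_bits (bits_of k).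
Proof.
elim/ltn_ind: k => -[|k] IH //; have := odd_double_half k.+1.
case: (boolP (odd k.+1)) => _ E.
  rewrite -[in RHS]E bits_of_double //= -IH; last by lia.
  by rewrite -(bits_of_double (b := false)) //; congr bits_of; lia.
rewrite -[in RHS]E bits_of_double; last by lia.
by rewrite /= -(bits_of_double (b := true)) //; congr bits_of; lia.
Qed.

Lemma bits_of_inj : injective bits_of.
Proof.
elim/ltn_ind => a IH b; rewrite bits_ofE [RHS]bits_ofE.
case: a IH => [|a] IH; case: b => [|b] // [].
have ->: uphalf a = a.+1./2 by []; have ->: uphalf b = b.+1./2 by [].
by move=> e /IH; lia.
Qed.

Lemma size_bits_of k p : k < 2 ^ p -> size (bits_of k) <= p.
Proof.
elim: p k => [|p IH] k; first by rewrite expn0; case: k.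
rewrite expnS bits_ofE; case: k => // k lt; rewrite ltnS IH //; lia.
Qed.

(* The start state and the blank symbol have code 0. All elements are shifted by one,
   so that 0 is free to decode to them, whatever the enumeration of the finite type. *)
Section Ordinals.
Variable (X : finType).
Definition to_ord (x : X) : 'I_#|X|.+1 := lift ord0 (enum_rank x).
Definition of_ord (x0 : X) (i : 'I_#|X|.+1) : X :=
  if unlift ord0 i is Some j then enum_val j else x0.
Lemma to_ordK x0 : cancel to_ord (of_ord x0).
Proof. by move=> x; rewrite /of_ord /to_ord liftK enum_rankK. Qed.
Lemma of_ord0 x0 : of_ord x0 ord0 = x0.
Proof. by rewrite /of_ord unlift_none. Qed.
End Ordinals.

Section FinMachine.
Variables (Q X : finType) (q0 : Q) (x0 : X).
Variable delta : Q -> option bool -> X -> option (Q * X * move * move * option bool).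

Definition ltm_of : LTM := {|
  ltm_Q := #|Q|; ltm_S := #|X|;
  ltm_delta := fun q i a =>
    if delta (of_ord q0 q) i (of_ord x0 a) is Some (q', a', mi, mw, o)
    then Some (to_ord q', to_ord a', mi, mw, o) else None |}.

Record fconf := FConf {
  f_st : Q; f_ih : nat; f_wt : nat -> X; f_wh : nat; f_out : seq bool }.

Definition fstep (x : seq bool) (c : fconf) : option fconf :=
  if delta (f_st c) (read_input x (f_ih c)) (f_wt c (f_wh c)) is Some (q, a, mi, mw, o)
  then Some (FConf q (minn (do_move mi (f_ih c)) (size x).+1)
              (fun p => if p == f_wh c then a else f_wt c p)
              (do_move mw (f_wh c))
              (f_out c ++ (if o is Some b then [:: b] else [::])))
  else None.

(** The head bound is imposed on every configuration, the last one included; it becomes the space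
    clause of [ltm_computes_on]. *)
Inductive freach (x : seq bool) (s : nat) : fconf -> fconf -> Prop :=
| freach0 c : f_wh c < s -> freach x s c c
| freachS c c1 c2 : f_wh c < s -> fstep x c = Some c1 -> freach x s c1 c2 ->
    freach x s c c2.

Lemma freach_trans x s c1 c2 c3 :
  freach x s c1 c2 -> freach x s c2 c3 -> freach x s c1 c3.
Proof. by elim=> // c c' c'' lt st _ IH /IH; apply: freachS st. Qed.

(** Tapes are functions, hence compared pointwise, and only after decoding: the blank and the start
    state each have two codes. *)
Definition fconf_rep (cf : ltm_conf ltm_of) (c : fconf) : Prop :=
  [/\ of_ord q0 (lc_st cf) = f_st c, lc_ih cf = f_ih c,
      forall p, of_ord x0 (lc_wt cf p) = f_wt c p,
      lc_wh cf = f_wh c & lc_out cf = f_out c].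

Lemma fstep_rep x cf c : fconf_rep cf c ->
  match fstep x c with
  | Some c' => exists2 cf', ltm_step x cf = Some cf' & fconf_rep cf' c'
  | None => ltm_step x cf = None
  end.
Proof.
case: cf => q ih wt wh out [/= Eq Ei Et Eh Eo].
rewrite /fstep /ltm_step /= Eq Ei Et Eh Eo.
case: (delta _ _ _) => [[[[[q' a] mi] mw] o]|] //.
eexists; first by []; split; rewrite //= ?to_ordK // => p.
by case: eqP => _; rewrite ?to_ordK.
Qed.

Lemma freach_computes x s out c :
  freach x s (FConf q0 0 (fun=> x0) 0 [::]) c -> fstep x c = None -> f_out c = out ->
  ltm_computes_on ltm_of s x out.
Proof.
move=> R st Eo.
(* Generalized to a run that has already lasted [t] steps within the space bound, so that induction
   on reachability applies. *)
suff gen c1 c2 : freach x s c1 c2 -> forall t cf, ltm_run ltm_of x t = Some cf ->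
    fconf_rep cf c1 -> (forall t' cf', t' < t ->
      ltm_run ltm_of x t' = Some cf' -> lc_wh cf' < s) ->
  exists t2 cf2, [/\ ltm_run ltm_of x t2 = Some cf2, fconf_rep cf2 c2 &
    forall t' cf', t' <= t2 -> ltm_run ltm_of x t' = Some cf' -> lc_wh cf' < s].
  have [||t2 [cf2 [E2 R2 B2]]] := gen _ _ R 0 (ltm_init ltm_of) erefl.
  - by split; rewrite //= ?of_ord0 // => p; rewrite of_ord0.
  - by [].
  exists t2, cf2; split=> //; last by case: R2 => _ _ _ _ ->.
  by have := fstep_rep x R2; rewrite st.
elim=> {c1 c2 R} [c1 lt|c1 c2 c3 lt st12 _ IH] t cf Et rep B.
  exists t, cf; split=> // t' cf'; rewrite leq_eqVlt => /predU1P[->|]; last exact: B.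
  by rewrite Et => -[<-]; case: rep => _ _ _ ->.
have := fstep_rep x rep; rewrite st12 => -[cf' Ecf' rep'].
apply: (IH t.+1 cf') => //; first by rewrite /= Et.
move=> t' cf''; rewrite ltnS leq_eqVlt => /predU1P[->|]; last exact: B.
by rewrite Et => -[<-]; case: rep => _ _ _ ->.
Qed.
End FinMachine.

(** * Register machines on a multi-track tape *)

(* [IJeq r1 r2 k] jumps [k] instructions forward if the registers are equal,
   [IBack k] jumps [k] backward, [IRead k] advances the input head and jumps [k]
   forward on the right endmarker; [IOutR r] outputs [enc_nat] of register [r]. *)
Inductive instr :=
| IInc of nat
| IReset of nat
| IJeq of nat & nat & nat
| IBack of nat
| IOutB of bool
| IOutR of nat
| IRead of nat.

Definition instr_regs (i : instr) : seq nat :=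
  match i with
  | IInc r | IReset r | IOutR r => [:: r]
  | IJeq r1 r2 _ => [:: r1; r2]
  | _ => [::]
  end.

Definition upd (st : nat -> nat) (r v : nat) : nat -> nat :=
  fun r' => if r' == r then v else st r'.

Record cconf := CConf {
  c_pc : nat; c_st : nat -> nat; c_ih : nat; c_out : seq bool }.

Definition cstep (code : seq instr) (x : seq bool) (c : cconf) : option cconf :=
  let: CConf pc st ih out := c in
  if onth code pc is Some i then Some
    match i with
    | IInc r => CConf pc.+1 (upd st r (st r).+1) ih out
    | IReset r => CConf pc.+1 (upd st r 0) ih out
    | IJeq r1 r2 k => CConf (if st r1 == st r2 then pc + k else pc.+1) st ih out
    | IBack k => CConf (pc - k) st ih out
    | IOutB b => CConf pc.+1 st ih (rcons out b)
    | IOutR r => CConf pc.+1 st ih (out ++ enc_nat (st r))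
    | IRead k =>
        let ih' := minn ih.+1 (size x).+1 in
        CConf (if read_input x ih' is Some _ then pc.+1 else pc + k) st ih' out
    end
  else None.

Inductive creach (code : seq instr) (x : seq bool) (B : nat) : cconf -> cconf -> Prop :=
| creach0 c : creach code x B c c
| creachS c c1 c2 : cstep code x c = Some c1 -> c_pc c1 <= size code ->
    (forall r, c_st c1 r <= B) -> creach code x B c1 c2 -> creach code x B c c2.

Lemma creach_trans code x B c1 c2 c3 :
  creach code x B c1 c2 -> creach code x B c2 c3 -> creach code x B c1 c3.
Proof. by elim=> // c c' c'' st le bd _ IH /IH; apply: creachS st le bd. Qed.

Section CodeMachine.
Variables (code : seq instr) (K : nat).
Hypothesis code_regs : all (fun i => all (leq^~ K) (instr_regs i)) code.

(* Little-endian binary registers are kept on parallel tracks of the work tape;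
   the flag marks cell 0, where the head stands between two instructions. *)
Definition cell : finType := (bool * {ffun 'I_K.+1 -> option bool})%type.
Definition set_track (a : cell) (r : nat) (v : option bool) : cell :=
  (a.1, [ffun i => if i == inord r then v else a.2 i]).
Definition track (r : nat) (a : cell) : option bool := a.2 (inord r).

(* The two booleans: [(false, false)] starts or continues an instruction,
   [(true, false)] is its second phase, [(false, true)] goes back to cell 0,
   [(true, true)] is the start of the machine. *)
Definition cstate : finType := ('I_(size code).+1 * (bool * bool))%type.
Definition cinit : cstate := (ord0, (true, true)).
Definition cblank : cell := (false, [ffun=> None]).
Definition run_at (pc : nat) : cstate := (inord pc, (false, false)).
Definition ret_at (pc : nat) : cstate := (inord pc, (false, true)).
Definition snd_at (pc : nat) : cstate := (inord pc, (true, false)).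

(** A register instruction is one sweep to the right from cell 0; a blank on a track marks the end
    of its register. [IInc] carries, [IJeq] compares two tracks until both end or they differ,
    [IOutR] uses the second phase to print each bit twice and to finish the terminator. [IRead]
    moves the input head first and looks in the second phase. *)
Definition exec_instr (snd : bool) (q : cstate) (pc : nat) (inp : option bool)
    (a : cell) (i : instr) : cstate * cell * move * move * option bool :=
  match i with
  | IInc r =>
      if track r a is Some true
      then (q, set_track a r (Some false), MoveS, MoveR, None)
      else (ret_at pc.+1, set_track a r (Some true), MoveS, MoveS, None)
  | IReset r =>
      if track r a is Some _ then (q, set_track a r None, MoveS, MoveR, None)
      else (ret_at pc.+1, a, MoveS, MoveS, None)
  | IJeq r1 r2 k =>
      if track r1 a == track r2 a then
        if track r1 a is Some _ then (q, a, MoveS, MoveR, None)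
        else (ret_at (pc + k), a, MoveS, MoveS, None)
      else (ret_at pc.+1, a, MoveS, MoveS, None)
  | IBack k => (run_at (pc - k), a, MoveS, MoveS, None)
  | IOutB b => (run_at pc.+1, a, MoveS, MoveS, Some b)
  | IOutR r =>
      if track r a is Some b then
        if snd then (run_at pc, a, MoveS, MoveR, Some b)
        else (snd_at pc, a, MoveS, MoveS, Some b)
      else if snd then (ret_at pc.+1, a, MoveS, MoveS, Some true)
           else (snd_at pc, a, MoveS, MoveS, Some false)
  | IRead k =>
      if snd then
        (run_at (if inp is Some _ then pc.+1 else pc + k), a, MoveS, MoveS, None)
      else (snd_at pc, a, MoveR, MoveS, None)
  end.

Definition cdelta (q : cstate) (inp : option bool) (a : cell)
  : option (cstate * cell * move * move * option bool) :=
  let pc : nat := q.1 in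
  match q.2 with
  | (true, true) => Some (run_at 0, (true, a.2), MoveS, MoveS, None)
  | (false, true) =>
      Some (if a.1 then (run_at pc, a, MoveS, MoveS, None)
            else (q, a, MoveS, MoveL, None))
  | (snd, _) => omap (exec_instr snd q pc inp a) (onth code pc)
  end.

Notation fc := (fconf cstate cell).
Notation FC := (@FConf cstate cell).
Notation frch := (freach cdelta).

Definition tape_rep (st : nat -> nat) (T : nat -> cell) : Prop :=
  forall p, (T p).1 = (p == 0) /\
            forall r, r <= K -> track r (T p) = onth (bits_of (st r)) p.

Lemma track_set a r r' v : r <= K -> r' <= K ->
  track r (set_track a r' v) = if r == r' then v else track r a.
Proof.
move=> le le'; rewrite /track ffunE; congr (if _ then _ else _).
apply/eqP/eqP => [/(congr1 (@nat_of_ord _))|->//].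
by rewrite !inordK.
Qed.

Lemma frch_step x s q ih T h out q' a mi mw o f : h < s ->
  cdelta q (read_input x ih) (T h) = Some (q', a, mi, mw, o) ->
  frch x s (FC q' (minn (do_move mi ih) (size x).+1)
                (fun p => if p == h then a else T p) (do_move mw h)
                (out ++ (if o is Some b then [:: b] else [::]))) f ->
  frch x s (FC q ih T h out) f.
Proof. by move=> lt E; apply: freachS => //; rewrite /fstep /= E. Qed.

(** The flag of cell 0 stops the way back. The final tape is only pointwise equal to [T], because
    each step rewrites the scanned cell. *)
Lemma ret_reach x s pc ih T h out : pc <= size code -> h < s -> ih <= (size x).+1 ->
  (forall p, (T p).1 = (p == 0)) ->
  exists2 T', forall p, T' p = T p &
    frch x s (FC (ret_at pc) ih T h out) (FC (run_at pc) ih T' 0 out).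
Proof.
move=> le; elim: h T => [|h IH] T lt lei mk.
  eexists; last first.
    apply: (frch_step (q' := run_at pc) (a := T 0) (mi := MoveS) (mw := MoveS) (o := None)) => //.
      by rewrite /cdelta /= mk inordK.
    rewrite /= cats0 (minn_idPl lei); exact: freach0.
  by move=> p /=; case: eqP => [->|].
have [|||T' ET' R] := IH (fun p => if p == h.+1 then T h.+1 else T p).
- by lia.
- by [].
- by move=> p; case: eqP => [->|_]; exact: mk.
exists T'; first by move=> p; rewrite ET'; case: eqP => [->|].
apply: (frch_step (q' := ret_at pc) (a := T h.+1) (mi := MoveS) (mw := MoveL) (o := None)) => //.
  by rewrite /cdelta /= mk.
by rewrite /= cats0 (minn_idPl lei).
Qed.

Lemma run_delta pc inp a : pc <= size code ->
  cdelta (run_at pc) inp a = omap (exec_instr false (run_at pc) pc inp a) (onth code pc).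
Proof. by move=> le; rewrite /cdelta /= inordK. Qed.

Lemma snd_delta pc inp a : pc <= size code ->
  cdelta (snd_at pc) inp a = omap (exec_instr true (snd_at pc) pc inp a) (onth code pc).
Proof. by move=> le; rewrite /cdelta /= inordK. Qed.

Section Loops.
Variables (x : seq bool) (s : nat) (pc : nat).
Hypothesis pc_le : pc <= size code.

(** Stated for a sweep that stands at cell [h] with the bits [l] still ahead; the alternative
    [p < h] protects the bits already written. *)
Lemma inc_reach r ih T h out l : onth code pc = Some (IInc r) -> r <= K ->
  ih <= (size x).+1 -> h + size l < s ->
  (forall q, track r (T (h + q)) = onth l q) ->
  exists T' h', [/\ h' < s, frch x s (FC (run_at pc) ih T h out) (FC (ret_at pc.+1) ih T' h' out),
    forall p, (T' p).1 = (T p).1,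
    forall r' p, r' <= K -> (r' != r) || (p < h) -> track r' (T' p) = track r' (T p) &
    forall q, track r (T' (h + q)) = onth (inc_bits l) q].
Proof.
move=> Ei ler lei; elim: l T h => [|b l IH] T h lt tr.
  exists (fun p => if p == h then set_track (T h) r (Some true) else T p), h; split.
  - by move: lt => /=; lia.
  - apply: (frch_step (q' := ret_at pc.+1) (a := set_track (T h) r (Some true))
             (mi := MoveS) (mw := MoveS) (o := None)); first by move: lt => /=; lia.
      by rewrite run_delta // Ei /= -{1}[h]addn0 tr.
    rewrite /= cats0 (minn_idPl lei); apply: freach0; move: lt => /=; lia.
  - by move=> p; case: eqP => [->|].
  - move=> r' p ler' H; case: eqP => [E|//]; rewrite track_set // E.
    by move: H; rewrite E ltnn orbF => /negPf ->.
  - case=> [|q]; first by rewrite addn0 eqxx track_set // eqxx.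
    by case: eqP => [|_]; [lia | rewrite tr; case: q].
case: b lt tr => lt tr.
  have [||T' [h' [lt' R mk' oth' tr']]] :=
    IH (fun p => if p == h then set_track (T h) r (Some false) else T p) h.+1.
  - by move: lt => /=; lia.
  - by move=> q; case: eqP => [|_]; [lia | rewrite addSnnS tr].
  exists T', h'; split=> //.
  - apply: (frch_step (q' := run_at pc) (a := set_track (T h) r (Some false))
             (mi := MoveS) (mw := MoveR) (o := None)); first by move: lt => /=; lia.
      by rewrite run_delta // Ei /= -{1}[h]addn0 tr.
    by rewrite /= cats0 (minn_idPl lei).
  - by move=> p; rewrite mk'; case: eqP => [->|].
  - move=> r' p ler' H; rewrite oth' //; last by move: H; case: (r' != r) => //=; lia.
    case: eqP => [E|//]; rewrite track_set // E.
    by move: H; rewrite E ltnn orbF => /negPf ->.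
  - case=> [|q]; last by rewrite -addSnnS tr'.
    by rewrite addn0 oth' ?ltnS ?leqnn ?orbT // eqxx track_set // eqxx.
exists (fun p => if p == h then set_track (T h) r (Some true) else T p), h; split.
- by move: lt => /=; lia.
- apply: (frch_step (q' := ret_at pc.+1) (a := set_track (T h) r (Some true))
           (mi := MoveS) (mw := MoveS) (o := None)); first by move: lt => /=; lia.
    by rewrite run_delta // Ei /= -{1}[h]addn0 tr.
  rewrite /= cats0 (minn_idPl lei); apply: freach0; move: lt => /=; lia.
- by move=> p; case: eqP => [->|].
- move=> r' p ler' H; case: eqP => [E|//]; rewrite track_set // E.
  by move: H; rewrite E ltnn orbF => /negPf ->.
- case=> [|q]; first by rewrite addn0 eqxx track_set // eqxx.
  by case: eqP => [|_]; [lia | rewrite tr].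
Qed.

Lemma reset_reach r ih T h out l : onth code pc = Some (IReset r) -> r <= K ->
  ih <= (size x).+1 -> h + size l < s ->
  (forall q, track r (T (h + q)) = onth l q) ->
  exists T' h', [/\ h' < s, frch x s (FC (run_at pc) ih T h out) (FC (ret_at pc.+1) ih T' h' out),
    forall p, (T' p).1 = (T p).1,
    forall r' p, r' <= K -> (r' != r) || (p < h) -> track r' (T' p) = track r' (T p) &
    forall q, track r (T' (h + q)) = None].
Proof.
move=> Ei ler lei; elim: l T h => [|b l IH] T h lt tr.
  exists (fun p => if p == h then T h else T p), h; split.
  - by move: lt => /=; lia.
  - apply: (frch_step (q' := ret_at pc.+1) (a := T h)
             (mi := MoveS) (mw := MoveS) (o := None)); first by move: lt => /=; lia.
      by rewrite run_delta // Ei /= -{1}[h]addn0 tr.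
    rewrite /= cats0 (minn_idPl lei); apply: freach0; move: lt => /=; lia.
  - by move=> p; case: eqP => [->|].
  - by move=> r' p _ _; case: eqP => [->|].
  - move=> q; have -> : (if h + q == h then T h else T (h + q)) = T (h + q) by case: eqP => [->|].
    by rewrite tr; case: (q).
have [||T' [h' [lt' R mk' oth' tr']]] :=
  IH (fun p => if p == h then set_track (T h) r None else T p) h.+1.
- by move: lt => /=; lia.
- by move=> q; case: eqP => [|_]; [lia | rewrite addSnnS tr].
exists T', h'; split=> //.
- apply: (frch_step (q' := run_at pc) (a := set_track (T h) r None)
           (mi := MoveS) (mw := MoveR) (o := None)); first by move: lt => /=; lia.
    by rewrite run_delta // Ei /= -{1}[h]addn0 tr.
  by rewrite /= cats0 (minn_idPl lei).
- by move=> p; rewrite mk'; case: eqP => [->|].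
- move=> r' p ler' H; rewrite oth' //; last by move: H; case: (r' != r) => //=; lia.
  case: eqP => [E|//]; rewrite track_set // E.
  by move: H; rewrite E ltnn orbF => /negPf ->.
- case=> [|q]; last by rewrite -addSnnS tr'.
  by rewrite addn0 oth' ?ltnS ?leqnn ?orbT // eqxx track_set // eqxx.
Qed.

Lemma jeq_reach r1 r2 k ih T h out l1 l2 : onth code pc = Some (IJeq r1 r2 k) ->
  ih <= (size x).+1 -> h + size l1 < s ->
  (forall q, track r1 (T (h + q)) = onth l1 q) ->
  (forall q, track r2 (T (h + q)) = onth l2 q) ->
  exists T' h', [/\ h' < s, frch x s (FC (run_at pc) ih T h out)
      (FC (ret_at (if l1 == l2 then pc + k else pc.+1)) ih T' h' out) &
    forall p, T' p = T p].
Proof.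
move=> Ei lei; elim: l1 l2 T h => [|b1 l1 IH] l2 T h lt tr1 tr2.
  exists (fun p => if p == h then T h else T p), h; split.
  - by move: lt => /=; lia.
  - apply: (frch_step (q' := ret_at (if [::] == l2 then pc + k else pc.+1)) (a := T h)
             (mi := MoveS) (mw := MoveS) (o := None)); first by move: lt => /=; lia.
      rewrite run_delta // Ei /=; move: (tr1 0) (tr2 0); rewrite addn0 => -> -> /=.
      by case: (l2).
    rewrite /= cats0 (minn_idPl lei); apply: freach0; move: lt => /=; lia.
  - by move=> p; case: eqP => [->|].
case: (boolP (onth l2 0 == Some b1)) => [/eqP E2|ne].
  case: l2 E2 tr2 => // _ l2 [->] tr2.
  have [|||T' [h' [lt' R ET']]] := IH l2 (fun p => if p == h then T h else T p) h.+1.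
  - by move: lt => /=; lia.
  - by move=> q; case: eqP => [|_]; [lia | rewrite addSnnS tr1].
  - by move=> q; case: eqP => [|_]; [lia | rewrite addSnnS tr2].
  exists T', h'; split=> //; last by move=> p; rewrite ET'; case: eqP => [->|].
  apply: (frch_step (q' := run_at pc) (a := T h)
           (mi := MoveS) (mw := MoveR) (o := None)); first by move: lt => /=; lia.
    rewrite run_delta // Ei /=; move: (tr1 0) (tr2 0); rewrite addn0 => -> ->.
    by rewrite /= eqxx.
  by rewrite /= cats0 (minn_idPl lei) eqseq_cons eqxx.
exists (fun p => if p == h then T h else T p), h; split.
- by move: lt => /=; lia.
- apply: (frch_step (q' := ret_at pc.+1) (a := T h)
           (mi := MoveS) (mw := MoveS) (o := None)); first by move: lt => /=; lia.
    rewrite run_delta // Ei /=; move: (tr1 0) (tr2 0); rewrite addn0 => -> ->.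
    by rewrite [X in if X then _ else _]eq_sym (negPf ne).
  suff ->: (b1 :: l1 == l2) = false.
    rewrite /= cats0 (minn_idPl lei); apply: freach0; move: lt => /=; lia.
  by case: (l2) ne => //= b2 l2' /eqP ne; apply/eqP => -[E _]; apply: ne; rewrite E.
- by move=> p; case: eqP => [->|].
Qed.

Lemma outr_reach r ih T h out l : onth code pc = Some (IOutR r) ->
  ih <= (size x).+1 -> h + size l < s ->
  (forall q, track r (T (h + q)) = onth l q) ->
  exists T' h', [/\ h' < s, frch x s (FC (run_at pc) ih T h out)
      (FC (ret_at pc.+1) ih T' h'
         (out ++ flatten [seq [:: b; b] | b <- l] ++ [:: false; true])) &
    forall p, T' p = T p].
Proof.
move=> Ei lei; elim: l T h out => [|b l IH] T h out lt tr.
  pose T1 p := if p == h then T h else T p.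
  exists (fun p => if p == h then T1 h else T1 p), h; split.
  - by move: lt => /=; lia.
  - apply: (frch_step (q' := snd_at pc) (a := T h)
             (mi := MoveS) (mw := MoveS) (o := Some false)); first by move: lt => /=; lia.
      by rewrite run_delta // Ei /= -{1}[h]addn0 tr.
    rewrite /= (minn_idPl lei).
    apply: (frch_step (q' := ret_at pc.+1) (a := T h)
             (mi := MoveS) (mw := MoveS) (o := Some true)); first by move: lt => /=; lia.
      by rewrite snd_delta // Ei /= eqxx -{1}[h]addn0 tr.
    rewrite /= (minn_idPl lei) -catA /T1 eqxx; apply: freach0; move: lt => /=; lia.
  - by move=> p; rewrite /T1 eqxx; case: eqP => [->|].
pose T1 p := if p == h then T h else T p.
have [||T' [h' [lt' R ET']]] :=
    IH (fun p => if p == h then T1 h else T1 p) h.+1 (out ++ [:: b; b]).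
- by move: lt => /=; lia.
- by move=> q; rewrite /T1; case: eqP => [|_]; [lia | rewrite addSnnS tr].
exists T', h'; split=> //; last by move=> p; rewrite ET' /T1 eqxx; case: eqP => [->|].
apply: (frch_step (q' := snd_at pc) (a := T h)
         (mi := MoveS) (mw := MoveS) (o := Some b)); first by move: lt => /=; lia.
  by rewrite run_delta // Ei /= -{1}[h]addn0 tr.
rewrite /= (minn_idPl lei).
apply: (frch_step (q' := run_at pc) (a := T h)
         (mi := MoveS) (mw := MoveR) (o := Some b)); first by move: lt => /=; lia.
  by rewrite snd_delta // Ei /= eqxx -{1}[h]addn0 tr.
move: R; rewrite /= (minn_idPl lei) -!catA /=; suff -> : T1 h = T h by [].
by rewrite /T1 eqxx.
Qed.
End Loops.

Definition cf_rep (x : seq bool) (c : cconf) (f : fc) : Prop :=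
  [/\ f = FC (run_at (c_pc c)) (c_ih c) (f_wt f) 0 (c_out c),
      tape_rep (c_st c) (f_wt f) &
      (c_ih c <= (size x).+1) && (c_pc c <= size code)].

(** A sweep goes from cell 0 at most to the first blank of a register, whose index is at most [W];
    hence the space [W.+1]. *)
Lemma cstep_sim x W c c' f : (forall r, size (bits_of (c_st c r)) <= W) ->
  cstep code x c = Some c' -> c_pc c' <= size code -> cf_rep x c f ->
  exists2 f', frch x W.+1 f f' & cf_rep x c' f'.
Proof.
case: c => pc st ih out /= bd; case: f => q ih0 T0 h0 out0.
case Ei: (onth code pc) => [i|] // [Ec] le' [[-> -> -> ->] /= rep /andP [lei lep]].
have mk p : (T0 p).1 = (p == 0) by case: (rep p).
have T0E p : (if p == 0 then T0 0 else T0 p) = T0 p by case: eqP => [->|].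
have regs r : r \in instr_regs i -> r <= K.
  have lt : pc < size code by rewrite -onthTE Ei.
  move: (all_nthP i code_regs pc lt); rewrite (onth_nth i _ _ _ Ei) => /allP; exact.
have tr r : r <= K -> forall q, track r (T0 (0 + q)) = onth (bits_of (st r)) q.
  by move=> ler p; case: (rep p) => _; apply.
have lts r : 0 + size (bits_of (st r)) < W.+1 by rewrite add0n ltnS bd.
have fin pc' st' T h o : h < W.+1 -> pc' <= size code -> tape_rep st' T ->
    exists2 f', frch x W.+1 (FC (ret_at pc') ih T h o) f' &
      cf_rep x (CConf pc' st' ih o) f'.
  move=> lth lepc' repT.
  have [|T' ET' R] := ret_reach (T := T) o lepc' lth lei; first by move=> p; case: (repT p).
  exists (FC (run_at pc') ih T' 0 o) => //; split; rewrite /= ?lei // => p.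
  by rewrite ET'.
case: i Ei regs Ec => [r|r|r1 r2 k|k|b|r|k] Ei regs /= Ec; subst c'; move: le' => /= le'.
- have ler : r <= K by apply: regs; rewrite inE.
  have [T' [h' [lt' R mk' oth' tr']]] := inc_reach lep out Ei ler lei (lts r) (tr _ ler).
  have [|f' R' rep'] := fin pc.+1 (upd st r (st r).+1) T' h' out lt' le'.
    move=> p; split; first by rewrite mk'.
    move=> r' ler'; rewrite /upd; case: eqP => [->|/eqP ne].
      by rewrite bits_ofS; apply: (tr' p).
    by rewrite oth' ?ne //; case: (rep p) => _; apply.
  by exists f' => //; apply: freach_trans R R'.
- have ler : r <= K by apply: regs; rewrite inE.
  have [T' [h' [lt' R mk' oth' tr']]] := reset_reach lep out Ei ler lei (lts r) (tr _ ler).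
  have [|f' R' rep'] := fin pc.+1 (upd st r 0) T' h' out lt' le'.
    move=> p; split; first by rewrite mk'.
    move=> r' ler'; rewrite /upd; case: eqP => [->|/eqP ne].
      by rewrite (tr' p); case: p.
    by rewrite oth' ?ne //; case: (rep p) => _; apply.
  by exists f' => //; apply: freach_trans R R'.
- have le1 : r1 <= K by apply: regs; rewrite !inE eqxx.
  have le2 : r2 <= K by apply: regs; rewrite !inE eqxx orbT.
  have [T' [h' [lt' R ET']]] := jeq_reach lep out Ei lei (lts r1) (tr _ le1) (tr _ le2).
  move: R; rewrite (inj_eq bits_of_inj) => R.
  have [|f' R' rep'] := fin (if st r1 == st r2 then pc + k else pc.+1) st T' h' out lt' le'.
    by move=> p; rewrite ET'.
  by exists f' => //; apply: freach_trans R R'.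
- exists (FC (run_at (pc - k)) ih (fun p => if p == 0 then T0 0 else T0 p) 0 out).
    apply: (frch_step (q' := run_at (pc - k)) (a := T0 0) (mi := MoveS) (mw := MoveS) (o := None)) => //.
      by rewrite run_delta // Ei /=.
    rewrite /= cats0 (minn_idPl lei); exact: freach0.
  by split; rewrite /= ?lei // => p; rewrite T0E.
- exists (FC (run_at pc.+1) ih (fun p => if p == 0 then T0 0 else T0 p) 0 (rcons out b)).
    apply: (frch_step (q' := run_at pc.+1) (a := T0 0) (mi := MoveS) (mw := MoveS) (o := Some b)) => //.
      by rewrite run_delta // Ei /=.
    rewrite /= cats1 (minn_idPl lei); exact: freach0.
  by split; rewrite /= ?lei // => p; rewrite T0E.
- have ler : r <= K by apply: regs; rewrite inE.
  have [T' [h' [lt' R ET']]] := outr_reach lep out Ei lei (lts r) (tr _ ler).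
  have [|f' R' rep'] := fin pc.+1 st T' h' (out ++ enc_nat (st r)) lt' le'.
    by move=> p; rewrite ET'.
  by exists f' => //; apply: freach_trans R R'.
pose T1 p := if p == 0 then T0 0 else T0 p.
set ih' := minn ih.+1 (size x).+1.
set pc' := (if read_input x ih' is Some _ then pc.+1 else pc + k).
exists (FC (run_at pc') ih' (fun p => if p == 0 then T1 0 else T1 p) 0 out).
  apply: (frch_step (q' := snd_at pc) (a := T0 0) (mi := MoveR) (mw := MoveS) (o := None)) => //.
    by rewrite run_delta // Ei /=.
  rewrite /= cats0.
  apply: (frch_step (q' := run_at pc') (a := T0 0) (mi := MoveS) (mw := MoveS) (o := None)) => //.
    by rewrite snd_delta // Ei /=.
  by rewrite /= cats0 /ih' -minnA minnn; exact: freach0.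
split; rewrite /= ?geq_minr // => p.
by have -> : (if p == 0 then T1 0 else T1 p) = T0 p by rewrite /T1; case: eqP => [->|].
Qed.

Lemma creach_sim x W B c c' f : (forall k, k <= B -> size (bits_of k) <= W) ->
  (forall r, c_st c r <= B) -> creach code x B c c' -> cf_rep x c f ->
  exists2 f', frch x W.+1 f f' & cf_rep x c' f'.
Proof.
move=> bW bd R; elim: R bd f => {c c'} [c|c c1 c2 st lepc bd1 _ IH] bd f rep.
  by exists f => //; apply: freach0; case: rep => ->.
have [|f1 R1 rep1] := cstep_sim (W := W) _ st lepc rep; first by move=> r; apply: bW.
have [f2 R2 rep2] := IH bd1 f1 rep1.
by exists f2 => //; apply: freach_trans R1 R2.
Qed.

(** The first move only writes the flag on cell 0. At the end of the code no instruction is found,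
    and the machine halts. *)
Lemma code_computes x W B st ih out : (forall k, k <= B -> size (bits_of k) <= W) ->
  creach code x B (CConf 0 (fun=> 0) 0 [::]) (CConf (size code) st ih out) ->
  ltm_computes_on (ltm_of cinit cblank cdelta) W.+1 x out.
Proof.
move=> bW R; pose T0 p := if p == 0 then (true, cblank.2) : cell else cblank.
have rep0 : cf_rep x (CConf 0 (fun=> 0) 0 [::]) (FC (run_at 0) 0 T0 0 [::]).
  split=> // p; rewrite /= /T0; split; first by case: eqP.
  by move=> r _; case: eqP; rewrite /track ffunE onth0n.
have [|[q ih1 T h o] R1 [[Eq Ei Eh Eo] /= repT _]] := creach_sim bW _ R rep0; first by [].
apply: (freach_computes (c := FC q ih1 T h o) _ _ Eo).
  apply: (frch_step (q' := run_at 0) (a := (true, cblank.2)) (mi := MoveS) (mw := MoveS) (o := None)) => //.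
rewrite Eq Eh /fstep /= run_delta // onth_default //.
Qed.
End CodeMachine.

Definition code_width (code : seq instr) : nat :=
  \max_(r <- flatten (map instr_regs code)) r.

Lemma code_widthP code : all (fun i => all (leq^~ (code_width code)) (instr_regs i)) code.
Proof.
suff sub rs : (forall r, r \in flatten (map instr_regs code) -> r \in rs) ->
  all (fun i => all (leq^~ (\max_(r <- rs) r)) (instr_regs i)) code by exact: sub.
elim: code => //= i code IH sub; apply/andP; split.
  apply/allP => r ri; apply: (leq_bigmax_seq (F := id)) => //.
  by apply: sub; rewrite mem_cat ri.
by apply: IH => r ri; apply: sub; rewrite mem_cat ri orbT.
Qed.

(** * Register machine fragments *)

Definition regs_le (B : nat) (st : nat -> nat) : Prop := forall r, st r <= B.

(** Jumps are relative, so a fragment behaves alike in all surrounding code; quantifying over [pre]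
    and [post] makes fragments composable. The bound on [st'] lets the next fragment start. *)
Definition exec (B : nat) (f : seq instr) (st st' : nat -> nat) (w : seq bool) : Prop :=
  regs_le B st' /\
  forall x pre post ih o, creach (pre ++ f ++ post) x B
    (CConf (size pre) st ih o) (CConf (size pre + size f) st' ih (o ++ w)).

Lemma onth_at (T : Type) (pre : seq T) i post code pc :
  code = pre ++ i :: post -> pc = size pre -> onth code pc = Some i.
Proof. by move=> -> ->; rewrite onth_cat ltnn subnn. Qed.

Lemma regs_le_upd B st r v : regs_le B st -> v <= B -> regs_le B (upd st r v).
Proof. by move=> bd le r'; rewrite /upd; case: eqP. Qed.

Lemma creach1 code x B c c1 : cstep code x c = Some c1 -> c_pc c1 <= size code ->
  regs_le B (c_st c1) -> creach code x B c c1.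
Proof. by move=> st le bd; apply: creachS st le bd _; apply: creach0. Qed.

Lemma exec_nil B st : regs_le B st -> exec B [::] st st [::].
Proof. by move=> bd; split=> // x pre post ih o; rewrite addn0 cats0; apply: creach0. Qed.

Lemma exec_cat B f g st st1 st2 w1 w2 :
  exec B f st st1 w1 -> exec B g st1 st2 w2 -> exec B (f ++ g) st st2 (w1 ++ w2).
Proof.
move=> [_ R1] [bd R2]; split=> // x pre post ih o.
have := R1 x pre (g ++ post) ih o; rewrite -catA => /creach_trans; apply.
have := R2 x (pre ++ f) post ih (o ++ w1).
by rewrite -!catA !size_cat !addnA.
Qed.

Lemma exec1 B i st st' w : regs_le B st' ->
  (forall code x pc ih o, onth code pc = Some i ->
    cstep code x (CConf pc st ih o) = Some (CConf pc.+1 st' ih (o ++ w))) ->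
  exec B [:: i] st st' w.
Proof.
move=> bd H; split=> // x pre post ih o; rewrite addn1; apply: creach1 => //=.
  by apply/H/onth_at.
by rewrite size_cat /=; lia.
Qed.

Lemma exec_inc B r st : regs_le B st -> st r < B ->
  exec B [:: IInc r] st (upd st r (st r).+1) [::].
Proof.
move=> bd lt; apply: exec1 => [|code x pc ih o E]; first exact: regs_le_upd.
by rewrite /cstep E cats0.
Qed.

Lemma exec_reset B r st : regs_le B st -> exec B [:: IReset r] st (upd st r 0) [::].
Proof.
move=> bd; apply: exec1 => [|code x pc ih o E]; first exact: regs_le_upd.
by rewrite /cstep E cats0.
Qed.

Lemma exec_outb B b st : regs_le B st -> exec B [:: IOutB b] st st [:: b].
Proof. by move=> bd; apply: exec1 => // code x pc ih o E; rewrite /cstep E cats1. Qed.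

Lemma exec_outr B r st : regs_le B st -> exec B [:: IOutR r] st st (enc_nat (st r)).
Proof. by move=> bd; apply: exec1 => // code x pc ih o E; rewrite /cstep E. Qed.

(** The branch for equality comes second; [IJeq r1 r1] is the unconditional jump that skips it after
    the other branch. *)
Definition cif (r1 r2 : nat) (f g : seq instr) : seq instr :=
  IJeq r1 r2 (size g).+2 :: g ++ IJeq r1 r1 (size f).+1 :: f.

Lemma exec_if B r1 r2 f g st st' w : regs_le B st ->
  exec B (if st r1 == st r2 then f else g) st st' w -> exec B (cif r1 r2 f g) st st' w.
Proof.
move=> bd; case: ifP => E [bd' R]; split=> // x pre post ih o.
  apply: (creachS (c1 := CConf (size pre + (size g).+2) st ih o)) => //=.
  - by rewrite (onth_at (pre := pre) erefl) ?E.
  - by rewrite ?size_cat /= ?size_cat /= ?size_cat /=; lia.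
  have := R x (pre ++ IJeq r1 r2 (size g).+2 :: g ++ [:: IJeq r1 r1 (size f).+1]) post ih o.
  rewrite -!catA /= -!catA /= ?size_cat /= ?size_cat /= ?size_cat /= addn1.
  by rewrite -!addnA ?addSn ?addnS ?addSn.
apply: (creachS (c1 := CConf (size pre).+1 st ih o)) => //=.
- by rewrite (onth_at (pre := pre) erefl) ?E.
- by rewrite ?size_cat /= ?size_cat /= ?size_cat /=; lia.
have := R x (rcons pre (IJeq r1 r2 (size g).+2)) (IJeq r1 r1 (size f).+1 :: f ++ post) ih o.
rewrite size_rcons cat_rcons -!catA /= => /creach_trans; apply.
apply: creach1 => //.
  rewrite /cstep (onth_at (pre := pre ++ IJeq r1 r2 (size g).+2 :: g)
    (i := IJeq r1 r1 (size f).+1) (post := f ++ post)); last first.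
  - by rewrite size_cat /=; lia.
  - by rewrite /= -!catA.
  by rewrite /= eqxx size_cat /=; congr (Some (CConf _ _ _ _)); lia.
by rewrite ?size_cat /= ?size_cat /= ?size_cat /=; lia.
Qed.

Definition cloop (i r : nat) (body : seq instr) : seq instr :=
  IReset i :: IJeq i r (size body).+3 :: body ++ [:: IInc i; IBack (size body).+2].

(** The invariant is restated after the counter has been incremented, so it may speak of all
    registers. The counter never exceeds the value of [r], which is within [B]. *)
Lemma exec_loop B i r body n st (I : nat -> (nat -> nat) -> Prop) (w : nat -> seq bool) :
  regs_le B st -> st r = n -> i != r -> I 0 (upd st i 0) ->
  (forall k st, k < n -> regs_le B st -> I k st -> st i = k -> st r = n ->
    exists2 st', exec B body st st' (w k) &
      [/\ st' i = k, st' r = n & I k.+1 (upd st' i k.+1)]) ->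
  exists2 st', exec B (cloop i r body) st st' (flatten [seq w k | k <- iota 0 n]) &
    [/\ st' i = n, st' r = n & I n st'].
Proof.
move=> bd Er ne I0 step.
have sz : size (cloop i r body) = size body + 4 by rewrite /= size_cat addnS /=; lia.
have gen m k st1 : m + k = n -> regs_le B st1 -> I k st1 -> st1 i = k -> st1 r = n ->
  exists2 st', regs_le B st' /\ forall x pre post ih o,
    creach (pre ++ cloop i r body ++ post) x B
    (CConf (size pre).+1 st1 ih o)
    (CConf (size pre + (size body + 4)) st' ih
           (o ++ flatten [seq w k | k <- iota k m])) &
    [/\ st' i = n, st' r = n & I n st'].
  elim: m k st1 => [|m IH] k st1 Emk bd1 Ik Ei1 Er1.
    rewrite add0n in Emk; rewrite Emk in Ik Ei1; rewrite Emk.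
    exists st1; last by split.
    split=> // x pre post ih o; rewrite cats0.
    apply: creach1 => //; last by rewrite !size_cat sz /=; lia.
    rewrite /cstep (onth_at (pre := rcons pre (IReset i)) (i := IJeq i r (size body).+3)
      (post := (body ++ [:: IInc i; IBack (size body).+2]) ++ post)) ?size_rcons ?cat_rcons //=.
    by rewrite Ei1 Er1 eqxx; congr (Some (CConf _ _ _ _)); lia.
  have lt : k < n by lia.
  have [st2 [bd2 R2] [Ei2 Er2 I2]] := step k st1 lt bd1 Ik Ei1 Er1.
  have ltB : k.+1 <= B by rewrite (leq_trans lt) // -Er.
  have [|||||st' [bd' R'] I'] := IH k.+1 (upd st2 i k.+1).
  - by lia.
  - exact: regs_le_upd.
  - exact: I2.
  - by rewrite /upd eqxx.
  - by rewrite /upd eq_sym (negPf ne).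
  exists st' => //; split=> // x pre post ih o.
  apply: (creachS (c1 := CConf (size pre).+2 st1 ih o)) => //.
  - rewrite /cstep (onth_at (pre := rcons pre (IReset i)) (i := IJeq i r (size body).+3)
      (post := (body ++ [:: IInc i; IBack (size body).+2]) ++ post)) ?size_rcons ?cat_rcons //=.
    by rewrite Ei1 Er1 (ltn_eqF lt).
  - by rewrite !size_cat sz /=; lia.
  have := R2 x (pre ++ [:: IReset i; IJeq i r (size body).+3])
               ([:: IInc i; IBack (size body).+2] ++ post) ih o.
  have Ecode : (pre ++ [:: IReset i; IJeq i r (size body).+3]) ++ body ++
    [:: IInc i; IBack (size body).+2] ++ post = pre ++ cloop i r body ++ post.
    by rewrite /cloop -!catA /= -!catA.
  rewrite Ecode size_cat addn2 => /creach_trans; apply.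
  apply: (creachS (c1 := CConf ((size pre).+2 + size body).+1 (upd st2 i k.+1) ih (o ++ w k))).
  - rewrite /cstep -Ecode catA (onth_at (pre := (pre ++ [:: IReset i; IJeq i r (size body).+3]) ++ body) erefl).
      by rewrite Ei2.
    by rewrite !size_cat /=; lia.
  - by rewrite !size_cat sz /=; lia.
  - exact: regs_le_upd.
  apply: (creachS (c1 := CConf (size pre).+1 (upd st2 i k.+1) ih (o ++ w k))).
  - rewrite /cstep -Ecode catA (onth_at (pre := (pre ++ [:: IReset i; IJeq i r (size body).+3]) ++ body ++ [:: IInc i])
      (i := IBack (size body).+2) (post := post)).
    + by congr (Some (CConf _ _ _ _)); lia.
    + by rewrite -!catA.
    by rewrite !size_cat /=; lia.
  - by rewrite !size_cat sz /=; lia.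
  - exact: regs_le_upd.
  by rewrite /= catA; apply: R'.
have [||||| st' [bd' R'] I'] := gen n 0 (upd st i 0).
- by rewrite addn0.
- exact: regs_le_upd.
- exact: I0.
- by rewrite /upd eqxx.
- by rewrite /upd eq_sym (negPf ne).
exists st' => //; split=> // x pre post ih o; rewrite sz.
apply: (creachS (c1 := CConf (size pre).+1 (upd st i 0) ih o)).
- by rewrite /cstep (onth_at (pre := pre) erefl).
- by rewrite !size_cat sz /=; lia.
- exact: regs_le_upd.
exact: R'.
Qed.

(** * Compiling arithmetic expressions *)

Inductive expr :=
| EVar of nat
| ECst of nat
| EAdd of expr & expr
| EMul of expr & expr
| EDiv of expr & expr
| EMod of expr & expr
| ELog of expr.

Fixpoint eval (env : nat -> nat) (e : expr) : nat :=
  match e with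
  | EVar v => env v
  | ECst c => c
  | EAdd a b => eval env a + eval env b
  | EMul a b => eval env a * eval env b
  | EDiv a b => eval env a %/ eval env b
  | EMod a b => eval env a %% eval env b
  | ELog a => trunc_log 2 (eval env a).+1
  end.

Fixpoint expr_wf (d : nat) (e : expr) : bool :=
  match e with
  | EVar v => v < d
  | ECst _ => true
  | EAdd a b | EMul a b | EDiv a b | EMod a b => expr_wf d a && expr_wf d b
  | ELog a => expr_wf d a
  end.

(** Bounds every register that the compiled code uses, not only the value; hence the sums for
    quotient and remainder and the doubling for the logarithm. *)
Fixpoint expr_bound (e : expr) (X : nat) : nat :=
  match e with
  | EVar _ => X
  | ECst c => c
  | EAdd a b | EDiv a b | EMod a b => expr_bound a X + expr_bound b X
  | EMul a b => expr_bound a X * expr_bound b X + expr_bound a X + expr_bound b X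
  | ELog a => (expr_bound a X).*2 + 2
  end.

Lemma eval_ext d env env' e : expr_wf d e -> (forall r, r < d -> env r = env' r) ->
  eval env e = eval env' e.
Proof.
move=> wf E; elim: e wf => //= [a IHa b IHb|a IHa b IHb|a IHa b IHb|a IHa b IHb|a IHa].
- by case/andP=> /IHa -> /IHb ->.
- by case/andP=> /IHa -> /IHb ->.
- by case/andP=> /IHa -> /IHb ->.
- by case/andP=> /IHa -> /IHb ->.
by move/IHa ->.
Qed.

Lemma expr_wfW d d' e : d <= d' -> expr_wf d e -> expr_wf d' e.
Proof.
move=> le; elim: e => //= [v|a IHa b IHb|a IHa b IHb|a IHa b IHb|a IHa b IHb].
- lia.
- by case/andP=> /IHa -> /IHb ->.
- by case/andP=> /IHa -> /IHb ->.
- by case/andP=> /IHa -> /IHb ->.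
- by case/andP=> /IHa -> /IHb ->.
Qed.

Lemma trunc_log_le n : trunc_log 2 n.+1 <= n.
Proof.
by have := trunc_logP (isT : 1 < 2) (ltn0Sn n); have := ltn_expl (trunc_log 2 n.+1) (isT : 1 < 2); lia.
Qed.

Lemma eval_le d env e X : expr_wf d e -> (forall r, r < d -> env r <= X) ->
  eval env e <= expr_bound e X.
Proof.
move=> wf le; elim: e wf => //= [a IHa b IHb|a IHa b IHb|a IHa b IHb|a IHa b IHb|a IHa].
- by move=> /andP [/IHa la /IHb lb]; rewrite leq_add.
- by move=> /andP [/IHa la /IHb lb]; have := leq_mul la lb; lia.
- by move=> /andP [/IHa la /IHb lb]; have := leq_div (eval env a) (eval env b); lia.
- by move=> /andP [/IHa la /IHb lb]; have := leq_mod (eval env a) (eval env b); lia.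
- by move=> /IHa la; have := trunc_log_le (eval env a); lia.
Qed.

(* [compile e d] leaves the value of [e] in register [d], using only registers
   from [d] on. *)
Fixpoint compile (e : expr) (d : nat) : seq instr :=
  match e with
  | EVar v => cloop d v [::]
  | ECst c => IReset d :: nseq c (IInc d)
  | EAdd a b => compile a d ++ compile b d.+1 ++ cloop d.+2 d.+1 [:: IInc d]
  | EMul a b => compile a d.+1 ++ compile b d.+2 ++ IReset d ::
                cloop d.+3 d.+1 (cloop d.+4 d.+2 [:: IInc d])
  | EDiv a b => compile a d.+2 ++ compile b d.+3 ++ IReset d :: IReset d.+1 ::
      cloop d.+4 d.+2 (IInc d.+1 :: cif d.+1 d.+3 [:: IReset d.+1; IInc d] [::])
  | EMod a b => compile a d.+2 ++ compile b d.+3 ++ IReset d.+1 :: IReset d ::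
      cloop d.+4 d.+2 (IInc d :: cif d d.+3 [:: IReset d; IInc d.+1] [::])
  | ELog a => compile a d.+3 ++
      [:: IReset d; IReset d.+1; IInc d.+1; IReset d.+2] ++
      cloop d.+4 d.+3 (IInc d.+2 :: cif d.+2 d.+1
        ([:: IReset d.+2; IInc d] ++ cloop d.+4.+1 d.+1 [::] ++
         cloop d.+4.+2 d.+4.+1 [:: IInc d.+1]) [::])
  end.

Lemma updE st r v : upd st r v r = v.
Proof. by rewrite /upd eqxx. Qed.

Lemma updN st r v r' : r' != r -> upd st r v r' = st r'.
Proof. by rewrite /upd => /negPf ->. Qed.

Ltac upd_simp := repeat (rewrite updE || (rewrite updN; last by lia)).

Lemma exec_mov B d r st : regs_le B st -> d != r ->
  exists2 st', exec B (cloop d r [::]) st st' [::] &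
    st' d = st r /\ forall r', r' != d -> st' r' = st r'.
Proof.
move=> bd ne.
have [||st' ex [E1 E2 I]] := exec_loop (B := B) (i := d) (r := r) (body := [::]) (n := st r)
  (I := fun k st1 => forall r', r' != d -> st1 r' = st r') (w := fun=> [::]) bd erefl ne.
- by move=> r' ne'; rewrite updN.
- move=> k st1 lt bd1 I1 E1 E2; exists st1; first exact: exec_nil.
  by split=> // r' ne'; rewrite updN // I1.
exists st' => //; move: ex; suff -> : flatten [seq [::] | _ <- iota 0 (st r)] = [::] :> seq bool by [].
by elim: (iota _ _).
Qed.

Lemma flatten_nil (T : Type) s : flatten [seq [::] | _ : nat <- s] = [::] :> seq T.
Proof. by elim: s. Qed.

Lemma exec_add B d i r st : regs_le B st -> st d + st r <= B -> i != r -> i != d -> r != d ->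
  exists2 st', exec B (cloop i r [:: IInc d]) st st' [::] &
    st' d = st d + st r /\ forall r', r' != d -> r' != i -> st' r' = st r'.
Proof.
move=> bd le ne ne' ne2.
have [||st' ex [E1 E2 [E3 I]]] := exec_loop (B := B) (i := i) (r := r) (body := [:: IInc d]) (n := st r)
  (I := fun k st1 => st1 d = st d + k /\ forall r', r' != d -> r' != i -> st1 r' = st r')
  (w := fun=> [::]) bd erefl ne.
- by split=> [|r' n1 n2]; rewrite updN ?addn0 // eq_sym.
- move=> k st1 lt bd1 [I1 I2] E1 E2; exists (upd st1 d (st1 d).+1).
    by apply: exec_inc => //; lia.
  split; first by rewrite updN.
    by rewrite updN.
  split=> [|r' n1 n2]; first by rewrite updN 1?eq_sym // updE I1 addnS.
  by rewrite !updN // I2.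
by exists st'; first by move: ex; rewrite flatten_nil.
Qed.

Section Divmod.
Variables (B d q m : nat).
Hypothesis qm : (q, m) \in [:: (d, d.+1); (d.+1, d)].

(** The dividend is counted off; whenever [m] reaches the divisor, it is reset and [q] is
    incremented. A divisor 0 is never reached, in agreement with [k %/ 0 = 0] and [k %% 0 = k]. The
    two orders of [q] and [m] serve [EDiv] and [EMod], whose results must land in [d]. *)
Lemma exec_divmod st : regs_le B st -> st d.+2 <= B ->
  exists2 st', exec B (IReset q :: IReset m ::
     cloop d.+4 d.+2 (IInc m :: cif m d.+3 [:: IReset m; IInc q] [::])) st st' [::] &
    [/\ st' q = st d.+2 %/ st d.+3, st' m = st d.+2 %% st d.+3 &
        forall r, r < d -> st' r = st r].
Proof.
have [qm1 qm2 qm3] : [/\ q != m, q < d.+2 & m < d.+2].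
  by move: qm; rewrite !inE => /orP [] /eqP [-> ->]; split; lia.
have qdm : d <= q /\ d <= m by move: qm; rewrite !inE => /orP [] /eqP [-> ->]; lia.
move=> bd le; set st1 := upd (upd st q 0) m 0.
have bd1 : regs_le B st1 by apply/regs_le_upd/leq0n/regs_le_upd.
have E2 : st1 d.+2 = st d.+2 by rewrite /st1; upd_simp.
have E3 : st1 d.+3 = st d.+3 by rewrite /st1; upd_simp.
have [|||st' ex [_ _ [H1 H2 H3]]] := exec_loop (B := B) (i := d.+4) (r := d.+2)
  (body := IInc m :: cif m d.+3 [:: IReset m; IInc q] [::]) (n := st d.+2)
  (I := fun k s => [/\ s q = k %/ st d.+3, s m = k %% st d.+3 &
     forall r, r < d \/ r = d.+3 -> s r = st r]) (w := fun=> [::]) bd1 E2.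
- by lia.
- rewrite div0n mod0n /st1; split; [upd_simp.. | move=> r lt].
  + by [].
  + by [].
  + by upd_simp.
- move=> k s lt bds [I1 I2 I3] Ei Er.
  have E3s : s d.+3 = st d.+3 by apply: I3; right.
  have lem : s m < B by rewrite I2; apply: leq_ltn_trans (leq_mod _ _) _; lia.
  have exm := exec_inc bds lem.
  set s1 := upd s m (s m).+1 in exm *.
  have bd1s : regs_le B s1 by case: exm.
  have E1m : s1 m = (s m).+1 by rewrite /s1; upd_simp.
  have E13 : s1 d.+3 = st d.+3 by rewrite /s1; upd_simp.
  case: (boolP (s1 m == s1 d.+3)) => [eq|neq].
    have [eqk b0] : k.+1 = (k %/ st d.+3).+1 * st d.+3 /\ 0 < st d.+3.
      move: eq; rewrite E1m E13 I2 => /eqP eq; have := divn_eq k (st d.+3).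
      by rewrite mulSn; lia.
    exists (upd (upd s1 m 0) q (s1 q).+1).
      apply: (exec_cat (f := [:: IInc m]) (w1 := [::]) (w2 := [::]) exm).
      apply: exec_if => //; rewrite eq.
      apply: (exec_cat (f := [:: IReset m]) (w1 := [::]) (w2 := [::])); first exact: exec_reset.
      have -> : s1 q = upd s1 m 0 q by upd_simp.
      apply: exec_inc; first exact: regs_le_upd.
      upd_simp; rewrite /s1; upd_simp; rewrite I1.
      by apply: leq_ltn_trans (leq_div _ _) _; lia.
    split; [by rewrite /s1; upd_simp.. |].
    split; last by move=> r lt'; rewrite /s1; upd_simp; apply: I3.
      by upd_simp; rewrite eqk mulnK // /s1; upd_simp; rewrite I1.
    by upd_simp; rewrite eqk modnMl.
  exists s1.
    apply: (exec_cat (f := [:: IInc m]) (w1 := [::]) (w2 := [::]) exm).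
    by apply: exec_if => //; rewrite (negPf neq); apply: exec_nil.
  split; [by rewrite /s1; upd_simp.. |].
  have [Ed Em] : k.+1 %/ st d.+3 = k %/ st d.+3 /\ k.+1 %% st d.+3 = (k %% st d.+3).+1.
    move: neq; rewrite E1m E13 I2 => neq.
    case: (posnP (st d.+3)) => [->|b0]; first by rewrite !divn0 !modn0.
    have lt' : (k %% st d.+3).+1 < st d.+3 by rewrite ltn_neqAle neq ltn_pmod.
    have -> : k.+1 = k %/ st d.+3 * st d.+3 + (k %% st d.+3).+1 by rewrite addnS -divn_eq.
    by rewrite divnMDl // (divn_small lt') addn0 modnMDl (modn_small lt').
  split; last by move=> r lt'; rewrite /s1; upd_simp; apply: I3.
    by rewrite Ed /s1; upd_simp.
  by rewrite Em /s1; upd_simp; rewrite I2.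
rewrite flatten_nil in ex.
exists st'; last by split=> // r lt; apply: H3; left.
apply: (exec_cat (f := [:: IReset q]) (w1 := [::]) (w2 := [::])); first exact: exec_reset.
apply: (exec_cat (f := [:: IReset m]) (w1 := [::]) (w2 := [::])) ex.
by apply: exec_reset; apply: regs_le_upd.
Qed.
End Divmod.

Lemma exec_mul B d st : regs_le B st -> st d.+1 * st d.+2 <= B ->
  exists2 st', exec B (IReset d :: cloop d.+3 d.+1 (cloop d.+4 d.+2 [:: IInc d])) st st' [::] &
    st' d = st d.+1 * st d.+2 /\ forall r, r < d -> st' r = st r.
Proof.
move=> bd le; set st1 := upd st d 0.
have bd1 : regs_le B st1 by apply: regs_le_upd.
have E1 : st1 d.+1 = st d.+1 by rewrite /st1; upd_simp.
have [|||st' ex [_ _ [H1 [H2 H3]]]] := exec_loop (B := B) (i := d.+3) (r := d.+1)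
  (body := cloop d.+4 d.+2 [:: IInc d]) (n := st d.+1)
  (I := fun k s => s d = k * st d.+2 /\ (s d.+2 = st d.+2 /\
     forall r, r < d -> s r = st r)) (w := fun=> [::]) bd1 E1.
- by lia.
- by rewrite /st1 mul0n; split; [|split=> [|r lt]]; upd_simp.
- move=> k s lt bds [I1 [I2 I3]] Ei Er.
  have leB : s d + s d.+2 <= B.
    by rewrite I1 I2 addnC -mulSn (leq_trans _ le) // leq_mul2r lt orbT.
  have [|||s' exs [Ed Es]] := exec_add (B := B) (d := d) (i := d.+4) (r := d.+2) bds leB; [lia..|].
  exists s' => //; split; [by rewrite Es //; lia.. |].
  split; first by upd_simp; rewrite Ed I1 I2 mulSn addnC.
  split=> [|r ltr]; upd_simp; rewrite Es ?I2 ?I3 //; lia.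
rewrite flatten_nil in ex.
exists st'; last by [].
apply: (exec_cat (f := [:: IReset d]) (w1 := [::]) (w2 := [::])) ex; exact: exec_reset.
Qed.

(** For the count plus one, [d] holds the logarithm, [d.+1] the corresponding power of 2 and [d.+2]
    the excess over it. When the excess reaches the power, the power is doubled by adding a copy of
    itself. *)
Lemma exec_log B d st : regs_le B st -> (st d.+3).*2 + 2 <= B ->
  exists2 st', exec B ([:: IReset d; IReset d.+1; IInc d.+1; IReset d.+2] ++
      cloop d.+4 d.+3 (IInc d.+2 :: cif d.+2 d.+1
        ([:: IReset d.+2; IInc d] ++ cloop d.+4.+1 d.+1 [::] ++
         cloop d.+4.+2 d.+4.+1 [:: IInc d.+1]) [::])) st st' [::] &
    st' d = trunc_log 2 (st d.+3).+1 /\ forall r, r < d -> st' r = st r.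
Proof.
move=> bd le; set st0 := upd (upd st d 0) d.+1 0; set st1 := upd (upd st0 d.+1 (st0 d.+1).+1) d.+2 0.
have bd0 : regs_le B st0 by do 2!(apply: regs_le_upd; last by lia).
have E01 : st0 d.+1 = 0 by rewrite /st0; upd_simp.
have bd1 : regs_le B st1 by apply: regs_le_upd => //; apply: regs_le_upd => //; rewrite E01; lia.
have E1 : st1 d.+3 = st d.+3 by rewrite /st1 /st0; upd_simp.
have [|||st' ex [_ _ [H1 [H2 H3]]]] := exec_loop (B := B) (i := d.+4) (r := d.+3)
  (body := IInc d.+2 :: cif d.+2 d.+1
        ([:: IReset d.+2; IInc d] ++ cloop d.+4.+1 d.+1 [::] ++
         cloop d.+4.+2 d.+4.+1 [:: IInc d.+1]) [::]) (n := st d.+3)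
  (I := fun k s => s d.+1 = 2 ^ s d /\ ((s d.+2 < 2 ^ s d) && (k.+1 == 2 ^ s d + s d.+2) /\
     forall r, r < d -> s r = st r)) (w := fun=> [::]) bd1 E1.
- by lia.
- by rewrite /st1 E01 /st0; split; [|split=> [|r lt]]; upd_simp.
- move=> k s lt bds [I1 [/andP [I2 /eqP I3] I4]] Ei Er.
  have exm : exec B [:: IInc d.+2] s (upd s d.+2 (s d.+2).+1) [::].
    by apply: exec_inc => //; lia.
  set s1 := upd s d.+2 (s d.+2).+1 in exm.
  have bd1s : regs_le B s1 by case: exm.
  have [F0 F1 F2] : [/\ s1 d = s d, s1 d.+1 = s d.+1 & s1 d.+2 = (s d.+2).+1].
    by rewrite /s1; split; upd_simp.
  have F s' : (forall r, r < d -> s' r = s1 r) -> forall r, r < d -> s' r = st r.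
    by move=> H r ltr; rewrite H // /s1; upd_simp; apply: I4.
  case: (boolP (s1 d.+2 == s1 d.+1)) => [eq|neq].
    have eqk : k.+2 = 2 ^ (s d).+1 by move/eqP: eq; rewrite F1 F2 expnS; lia.
    have lt2 : s d < 2 ^ s d := ltn_expl (s d) (isT : 1 < 2).
    have dlt : upd s1 d.+2 0 d < B by upd_simp; rewrite F0; lia.
    have bd2 : regs_le B (upd s1 d.+2 0) by apply: regs_le_upd.
    have exd := exec_inc bd2 dlt.
    set s2 := upd (upd s1 d.+2 0) d _ in exd.
    have bd2s : regs_le B s2 by case: exd.
    have [|s3 ex3 [G1 G2]] := exec_mov (d := d.+4.+1) (r := d.+1) bd2s; first by lia.
    have bd3 : regs_le B s3 by case: ex3.
    have G3 : s3 d.+1 = 2 ^ s d by rewrite G2 /s2; [upd_simp; rewrite F1 | lia].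
    have G4 : s3 d.+4.+1 = 2 ^ s d by rewrite G1 /s2; upd_simp; rewrite F1.
    have [|||| s4 ex4 [J1 J2]] := exec_add (B := B) (d := d.+1) (i := d.+4.+2) (r := d.+4.+1) bd3;
      [by rewrite G3 G4; move: eqk; rewrite expnS; lia | lia..|].
    have K0 : s4 d = (s d).+1 by rewrite J2 ?G2 /s2; [upd_simp; rewrite F0 | lia..].
    exists s4.
      apply: (exec_cat (f := [:: IInc d.+2]) (w1 := [::]) (w2 := [::]) exm).
      apply: exec_if => //; rewrite eq.
      apply: (exec_cat (f := [:: IReset d.+2]) (w1 := [::]) (w2 := [::])); first exact: exec_reset.
      apply: (exec_cat (f := [:: IInc d]) (w1 := [::]) (w2 := [::]) exd).
      exact: (exec_cat (w1 := [::]) (w2 := [::]) ex3 ex4).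
    split; [by rewrite J2 ?G2 /s2 /s1; [upd_simp | lia..].. |].
    split; first by upd_simp; rewrite K0 J1 G3 G4 expnS; lia.
    split; last first.
      move=> r ltr; upd_simp; move: r ltr; apply: F => r ltr.
      by rewrite J2 ?G2 /s2; [upd_simp | lia..].
    upd_simp; rewrite K0.
    have -> : s4 d.+2 = 0 by rewrite J2 ?G2 /s2; [upd_simp | lia..].
    by rewrite expn_gt0 addn0 eqk eqxx.
  exists s1.
    apply: (exec_cat (f := [:: IInc d.+2]) (w1 := [::]) (w2 := [::]) exm).
    by apply: exec_if => //; rewrite (negPf neq); apply: exec_nil.
  split; [by rewrite /s1; upd_simp.. |].
  split; first by upd_simp; rewrite F0 F1.
  split; last by move=> r ltr; upd_simp; move: r ltr; apply: F.
  by upd_simp; rewrite F0 F2; move: neq; rewrite F1 F2; lia.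
rewrite flatten_nil in ex.
exists st'; last first.
  split=> //; apply/esym/trunc_log_eq => //; move/andP: H2 => [h1 /eqP h2].
  by rewrite h2 expnS; lia.
apply: (exec_cat (w1 := [::]) (w2 := [::])) ex.
apply: (exec_cat (f := [:: IReset d]) (st1 := upd st d 0) (w1 := [::]) (w2 := [::])).
  exact: exec_reset.
apply: (exec_cat (f := [:: IReset d.+1]) (st1 := st0) (w1 := [::]) (w2 := [::])).
  by apply: exec_reset; apply: regs_le_upd.
apply: (exec_cat (f := [:: IInc d.+1]) (st1 := upd st0 d.+1 (st0 d.+1).+1) (w1 := [::]) (w2 := [::])).
  by apply: exec_inc => //; rewrite E01; lia.
by apply: exec_reset; apply: regs_le_upd => //; rewrite E01; lia.
Qed.

(** Variables lie below [v], scratch registers start at [d]: compiling operands into successive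
    registers disturbs neither the variables nor earlier results. *)
Definition compile_spec (v : nat) (e : expr) : Prop := forall d B X st,
  expr_wf v e -> v <= d -> regs_le B st -> (forall r, r < v -> st r <= X) ->
  expr_bound e X <= B ->
  exists2 st', exec B (compile e d) st st' [::] &
    st' d = eval st e /\ forall r, r < d -> st' r = st r.

Lemma compile_two v a b d1 d2 B X st : compile_spec v a -> compile_spec v b ->
  expr_wf v a && expr_wf v b -> v <= d1 -> d1 < d2 -> regs_le B st ->
  (forall r, r < v -> st r <= X) -> expr_bound a X <= B -> expr_bound b X <= B ->
  exists2 st', exec B (compile a d1 ++ compile b d2) st st' [::] &
    [/\ regs_le B st', st' d1 = eval st a, st' d2 = eval st b &
        forall r, r < d1 -> st' r = st r].
Proof.
move=> Ha Hb /andP [wa wb] le1 le2 bd lX la lb.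
have [s1 ex1 [E1 F1]] := Ha d1 B X st wa le1 bd lX la.
have bd1 : regs_le B s1 by case: ex1.
have [|r ltr|s2 ex2 [E2 F2]] := Hb d2 B X s1 wb _ bd1 _ lb; first by lia.
  by rewrite F1 ?lX //; lia.
exists s2; first exact: (exec_cat (w1 := [::]) (w2 := [::]) ex1 ex2).
split; [by case: ex2 | by rewrite F2 | | by move=> r ltr; rewrite F2 ?F1 //; lia].
by rewrite E2; apply: eval_ext wb _ => r ltr; rewrite F1 //; lia.
Qed.

Lemma exec_inc_iter B d c st : regs_le B st -> st d + c <= B ->
  exists2 st', exec B (nseq c (IInc d)) st st' [::] &
    st' d = st d + c /\ forall r, r != d -> st' r = st r.
Proof.
elim: c st => [|c IH] st bd le; first by exists st; rewrite ?addn0 //; apply: exec_nil.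
have bd1 : regs_le B (upd st d (st d).+1) by apply: regs_le_upd => //; lia.
have [|st' ex [E F]] := IH _ bd1; first by rewrite updE; lia.
exists st'.
  by apply: (exec_cat (f := [:: _]) (w1 := [::]) (w2 := [::])) ex; apply: exec_inc => //; lia.
by rewrite E updE addSnnS; split=> // r ne; rewrite F // updN.
Qed.

Lemma compile_exec v e : compile_spec v e.
Proof.
elim: e => [w|c|a IHa b IHb|a IHa b IHb|a IHa b IHb|a IHa b IHb|a IHa] d B X st /= wf le bd lX leB.
- have [|st' ex [E F]] := exec_mov (d := d) (r := w) bd; first by lia.
  by exists st' => //; split=> // r ltr; apply: F; lia.
- have bd0 : regs_le B (upd st d 0) by apply: regs_le_upd.
  have [|st' ex [E F]] := exec_inc_iter (d := d) (c := c) bd0; first by rewrite updE.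
  exists st'; last first.
    by rewrite E updE; split=> // r ltr; rewrite F ?updN //; lia.
  by apply: (exec_cat (f := [:: _]) (w1 := [::]) (w2 := [::])) ex; apply: exec_reset.
- have [s1 ex1 [bd1 E1 E2 F1]] := compile_two IHa IHb wf le (ltnSn d) bd lX
    (leq_trans (leq_addr _ _) leB) (leq_trans (leq_addl _ _) leB).
  have [va vb] : eval st a <= expr_bound a X /\ eval st b <= expr_bound b X.
    by case/andP: wf => wa wb; split; apply: (eval_le (d := v)).
  have [|||| s2 ex2 [E3 F2]] := exec_add (B := B) (d := d) (i := d.+2) (r := d.+1) bd1;
    [by rewrite E1 E2; lia | lia.. |].
  exists s2; last by rewrite E3 E1 E2; split=> // r ltr; rewrite F2 ?F1 //; lia.
  by rewrite catA; exact: (exec_cat (w1 := [::]) (w2 := [::]) ex1 ex2).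
- have [|||| s1 ex1 [bd1 E1 E2 F1]] := compile_two (d1 := d.+1) (d2 := d.+2) IHa IHb wf _ _ bd lX; [lia.. |].
  have [va vb] : eval st a <= expr_bound a X /\ eval st b <= expr_bound b X.
    by case/andP: wf => wa wb; split; apply: (eval_le (d := v)).
  have [| s2 ex2 [E3 F2]] := exec_mul (d := d) bd1.
    by rewrite E1 E2; have := leq_mul va vb; lia.
  exists s2; last by rewrite E3 E1 E2; split=> // r ltr; rewrite F2 ?F1 //; lia.
  by rewrite catA; exact: (exec_cat (w1 := [::]) (w2 := [::]) ex1 ex2).
- have [|||| s1 ex1 [bd1 E1 E2 F1]] := compile_two (d1 := d.+2) (d2 := d.+3) IHa IHb wf _ _ bd lX; [lia.. |].
  have [|| s2 ex2 [E3 E4 F2]] := exec_divmod (d := d) (q := d) (m := d.+1) _ bd1.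
  + by rewrite inE eqxx.
  + by rewrite E1 (leq_trans _ leB) // (leq_trans _ (leq_addr _ _)) //; case/andP: wf => wa _; apply: (eval_le (d := v)).
  exists s2; last by rewrite E3 E1 E2; split=> // r ltr; rewrite F2 ?F1 //; lia.
  by rewrite catA; exact: (exec_cat (w1 := [::]) (w2 := [::]) ex1 ex2).
- have [|||| s1 ex1 [bd1 E1 E2 F1]] := compile_two (d1 := d.+2) (d2 := d.+3) IHa IHb wf _ _ bd lX; [lia.. |].
  have [|| s2 ex2 [E3 E4 F2]] := exec_divmod (d := d) (q := d.+1) (m := d) _ bd1.
  + by rewrite !inE eqxx orbT.
  + by rewrite E1 (leq_trans _ leB) // (leq_trans _ (leq_addr _ _)) //; case/andP: wf => wa _; apply: (eval_le (d := v)).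
  exists s2; last by rewrite E4 E1 E2; split=> // r ltr; rewrite F2 ?F1 //; lia.
  by rewrite catA; exact: (exec_cat (w1 := [::]) (w2 := [::]) ex1 ex2).
have [||s1 ex1 [E1 F1]] := IHa d.+3 B X st wf _ bd lX; [lia.. |].
have bd1 : regs_le B s1 by case: ex1.
have va := eval_le wf lX.
have [|s2 ex2 [E3 F2]] := exec_log (d := d) bd1; first by rewrite E1; lia.
exists s2; last by rewrite E3 E1; split=> // r ltr; rewrite F2 ?F1 //; lia.
exact: (exec_cat (w1 := [::]) (w2 := [::]) ex1 ex2).
Qed.

(** * Compiling gate generators *)

Inductive gate_expr :=
| XInput of expr
| XConst of bool
| XNot of expr
| XAnd of expr & expr
| XOr of expr & expr.

Definition eval_gate (env : nat -> nat) (g : gate_expr) : gate :=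
  match g with
  | XInput e => GInput (eval env e)
  | XConst b => GConst b
  | XNot e => GNot (eval env e)
  | XAnd e1 e2 => GAnd (eval env e1) (eval env e2)
  | XOr e1 e2 => GOr (eval env e1) (eval env e2)
  end.

(* Programs at level [d] use the variables below [d]. [PFor e p] runs [p], at level
   [d.+2], with variable [d] ranging below [e], whose value is kept in variable [d.+1]. *)
Inductive gprog :=
| PSeq of gprog & gprog
| PFor of expr & gprog
| PLe of expr & expr & gprog & gprog
| PEmit of gate_expr.

Fixpoint gsem (p : gprog) (d : nat) (env : nat -> nat) : seq gate :=
  match p with
  | PSeq p q => gsem p d env ++ gsem q d env
  | PFor e p =>
      flatten [seq gsem p d.+2 (upd (upd env d.+1 (eval env e)) d i) | i <- iota 0 (eval env e)]
  | PLe e1 e2 p q => if eval env e1 <= eval env e2 then gsem p d env else gsem q d env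
  | PEmit g => [:: eval_gate env g]
  end.

Definition gate_args (g : gate_expr) : seq expr :=
  match g with
  | XInput e | XNot e => [:: e]
  | XConst _ => [::]
  | XAnd e1 e2 | XOr e1 e2 => [:: e1; e2]
  end.

Definition gate_tag (g : gate_expr) : seq bool :=
  match g with
  | XInput _ => [:: false; false; false]
  | XConst b => [:: false; false; true; b]
  | XNot _ => [:: false; true; false]
  | XAnd _ _ => [:: false; true; true]
  | XOr _ _ => [:: true; false; false]
  end.

Lemma enc_gateE env g : enc_gate (eval_gate env g) =
  gate_tag g ++ flatten [seq enc_nat (eval env e) | e <- gate_args g].
Proof. by case: g => [e|b|e|e1 e2|e1 e2] /=; rewrite ?cats0. Qed.

Fixpoint gprog_wf (d : nat) (p : gprog) : bool :=
  match p with
  | PSeq p q => gprog_wf d p && gprog_wf d q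
  | PFor e p => expr_wf d e && gprog_wf d.+2 p
  | PLe e1 e2 p q => [&& expr_wf d e1, expr_wf d e2, gprog_wf d p & gprog_wf d q]
  | PEmit g => all (expr_wf d) (gate_args g)
  end.

(** The counter and the limit of a loop are new variables bounded through [e], hence the enlarged
    argument for the body. *)
Fixpoint gprog_bound (p : gprog) (X : nat) : nat :=
  match p with
  | PSeq p q => gprog_bound p X + gprog_bound q X
  | PFor e p => expr_bound e X + gprog_bound p (X + expr_bound e X)
  | PLe e1 e2 p q => expr_bound e1 X + expr_bound e2 X + gprog_bound p X + gprog_bound q X + 2
  | PEmit g => sumn [seq expr_bound e X | e <- gate_args g]
  end.

(* [e1 <= e2] is tested as [(e2 + 1) %/ (e1 + 1) != 0]. *)
Fixpoint gcompile (p : gprog) (d : nat) : seq instr :=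
  match p with
  | PSeq p q => gcompile p d ++ gcompile q d
  | PFor e p => compile e d.+1 ++ cloop d d.+1 (gcompile p d.+2)
  | PLe e1 e2 p q =>
      compile (EDiv (EAdd e2 (ECst 1)) (EAdd e1 (ECst 1))) d ++ IReset d.+1 ::
      cif d d.+1 (gcompile q d) (gcompile p d)
  | PEmit g => map IOutB (gate_tag g) ++
               flatten [seq compile e d ++ [:: IOutR d] | e <- gate_args g]
  end.

Lemma gsem_ext p d env env' : gprog_wf d p -> (forall r, r < d -> env r = env' r) ->
  gsem p d env = gsem p d env'.
Proof.
elim: p d env env' => [p IHp q IHq|e p IHp|e1 e2 p IHp q IHq|g] d env env' /=.
- by move=> /andP [wp wq] E; rewrite (IHp _ _ _ wp E) (IHq _ _ _ wq E).
- move=> /andP [we wp] E; rewrite (eval_ext we E); congr flatten; apply: eq_map => i.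
  by apply: IHp => // r lt; rewrite /upd; do 2!(case: eqP => // ?); apply: E; lia.
- move=> /and4P [w1 w2 wp wq] E; rewrite (eval_ext w1 E) (eval_ext w2 E).
  by rewrite (IHp _ _ _ wp E) (IHq _ _ _ wq E).
- case: g => [e|b|e|e1 e2|e1 e2] //=; rewrite ?andbT.
  + by move=> w E; rewrite (eval_ext w E).
  + by move=> w E; rewrite (eval_ext w E).
  + by case/andP=> w1 w2 E; rewrite (eval_ext w1 E) (eval_ext w2 E).
  + by case/andP=> w1 w2 E; rewrite (eval_ext w1 E) (eval_ext w2 E).
Qed.

Lemma exec_outbs B st l : regs_le B st -> exec B (map IOutB l) st st l.
Proof.
move=> bd; elim: l => [|b l IH]; first exact: exec_nil.
exact: (exec_cat (f := [:: _]) (w1 := [:: b]) (exec_outb b bd) IH).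
Qed.

Lemma enc_circuit_cat C D : enc_circuit (C ++ D) = enc_circuit C ++ enc_circuit D.
Proof. by rewrite /enc_circuit map_cat flatten_cat. Qed.

Lemma enc_circuit_flatten (T : Type) (f : T -> circuit) s :
  enc_circuit (flatten [seq f i | i <- s]) = flatten [seq enc_circuit (f i) | i <- s].
Proof. by elim: s => //= i s IH; rewrite enc_circuit_cat IH. Qed.

Lemma exec_outes v d B X st es : all (expr_wf v) es -> v <= d -> regs_le B st ->
  (forall r, r < v -> st r <= X) -> sumn [seq expr_bound e X | e <- es] <= B ->
  exists2 st', exec B (flatten [seq compile e d ++ [:: IOutR d] | e <- es]) st st'
      (flatten [seq enc_nat (eval st e) | e <- es]) &
    forall r, r < d -> st' r = st r.
Proof.
elim: es st => [|e es IH] st /=; first by exists st => //; apply: exec_nil.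
move=> /andP [we wes] led bd lX leB.
have [|s1 ex1 [E1 F1]] := compile_exec we led bd lX; first by lia.
have bd1 : regs_le B s1 by case: ex1.
have [||s2 ex2 F2] := IH s1 wes led bd1.
- by move=> r lt; rewrite F1 ?lX //; lia.
- by lia.
exists s2; last by move=> r lt; rewrite F2 ?F1.
apply: exec_cat; first by rewrite -E1 -[enc_nat _]cat0s; apply: exec_cat ex1 (exec_outr _ bd1).
suff <- : [seq enc_nat (eval s1 e0) | e0 <- es] = [seq enc_nat (eval st e0) | e0 <- es] by [].
elim: es wes {IH leB ex2} => //= e' es IH /andP [we' wes]; rewrite IH //; congr (enc_nat _ :: _).
by apply: eval_ext we' _ => r lt; apply: F1; lia.
Qed.

Lemma gcompile_exec p d B X st : gprog_wf d p -> regs_le B st ->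
  (forall r, r < d -> st r <= X) -> gprog_bound p X <= B ->
  exists2 st', exec B (gcompile p d) st st' (enc_circuit (gsem p d st)) &
    forall r, r < d -> st' r = st r.
Proof.
elim: p d X st => [p IHp q IHq|e p IHp|e1 e2 p IHp q IHq|g] d X st /=.
- move=> /andP [wp wq] bd lX leB.
  have [|s1 ex1 F1] := IHp d X st wp bd lX; first by lia.
  have bd1 : regs_le B s1 by case: ex1.
  have [r lt||s2 ex2 F2] := IHq d X s1 wq bd1; [by rewrite F1 ?lX | by lia |].
  exists s2; last by move=> r lt; rewrite F2 ?F1.
  rewrite /enc_circuit map_cat flatten_cat; apply: exec_cat ex1 _.
  by rewrite -(gsem_ext wq F1).
- move=> /andP [we wp] bd lX leB.
  have [||s1 ex1 [E1 F1]] := compile_exec (d := d.+1) we _ bd lX; [lia.. |].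
  have bd1 : regs_le B s1 by case: ex1.
  have [|||s2 ex2 [_ _ F2]] := exec_loop (B := B) (i := d) (r := d.+1) (body := gcompile p d.+2)
    (n := eval st e) (I := fun k s => forall r, r < d -> s r = st r)
    (w := fun k => enc_circuit (gsem p d.+2 (upd (upd st d.+1 (eval st e)) d k))) bd1 E1; first by lia.
  + by move=> r lt; upd_simp; apply: F1; lia.
  + move=> k s lt bds Is Ei Er.
    have [r ltr||s' exs Fs] := IHp d.+2 (X + expr_bound e X) s wp bds.
    * have := eval_le we lX; case: (ltngtP r d) => [ltd|gtd|->].
      - by rewrite Is // (leq_trans (lX _ ltd)) ?leq_addr.
      - by have -> : r = d.+1 by [lia]; rewrite Er; lia.
      - by rewrite Ei; lia.
    * by lia.
    exists s'.
      rewrite -(gsem_ext (env := s)) // => r ltr; rewrite /upd.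
      by case: eqP => [->//|ne]; case: eqP => [->//|ne']; apply: Is; lia.
    split; [by rewrite Fs | by rewrite Fs | move=> r ltr; upd_simp].
    by rewrite Fs ?Is //; lia.
  exists s2 => //; rewrite enc_circuit_flatten.
  exact: (exec_cat (w1 := [::]) ex1 ex2).
- move=> /and4P [w1 w2 wp wq] bd lX leB.
  have we : expr_wf d (EDiv (EAdd e2 (ECst 1)) (EAdd e1 (ECst 1))) by rewrite /= w1 w2.
  have [|s1 ex1 [E1 F1]] := compile_exec we (leqnn d) bd lX; first by rewrite /=; lia.
  have bd1 : regs_le B s1 by case: ex1.
  set s2 := upd s1 d.+1 0.
  have bd2 : regs_le B s2 by apply: regs_le_upd.
  have F2 r : r < d -> s2 r = st r by move=> lt; rewrite /s2; upd_simp; apply: F1.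
  have E2 : (s2 d == s2 d.+1) = ~~ (eval st e1 <= eval st e2).
    rewrite /s2; upd_simp; rewrite E1 /= !addn1 -ltnNge.
    case: (ltnP (eval st e2) (eval st e1)) => [lt|ge]; first by rewrite divn_small.
    by apply/negbTE; rewrite -lt0n divn_gt0.
  have [s3 ex3 F3] : exists2 s3, exec B (if s2 d == s2 d.+1 then gcompile q d else gcompile p d) s2 s3
    (enc_circuit (if eval st e1 <= eval st e2 then gsem p d st else gsem q d st)) &
    forall r, r < d -> s3 r = st r.
    rewrite E2; case: (eval st e1 <= eval st e2) => /=.
      have [r lt||s3 ex3 F3] := IHp d X s2 wp bd2; [by rewrite F2 ?lX | by lia |].
      by exists s3; [rewrite -(gsem_ext wp F2) | move=> r lt; rewrite F3 ?F2].
    have [r lt||s3 ex3 F3] := IHq d X s2 wq bd2; [by rewrite F2 ?lX | by lia |].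
    by exists s3; [rewrite -(gsem_ext wq F2) | move=> r lt; rewrite F3 ?F2].
  exists s3 => //; apply: (exec_cat (w1 := [::]) ex1).
  apply: (exec_cat (f := [:: IReset d.+1]) (w1 := [::]) (exec_reset d.+1 bd1)).
  exact: exec_if.
move=> wes bd lX leB.
have [|s1 ex1 F1] := exec_outes (d := d) wes (leqnn d) bd lX; first by [].
exists s1 => //; rewrite /enc_circuit /= cats0 enc_gateE.
exact: exec_cat (exec_outbs _ bd) ex1.
Qed.

(** With a base [X + 2], which is at least 2, constants and sums are absorbed by the exponent, and
    the class is closed under composition. *)
Definition poly_bounded (f : nat -> nat) : Prop := exists c, forall X, f X <= (X + 2) ^ c.

Lemma poly_bounded_le f g : (forall X, f X <= g X) -> poly_bounded g -> poly_bounded f.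
Proof. by move=> le [c H]; exists c => X; apply: leq_trans (le X) (H X). Qed.

Lemma poly_bounded_id : poly_bounded id.
Proof. by exists 1 => X; rewrite expn1 leq_addr. Qed.

Lemma poly_bounded_cst k : poly_bounded (fun=> k).
Proof.
exists k => X; apply: leq_trans (ltnW (ltn_expl k (isT : 1 < 2))) _.
by case: k => // k; rewrite leq_exp2r // leq_addl.
Qed.

Lemma poly_bounded_add f g : poly_bounded f -> poly_bounded g ->
  poly_bounded (fun X => f X + g X).
Proof.
move=> [a Ha] [b Hb]; exists (a + b).+1 => X.
have lea : (X + 2) ^ a <= (X + 2) ^ (a + b) by rewrite leq_pexp2l ?leq_addr // addnC.
have leb : (X + 2) ^ b <= (X + 2) ^ (a + b) by rewrite leq_pexp2l ?leq_addl // addnC.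
by rewrite expnS; have := Ha X; have := Hb X; nia.
Qed.

Lemma poly_bounded_mul f g : poly_bounded f -> poly_bounded g ->
  poly_bounded (fun X => f X * g X).
Proof. by move=> [a Ha] [b Hb]; exists (a + b) => X; rewrite expnD leq_mul. Qed.

Lemma poly_bounded_comp f g : poly_bounded f -> poly_bounded g ->
  poly_bounded (fun X => f (g X)).
Proof.
move=> [a Ha] [b Hb]; exists (b.+2 * a) => X; apply: leq_trans (Ha _) _.
rewrite expnM; case: a {Ha} => // a; rewrite leq_exp2r //.
have b0 : 0 < (X + 2) ^ b by rewrite expn_gt0 addnC.
by rewrite !expnS; have := Hb X; nia.
Qed.

Lemma expr_bound_poly e : poly_bounded (expr_bound e).
Proof.
elim: e => [v|c|a IHa b IHb|a IHa b IHb|a IHa b IHb|a IHa b IHb|a IHa] /=.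
- exact: poly_bounded_id.
- exact: poly_bounded_cst.
- exact: poly_bounded_add.
- by do 2!apply: poly_bounded_add => //; apply: poly_bounded_mul.
- exact: poly_bounded_add.
- exact: poly_bounded_add.
apply: poly_bounded_add (poly_bounded_cst _).
apply: (poly_bounded_le (g := fun X => 2 * expr_bound a X)) => [X|]; first by rewrite mul2n.
exact: poly_bounded_mul (poly_bounded_cst _) IHa.
Qed.

Lemma gprog_bound_poly p : poly_bounded (gprog_bound p).
Proof.
elim: p => [p IHp q IHq|e p IHp|e1 e2 p IHp q IHq|g] /=.
- exact: poly_bounded_add.
- apply: poly_bounded_add (expr_bound_poly e) _.
  apply: (poly_bounded_comp (g := fun X => X + expr_bound e X)) => //.
  exact: poly_bounded_add poly_bounded_id (expr_bound_poly e).
- by do !apply: poly_bounded_add => //; [apply: expr_bound_poly.. | apply: poly_bounded_cst].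
elim: (gate_args g) => [|e es IH] /=; first exact: poly_bounded_cst.
exact: poly_bounded_add (expr_bound_poly e) IH.
Qed.

(** * Printing the circuit in logarithmic space *)

Definition input_env (n : nat) : nat -> nat := upd (fun=> 0) 0 n.

Definition gcode (p : gprog) : seq instr :=
  [:: IRead 3; IInc 0; IBack 2] ++ gcompile p 1.

(** Register 0 counts the symbols up to the right endmarker. The input is read for its length
    only. *)
Lemma load_reach code x B : (forall i, i < 3 ->
    onth code i = onth [:: IRead 3; IInc 0; IBack 2] i) -> 3 <= size code -> size x <= B ->
  exists2 st, creach code x B (CConf 0 (fun=> 0) 0 [::]) (CConf 3 st (size x).+1 [::]) &
    st =1 input_env (size x) /\ regs_le B st.
Proof.
move=> Ec sz leB.
have gen m k st : m + k = size x -> st =1 input_env k ->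
  exists2 st', creach code x B (CConf 0 st k [::]) (CConf 3 st' (size x).+1 [::]) &
    st' =1 input_env (size x) /\ regs_le B st'.
  elim: m k st => [|m IH] k st Ek Est.
    have bd : regs_le B st.
      by move=> r; rewrite Est /input_env /upd; case: eqP => // _; lia.
    exists st; last by split=> // r; rewrite Est -Ek.
    apply: creach1 => //.
    by rewrite /cstep Ec //= /read_input -Ek add0n minnn /= ltnn.
  have bd : regs_le B st.
    by move=> r; rewrite Est /input_env /upd; case: eqP => // _; lia.
  have bd' : regs_le B (upd st 0 (st 0).+1).
    by apply: regs_le_upd => //; rewrite Est /input_env updE; lia.
  have [||st' R F] := IH k.+1 (upd st 0 (st 0).+1); first by lia.
    by move=> r; rewrite /upd !Est /input_env /upd eqxx; case: eqP.
  exists st' => //.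
  have Emin : minn k.+1 (size x).+1 = k.+1 by lia.
  apply: (creachS (c1 := CConf 1 st k.+1 [::])) => //.
  - rewrite /cstep Ec //= Emin /read_input /=.
    by have -> : k < size x by lia.
  - by rewrite /=; lia.
  apply: (creachS (c1 := CConf 2 (upd st 0 (st 0).+1) k.+1 [::])) => //.
  - by rewrite /cstep Ec.
  - by rewrite /=; lia.
  by apply: (creachS (c1 := CConf 0 (upd st 0 (st 0).+1) k.+1 [::])) => //; rewrite /cstep Ec.
by apply: gen; [rewrite addn0 | move=> r; rewrite /input_env /upd; case: eqP].
Qed.

Lemma gprog_logspace p : gprog_wf 1 p ->
  logspace_computable (fun u => enc_circuit (gsem p 1 (input_env (size u)))).
Proof.
move=> wf; have [c Hc] := poly_bounded_add (gprog_bound_poly p) poly_bounded_id.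
pose code := gcode p.
exists (ltm_of (cinit code) (cblank (code_width code)) (@cdelta code (code_width code))).
(* All registers stay within [(N + 2) ^ c], which is at most [2 ^ W]; so they have at most [W + 1]
   bits and [W + 2] cells are enough, where [W = c * (log N + 2)]. *)
exists (2 * c + 3) => x; set N := size x.
pose B := gprog_bound p N + N; pose W := c * (trunc_log 2 N).+2.
have bW k : k <= B -> size (bits_of k) <= W.+1.
  move=> le; apply: size_bits_of; rewrite expnS mul2n.
  suff : (N + 2) ^ c <= 2 ^ W by have := Hc N; rewrite -/B; lia.
  rewrite /W mulnC expnM; case: (c) => // c'; rewrite leq_exp2r // !expnS.
  have := trunc_log_ltn N (isT : 1 < 2); rewrite expnS.
  have := expn_gt0 2 (trunc_log 2 N); lia.
have [|||st R0 [Est bd]] := @load_reach code x B.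
- by case=> [|[|[|]]].
- by rewrite /code size_cat.
- exact: leq_addl.
have [r lt||st' [_ R1] _] := gcompile_exec (d := 1) (X := N) wf bd.
- by rewrite Est /input_env /upd; case: eqP.
- exact: leq_addr.
have := R1 x [:: IRead 3; IInc 0; IBack 2] [::] (size x).+1 [::].
rewrite cats0 (gsem_ext (env' := input_env N) wf); last by move=> r _; rewrite Est.
rewrite add3n => R2; have := creach_trans R0 R2.
move/(code_computes (code_widthP code) bW) => [t [cf [H1 H2 H3 H4]]].
exists t, cf; split=> // t' cf' le' /(H4 _ _ le') lt; apply: leq_trans lt _.
by rewrite /W; nia.
Qed.

(** * Circuits for first-order formulas *)

Definition gstep (x : seq bool) (s : seq bool * seq nat) (g : gate) : seq bool * seq nat :=
  (rcons s.1 (gate_val x s.1 g), rcons s.2 (gate_depth s.2 g)).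
Definition grun (x : seq bool) := foldl (gstep x).

Lemma grun_vals x C : (grun x ([::], [::]) C).1 = circuit_vals C x.
Proof.
rewrite /circuit_vals; move: ([::] : seq nat) => ds; move: ([::] : seq bool) => vs.
by elim: C vs ds => //= g C IH vs ds; apply: IH.
Qed.

Lemma grun_depths x C : (grun x ([::], [::]) C).2 =
  foldl (fun ds g => rcons ds (gate_depth ds g)) [::] C.
Proof.
move: ([::] : seq nat) => ds; move: ([::] : seq bool) => vs.
by elim: C vs ds => //= g C IH vs ds; apply: IH.
Qed.

Lemma grun_cat x s C1 C2 : grun x s (C1 ++ C2) = grun x (grun x s C1) C2.
Proof. exact: foldl_cat. Qed.

(* Running [C] from the state [s] appends [m] gates of depth at most [D] whose
   values satisfy [P]. *)
Definition runs x (s : seq bool * seq nat) (C : seq gate) (m D : nat) (P : seq bool -> Prop) :=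
  exists vs ds, [/\ grun x s C = (s.1 ++ vs, s.2 ++ ds), size vs = m, size ds = m,
                    all (leq^~ D) ds & P vs].

Definition extends (s s' : seq bool * seq nat) : Prop :=
  exists vs ds, s' = (s.1 ++ vs, s.2 ++ ds) /\ size s'.1 = size s'.2.

Lemma extends_nth s s' i : size s.1 = size s.2 -> extends s s' -> i < size s.1 ->
  nth false s'.1 i = nth false s.1 i /\ nth 0 s'.2 i = nth 0 s.2 i.
Proof. by move=> E [vs [ds [-> _]]] lt; rewrite !nth_cat -E lt. Qed.

Lemma runs1 x s g D (Q : seq bool -> Prop) : gate_depth s.2 g <= D ->
  Q [:: gate_val x s.1 g] -> runs x s [:: g] 1 D Q.
Proof.
move=> le q; exists [:: gate_val x s.1 g], [:: gate_depth s.2 g].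
by split; rewrite //= ?cats1 // le.
Qed.

(** Gates refer to earlier gates by absolute index, so the second piece may rely on the values [P]
    of the first and on the depth [D1] at its indices. *)
Lemma runs_cat x s C1 C2 m1 m2 D1 D P Q : size s.1 = size s.2 -> D1 <= D ->
  runs x s C1 m1 D1 P ->
  (forall vs1 s1, P vs1 -> extends s s1 -> s1.1 = s.1 ++ vs1 -> size vs1 = m1 ->
     (forall i, size s.1 <= i < size s.1 + m1 -> nth 0 s1.2 i <= D1) ->
     runs x s1 C2 m2 D (fun vs2 => Q (vs1 ++ vs2))) ->
  runs x s (C1 ++ C2) (m1 + m2) D Q.
Proof.
move=> Es le [vs1 [ds1 [E1 sv1 sd1 aD1 P1]]] H.
have [||||vs2 [ds2 [E2 sv2 sd2 aD2 Q2]]] := H vs1 (s.1 ++ vs1, s.2 ++ ds1) P1 => //.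
- by exists vs1, ds1; rewrite /= !size_cat Es sv1 sd1.
- move=> i /andP [ge lt]; rewrite /= nth_cat -Es ltnNge ge /=.
  by apply: (all_nthP 0 aD1); rewrite sd1; lia.
exists (vs1 ++ vs2), (ds1 ++ ds2); split=> //.
- by rewrite grun_cat E1 E2 /= !catA.
- by rewrite size_cat sv1 sv2.
- by rewrite size_cat sd1 sd2.
- by rewrite all_cat aD2 andbT; apply: sub_all aD1 => d le'; apply: leq_trans le.
Qed.

Lemma runsW x s C m D D' P Q : D <= D' -> (forall vs, size vs = m -> P vs -> Q vs) ->
  runs x s C m D P -> runs x s C m D' Q.
Proof.
move=> le PQ [vs [ds [E sv sd aD pv]]]; exists vs, ds; split=> //; last exact: PQ.
by apply: sub_all aD => d le'; apply: leq_trans le.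
Qed.

Lemma runs_blocks x s0 (C : nat -> seq gate) (v : nat -> bool) l D k :
  size s0.1 = size s0.2 ->
  (forall i s, i < k -> extends s0 s -> size s.1 = size s0.1 + i * l.+1 ->
     runs x s (C i) l.+1 D (fun vs => nth false vs l = v i)) ->
  runs x s0 (flatten [seq C i | i <- iota 0 k]) (k * l.+1) D
    (fun vs => forall j, j < k -> nth false vs (j * l.+1 + l) = v j).
Proof.
move=> E0; elim: k => [|k IH] H.
  by exists [::], [::]; rewrite !cats0 /=; split=> //; case: (s0).
have -> : iota 0 k.+1 = rcons (iota 0 k) k by rewrite -cats1 -[k.+1]addn1 iotaD.
rewrite map_rcons flatten_rcons mulSnr.
apply: (runs_cat (D1 := D)) => //; first by apply: IH => i s lt; apply: H; lia.
move=> vs1 s1 P1 ext E1 sz1 _.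
apply: runsW (leqnn D) _ (H k s1 _ ext _) => // [vs sv Ev j|]; last by rewrite E1 size_cat sz1.
rewrite ltnS leq_eqVlt => /predU1P [->|lt].
  by rewrite nth_cat sz1 ltnNge leq_addr /= addKn.
rewrite nth_cat sz1; have -> : j * l.+1 + l < k * l.+1; last exact: P1.
have : j.+1 * l.+1 <= k * l.+1 by rewrite leq_mul2r lt orbT.
by rewrite mulSnr addnS.
Qed.

Section OrTree.
Variables (e D : nat).
Let L := e.+1.

(* The nodes are stored like a heap read backwards: with [u = 2 L - 1 - t], the
   root is [u = 1] and the children of [u] are [2 u] and [2 u + 1]. *)
Lemma tree_depth (d : nat -> nat) : (forall t, t < L -> d t <= D) ->
  (forall j, j < e -> d (L + j) = (maxn (d j.*2) (d j.*2.+1)).+1) ->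
  forall k t, t < L + e -> L.*2 <= (L + e - t) * 2 ^ k -> d t <= D + k.
Proof.
move=> leaf node; elim=> [|k IH] t lt le.
  by move: le; rewrite /L; lia.
case: (ltnP t L) => [ltL|geL]; first by rewrite (leq_trans (leaf t ltL)) ?leq_addr.
have -> : t = L + (t - L) by lia.
rewrite node; last by rewrite /L in lt *; lia.
rewrite addnS ltnS geq_max expnS in le *; apply/andP; split; apply: IH.
all: try (rewrite /L in lt geL *; lia).
all: apply: leq_trans le _; rewrite mulnA leq_mul2r; apply/orP; right.
all: rewrite /L in lt geL *; lia.
Qed.

(** A true node leads down to a true leaf, and a true leaf makes its ancestors true up to the root
    [e.*2]; the parent of node [t] is [L + t./2]. *)
Lemma tree_val (V : nat -> bool) :
  (forall j, j < e -> V (L + j) = V j.*2 || V j.*2.+1) ->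
  V e.*2 = has V (iota 0 L).
Proof.
move=> node; apply/idP/hasP => [|[t]].
  have: e.*2 <= e.*2 by []; move: {1 3}(e.*2) => t; elim/ltn_ind: t => t IH le Vt.
  case: (ltnP t L) => [ltL|geL]; first by exists t; rewrite ?mem_iota.
  move: Vt; have -> : t = L + (t - L) by lia.
  rewrite node; last by rewrite /L in geL *; lia.
  by case/orP; apply: IH; rewrite /L in geL *; lia.
rewrite mem_iota /= add0n => lt Vt.
have: t <= e.*2 by rewrite /L in lt; lia.
move: {2}(e.*2 - t) (leqnn (e.*2 - t)) => m; elim: m t Vt {lt} => [|m IH] t Vt lem le.
  by have <- : t = e.*2 by lia.
case: (ltngtP t e.*2) => [ltt|gt|<-//]; last by lia.
have ltj : t./2 < e by lia.
apply: (IH (L + t./2)); rewrite /L; try lia.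
rewrite -/L node //; have := odd_double_half t; case: (odd t) => E.
  by rewrite (_ : t./2.*2.+1 = t) ?Vt ?orbT //; lia.
by rewrite (_ : t./2.*2 = t) ?Vt //; lia.
Qed.
End OrTree.

Lemma runs_or_tree x s c e D (v : nat -> bool) K : size s.1 = size s.2 ->
  size s.1 = c + e.+1 -> (forall t, t < e.+1 -> nth 0 s.2 (c + t) <= D) ->
  (forall t, t < e.+1 -> nth false s.1 (c + t) = v t) -> e.+1.*2 <= 2 ^ K ->
  runs x s [seq GOr (c + j.*2) (c + j.*2.+1) | j <- iota 0 e] e (D + K)
    (fun vs => nth false (s.1 ++ vs) (c + e.*2) = has v (iota 0 e.+1)).
Proof.
move=> Es Ec HD Hv leK.
have gen k : k <= e -> exists vs ds,
    [/\ grun x s [seq GOr (c + j.*2) (c + j.*2.+1) | j <- iota 0 k] = (s.1 ++ vs, s.2 ++ ds),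
        size vs = k, size ds = k,
        forall j, j < k -> let V := nth false (s.1 ++ vs) in
          V (c + (e.+1 + j)) = V (c + j.*2) || V (c + j.*2.+1) &
        forall j, j < k -> let d := nth 0 (s.2 ++ ds) in
          d (c + (e.+1 + j)) = (maxn (d (c + j.*2)) (d (c + j.*2.+1))).+1].
  elim: k => [|k IH] lek.
    by exists [::], [::]; rewrite !cats0; split=> //; case: (s).
  have [vs [ds [E sv sd Hv' Hd']]] := IH (ltnW lek).
  have -> : iota 0 k.+1 = rcons (iota 0 k) k by rewrite -cats1 -[k.+1]addn1 iotaD.
  rewrite map_rcons -cats1 grun_cat E /= /gstep /=.
  set b := _ || _; set d := (maxn _ _).+1.
  exists (rcons vs b), (rcons ds d); rewrite !rcons_cat !size_rcons sv sd; split=> //.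
    move=> j; rewrite ltnS leq_eqVlt => /predU1P [->|lt] /=.
      rewrite -!rcons_cat !nth_rcons !size_cat sv Ec addnA ltnn eqxx.
      by rewrite /b; do 2!(rewrite ifT; last by lia).
    rewrite -!rcons_cat !nth_rcons !size_cat sv Ec.
    by do 3!(rewrite ifT; last by lia); rewrite Hv'.
  move=> j; rewrite ltnS leq_eqVlt => /predU1P [->|lt] /=.
    rewrite -!rcons_cat !nth_rcons !size_cat sd -Es Ec addnA ltnn eqxx.
    by rewrite /d; do 2!(rewrite ifT; last by lia).
  rewrite -!rcons_cat !nth_rcons !size_cat sd -Es Ec.
  by do 3!(rewrite ifT; last by lia); rewrite Hd'.
have [vs [ds [E sv sd HV Hd]]] := gen e (leqnn e).
exists vs, ds; split=> //.
  apply/(all_nthP 0) => j; rewrite sd => lt.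
  have -> : nth 0 ds j = nth 0 (s.2 ++ ds) (c + (e.+1 + j)).
    by rewrite nth_cat -Es Ec ltnNge addnA leq_addr /= addKn.
  apply: (@tree_depth e D (fun t => nth 0 (s.2 ++ ds) (c + t))) => //; last 2 first.
  - by lia.
  - by apply: leq_trans leK _; rewrite leq_pmull //; lia.
  by move=> t lt'; rewrite nth_cat -Es Ec ltn_add2l lt' HD.
rewrite (tree_val (V := fun t => nth false (s.1 ++ vs) (c + t))) //.
apply: eq_in_has => t; rewrite mem_iota /= add0n => lt.
by rewrite nth_cat Ec ltn_add2l lt Hv.
Qed.

Inductive fo_form :=
| FLe of expr & expr
| FBit of expr
| FTab of expr
| FNot of fo_form
| FAnd of fo_form & fo_form
| FOr of fo_form & fo_form
| FEx of expr & fo_form.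

(* [FEx e f] quantifies over values at most [e], in variable [d]. *)
Fixpoint sat (x : seq bool) (M : nat) (T : nat -> bool) (f : fo_form) (d : nat)
    (env : nat -> nat) : bool :=
  match f with
  | FLe e1 e2 => eval env e1 <= eval env e2
  | FBit e => nth false x (eval env e)
  | FTab e => (eval env e < M) && T (eval env e)
  | FNot f => ~~ sat x M T f d env
  | FAnd f g => sat x M T f d env && sat x M T g d env
  | FOr f g => sat x M T f d env || sat x M T g d env
  | FEx e f => has (fun v => sat x M T f d.+2 (upd (upd env d.+1 (eval env e).+1) d v))
                   (iota 0 (eval env e).+1)
  end.

(** The range of a quantifier must be an expression in variable 0, the input length. Then the number
    of gates of a formula is the same for all values of the other variables, and blocks can be
    addressed by multiplication. *)
Fixpoint form_wf (d : nat) (f : fo_form) : bool :=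
  match f with
  | FLe e1 e2 => expr_wf d e1 && expr_wf d e2
  | FBit e | FTab e => expr_wf d e
  | FNot f => form_wf d f
  | FAnd f g | FOr f g => form_wf d f && form_wf d g
  | FEx e f => expr_wf 1 e && form_wf d.+2 f
  end.

Definition succ (e : expr) : expr := EAdd e (ECst 1).

(* The number of gates of a formula, minus one. *)
Fixpoint form_last (f : fo_form) : expr :=
  match f with
  | FLe _ _ | FBit _ | FTab _ => ECst 0
  | FNot f => succ (form_last f)
  | FAnd f g | FOr f g => EAdd (succ (form_last f)) (succ (form_last g))
  | FEx e f => EAdd (EMul (succ e) (succ (form_last f))) (EMul (ECst 2) e)
  end.

Fixpoint form_depth (N : nat) (f : fo_form) : nat :=
  match f with
  | FLe _ _ | FBit _ => 0
  | FTab _ => 1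
  | FNot f => (form_depth N f).+1
  | FAnd f g | FOr f g => (form_depth N f + form_depth N g).+1
  | FEx e f => (form_depth N f).+1 + (trunc_log 2 (eval (input_env N) e).+1.*2).+1
  end.

(* The gates of [f] start at index [b]; entry [z] of the previous table is the
   last gate of the [z]-th block of [l + 1] gates from index [tb] on. *)
Section FormCompile.
Variables (M tb l : expr).

Fixpoint fcompile (f : fo_form) (d : nat) (b : expr) : gprog :=
  match f with
  | FLe e1 e2 => PLe e1 e2 (PEmit (XConst true)) (PEmit (XConst false))
  | FBit e => PEmit (XInput e)
  | FTab e =>
      let i := EAdd tb (EAdd (EMul e (succ l)) l) in
      (* [XOr i i] acts as a buffer that copies gate [i]; an index outside the table gives false and
         refers to no gate. *)
      PLe (succ e) M (PEmit (XOr i i)) (PEmit (XConst false))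
  | FNot f => PSeq (fcompile f d b) (PEmit (XNot (EAdd b (form_last f))))
  | FAnd f g =>
      let c := EAdd b (succ (form_last f)) in
      PSeq (fcompile f d b) (PSeq (fcompile g d c)
        (PEmit (XAnd (EAdd b (form_last f)) (EAdd c (form_last g)))))
  | FOr f g =>
      let c := EAdd b (succ (form_last f)) in
      PSeq (fcompile f d b) (PSeq (fcompile g d c)
        (PEmit (XOr (EAdd b (form_last f)) (EAdd c (form_last g)))))
  (* The outputs of the instances lie one block apart; they are first copied to consecutive
     positions, where the tree of disjunctions expects its leaves. *)
  | FEx e f =>
      let v := EMul (EVar d) (succ (form_last f)) in
      let c := EAdd b (EMul (succ e) (succ (form_last f))) in
      let j := EAdd c (EMul (ECst 2) (EVar d)) in
      let i := EAdd b (EAdd v (form_last f)) in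
      PSeq (PFor (succ e) (fcompile f d.+2 (EAdd b v)))
        (PSeq (PFor (succ e) (PEmit (XOr i i)))
              (PFor e (PEmit (XOr j (succ j)))))
  end.
End FormCompile.

Lemma form_last_wf d f : form_wf d f -> expr_wf 1 (form_last f).
Proof.
elim: f d => //= [f IHf|f IHf g IHg|f IHf g IHg|e f IHf] d.
- by move=> /IHf ->.
- by move=> /andP [/IHf -> /IHg ->].
- by move=> /andP [/IHf -> /IHg ->].
- by move=> /andP [-> /IHf ->].
Qed.

Lemma eval_input env N e : env 0 = N -> expr_wf 1 e -> eval env e = eval (input_env N) e.
Proof. by move=> E wf; apply: eval_ext wf _ => -[|//] _; rewrite E. Qed.

Section FormRun.
Variables (x : seq bool) (N : nat) (M tb l : expr) (T : nat -> bool).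
Hypotheses (wfM : expr_wf 1 M) (wfl : expr_wf 1 l).
Let cst e := eval (input_env N) e.
Let lst f := cst (form_last f).

Definition table_at (t : nat) (s : seq bool * seq nat) (D : nat) : Prop :=
  forall z, z < cst M -> let i := t + (z * (cst l).+1 + cst l) in
    [/\ i < size s.1, nth false s.1 i = T z & nth 0 s.2 i <= D].

Lemma table_at_ext t s s' D : size s.1 = size s.2 -> extends s s' ->
  table_at t s D -> table_at t s' D.
Proof.
move=> Es ext tab z lt i; have [lti Ev Ed] := tab z lt.
have [-> ->] := extends_nth Es ext lti; split=> //.
by case: ext => vs [ds [-> _]]; rewrite size_cat ltn_addr.
Qed.

Definition fcompile_spec f := forall d b env s D,
  form_wf d f -> expr_wf d b -> expr_wf d tb ->
  0 < d -> env 0 = N -> size s.1 = size s.2 -> eval env b = size s.1 ->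
  table_at (eval env tb) s D ->
  runs x s (gsem (fcompile M tb l f d b) d env) (lst f).+1 (D + form_depth N f)
    (fun vs => nth false vs (lst f) = sat x (cst M) T f d env).

Lemma fcompile_two f g d b env s D (G : expr -> expr -> gate_expr) op :
  (forall i j vs, gate_val x vs (eval_gate env (G i j)) =
     op (nth false vs (eval env i)) (nth false vs (eval env j))) ->
  (forall i j ds, gate_depth ds (eval_gate env (G i j)) =
     (maxn (nth 0 ds (eval env i)) (nth 0 ds (eval env j))).+1) ->
  fcompile_spec f -> fcompile_spec g ->
  form_wf d f && form_wf d g -> expr_wf d b -> expr_wf d tb ->
  0 < d -> env 0 = N -> size s.1 = size s.2 -> eval env b = size s.1 ->
  table_at (eval env tb) s D ->
  let c := EAdd b (succ (form_last f)) in
  runs x s (gsem (PSeq (fcompile M tb l f d b) (PSeq (fcompile M tb l g d c)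
        (PEmit (G (EAdd b (form_last f)) (EAdd c (form_last g)))))) d env)
    ((lst f).+1 + (lst g).+1).+1 (D + (form_depth N f + form_depth N g).+1)
    (fun vs => nth false vs ((lst f).+1 + (lst g).+1) =
       op (sat x (cst M) T f d env) (sat x (cst M) T g d env)).
Proof.
move=> Gv Gd IHf IHg /andP [wf wg] wb wt d0 E0 Es Eb tab c /=.
have Elf : eval env (form_last f) = lst f by apply: eval_input E0 (form_last_wf wf).
have Elg : eval env (form_last g) = lst g by apply: eval_input E0 (form_last_wf wg).
rewrite -addnS.
apply: runs_cat (IHf d b env s D wf wb wt d0 E0 Es Eb tab) _ => //; first by lia.
move=> vs1 s1 P1 ext1 Ev1 sz1 HD1; rewrite -addn1.
have Es1 : size s1.1 = size s1.2 by case: ext1 => vs [ds [_ ->]].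
have Ec : eval env c = size s1.1 by rewrite /= Elf Eb Ev1 size_cat sz1 addn1.
have Ec' : size s.1 + (lst f + 1) = size s1.1 by rewrite Ev1 size_cat sz1 addn1.
have wc : expr_wf d c by rewrite /= wb (expr_wfW d0 (form_last_wf wf)).
apply: runs_cat (IHg d c env s1 D wg wc wt d0 E0 Es1 Ec (table_at_ext Es ext1 tab)) _ => //.
  by lia.
move=> vs2 s2 P2 ext2 Ev2 sz2 HD2; apply: runs1 => /=.
  rewrite Gd addnS ltnS geq_max /= Eb Elf Elg Ec'; apply/andP; split.
    have lt : size s.1 + lst f < size s1.1 by rewrite Ev1 size_cat sz1 addnS.
    have [_ ->] := extends_nth Es1 ext2 lt.
    by rewrite (leq_trans (HD1 _ _)) ?leq_addr //= ?addnS ?ltnS // leq_add2l leq_addr.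
  by rewrite (leq_trans (HD2 _ _)) ?leq_addr //= ?addnS ?ltnS // leq_add2l leq_addl.
rewrite Gv /= Eb Elf Elg Ec' catA -sz1 -sz2 -size_cat nth_cat ltnn subnn /=.
rewrite Ev2 Ev1 -catA; congr op.
  by rewrite nth_cat ltnNge leq_addr /= addKn nth_cat sz1 ltnSn P1.
by rewrite catA nth_cat ltnNge leq_addr /= addKn P2.
Qed.

Lemma fcompile_run f : fcompile_spec f.
Proof.
have E1 env' e : env' 0 = N -> expr_wf 1 e -> eval env' e = cst e by exact: eval_input.
elim: f => [e1 e2|e|e|f IHf|f IHf g IHg|f IHf g IHg|e f IHf] d b env s D /= wf wb wt d0 E0 Es Eb tab.
- by case: ifP => le; apply: runs1.
- exact: runs1.
- rewrite addn1 (E1 env M) //; case: ltnP => [lt|ge]; last exact: runs1.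
  have [lti Ev Ed] := tab _ lt.
  by apply: runs1; rewrite /= !(E1 env l) // addn1 ?maxnn ?addn1 ?ltnS // Ev orbb.
- have Elf : eval env (form_last f) = lst f by apply: E1 => //; apply: form_last_wf wf.
  have El : lst (FNot f) = (lst f).+1 by rewrite /lst /cst /= addn1.
  rewrite El -addn1; apply: runs_cat (IHf d b env s D wf wb wt d0 E0 Es Eb tab) _ => //; first by lia.
  move=> vs1 s1 P1 ext Ev1 sz1 HD; apply: runs1 => /=.
    by rewrite Eb Elf addnS ltnS HD //; lia.
  rewrite nth_cat sz1 ltnn subnn /= Eb Elf Ev1.
  by rewrite nth_cat ltnNge leq_addr /= addKn P1.
- have El : lst (FAnd f g) = (lst f).+1 + (lst g).+1 by rewrite /lst /cst /= !addn1.
  by rewrite El; apply: (fcompile_two (G := XAnd) (op := andb) _ _ IHf IHg).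
- have El : lst (FOr f g) = (lst f).+1 + (lst g).+1 by rewrite /lst /cst /= !addn1.
  by rewrite El; apply: (fcompile_two (G := XOr) (op := orb) _ _ IHf IHg).
case/andP: wf => we wf.
set n := cst e; have En : eval env e = n by apply: E1.
have El : (lst (FEx e f)).+1 = n.+1 * (lst f).+1 + (n.+1 + n).
  by rewrite /lst /cst /= !addn1 -/(cst e) -/n; lia.
have Elf env' : env' 0 = N -> eval env' (form_last f) = lst f.
  by move=> E; apply: eval_input E (form_last_wf wf).
rewrite En addn1 El.
set K := (trunc_log _ _).+1.
pose v i := sat x (cst M) T f d.+2 (upd (upd env d.+1 n.+1) d i).
have envE i m : upd (upd env d.+1 m) d i 0 = N by rewrite !updN // eq_sym -lt0n.
have evE w i m : expr_wf d w -> eval (upd (upd env d.+1 m) d i) w = eval env w.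
  by move=> ww; apply: eval_ext ww _ => r lt; rewrite !updN //; lia.
apply: (runs_cat (D1 := D + form_depth N f)
  (P := fun vs => forall j, j < n.+1 -> nth false vs (j * (lst f).+1 + lst f) = v j)) => //; first by lia.
  apply: runs_blocks => // i s1 lti ext sz1; apply: IHf => //.
  - rewrite /= !(expr_wfW _ wb) ?(expr_wfW _ (form_last_wf wf)) //; lia.
  - by apply: expr_wfW wt; lia.
  - by case: ext => vs [ds [_ ->]].
  - by rewrite /= evE // Elf // updE Eb sz1 addn1.
  - by rewrite evE //; apply: table_at_ext ext tab.
move=> vs1 s1 P1 ext1 Ev1 sz1 HD1.
have Es1 : size s1.1 = size s1.2 by case: ext1 => ? [? [_ ->]].
apply: (runs_cat (D1 := (D + form_depth N f).+1) (m1 := n.+1)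
  (P := fun vs => forall j, j < n.+1 -> nth false vs j = v j)) => //; first by lia.
  have := @runs_blocks x s1 (fun i => [:: eval_gate (upd (upd env d.+1 n.+1) d i)
      (XOr (EAdd b (EAdd (EMul (EVar d) (succ (form_last f))) (form_last f)))
           (EAdd b (EAdd (EMul (EVar d) (succ (form_last f))) (form_last f))))])
    v 0 (D + form_depth N f).+1 n.+1 Es1.
  rewrite muln1 => R; apply: runsW (leqnn _) _ (R _) => [vs _ H j lt|i s2 lt ext2 sz2].
    by rewrite -[RHS]H // muln1 addn0.
  have Ei : eval (upd (upd env d.+1 n.+1) d i) b + (i * (lst f + 1) + lst f) =
      size s.1 + (i * (lst f).+1 + lst f) by rewrite evE // Eb addn1.
  have lti : i * (lst f).+1 + lst f < size vs1.
    have : i.+1 * (lst f).+1 <= n.+1 * (lst f).+1 by rewrite leq_mul2r lt orbT.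
    by rewrite sz1 mulSnr addnS.
  have lts : size s.1 + (i * (lst f).+1 + lst f) < size s1.1.
    by rewrite Ev1 size_cat ltn_add2l.
  have [F1 F2] := extends_nth Es1 ext2 lts.
  apply: runs1; rewrite /= updE !Elf // Ei ?maxnn ?F2 ?F1 ?orbb.
    by rewrite ltnS HD1 // leq_addr ltn_add2l -sz1.
  by rewrite Ev1 nth_cat ltnNge leq_addr /= addKn P1.
move=> vs2 s2 P2 ext2 Ev2 sz2 HD2.
have Es2 : size s2.1 = size s2.2 by case: ext2 => ? [? [_ ->]].
have wfe1 := expr_wfW d0 we.
set C := flatten _; have -> : C = [seq GOr (size s1.1 + j.*2) (size s1.1 + j.*2.+1) | j <- iota 0 n].
  rewrite /C -[RHS]flatten_seq1; congr flatten; rewrite -map_comp; apply: eq_map => i /=.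
  rewrite !evE ?(expr_wfW d0 (form_last_wf wf)) // Elf // updE Eb En mul2n !addn1 addnS.
  by rewrite Ev1 size_cat sz1.
have El' : lst (FEx e f) = size vs1 + n.*2 by apply: succn_inj; rewrite El sz1 -addnn; lia.
have szs2 : size s2.1 = size s1.1 + n.+1 by rewrite Ev2 size_cat sz2.
have [|t lt||] := @runs_or_tree x s2 (size s1.1) n (D + form_depth N f).+1 v K Es2 szs2.
- by move=> t lt; rewrite HD2 // leq_addr ltn_add2l.
- by rewrite Ev2 nth_cat ltnNge leq_addr /= addKn P2.
- by rewrite /K; apply/ltnW/trunc_log_ltn.
move=> vs [ds [R sv sd aD Hv]]; rewrite Ev2 Ev1 in Hv.
exists vs, ds; split=> //; first by rewrite addnA addnS.
move: Hv; rewrite size_cat -!catA -addnA nth_cat ltnNge leq_addr /= addKn => Hv.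
by rewrite El' Hv.
Qed.
End FormRun.

Lemma fcompile_wf M tb l f d b : expr_wf 1 M -> expr_wf 1 l -> 0 < d -> form_wf d f ->
  expr_wf d tb -> expr_wf d b -> gprog_wf d (fcompile M tb l f d b).
Proof.
move=> wM wl; elim: f d b => /= [e1 e2|e|e|f IHf|f IHf g IHg|f IHf g IHg|e f IHf] d b d0.
- by move=> /andP [-> ->].
- by move=> ->.
- by move=> -> -> _; rewrite !(expr_wfW d0 wM) !(expr_wfW d0 wl).
- by move=> wf wt wb; rewrite IHf // wb (expr_wfW d0 (form_last_wf wf)).
- move=> /andP [wf wg] wt wb.
  have [lf lg] := (expr_wfW d0 (form_last_wf wf), expr_wfW d0 (form_last_wf wg)).
  by rewrite IHf // IHg /= ?wb ?lf ?lg.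
- move=> /andP [wf wg] wt wb.
  have [lf lg] := (expr_wfW d0 (form_last_wf wf), expr_wfW d0 (form_last_wf wg)).
  by rewrite IHf // IHg /= ?wb ?lf ?lg.
move=> /andP [we wf] wt wb; have le2 : d <= d.+2 by lia.
have [lf wd] := (expr_wfW d0 (form_last_wf wf), expr_wfW d0 we).
rewrite IHf //=; last 2 first.
- exact: expr_wfW wt.
- by rewrite (expr_wfW le2 wb) (expr_wfW le2 lf) !andbT /=; lia.
by rewrite (expr_wfW le2 wb) (expr_wfW le2 lf) (expr_wfW le2 wd) wd !andbT /=; lia.
Qed.

Lemma pow_log_bound N c : (N + 2) ^ c <= 2 ^ (c * (trunc_log 2 N).+2).
Proof.
rewrite mulnC expnM; case: c => // c; rewrite leq_exp2r // !expnS.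
have := trunc_log_ltn N (isT : 1 < 2); rewrite expnS.
have := expn_gt0 2 (trunc_log 2 N); lia.
Qed.

Lemma eval_input_le N e : expr_wf 1 e -> eval (input_env N) e <= expr_bound e N.
Proof. by move=> wf; apply: (eval_le (d := 1)) => // -[|//] _; rewrite /input_env updE. Qed.

(** Quantifier ranges are polynomial in [N], so each tree has logarithmic depth, and the nesting of
    the formula is fixed. *)
Lemma form_depth_log d f : form_wf d f ->
  exists c, forall N, form_depth N f <= c * (trunc_log 2 N).+1.
Proof.
elim: f d => /= [e1 e2|e|e|f IHf|f IHf g IHg|f IHf g IHg|e f IHf] d.
- by exists 0.
- by exists 0.
- by exists 1.
- by move=> /IHf [c H]; exists c.+1 => N; have := H N; lia.
- by move=> /andP [/IHf [a Ha] /IHg [b Hb]]; exists (a + b).+1 => N; have := Ha N; have := Hb N; lia.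
- by move=> /andP [/IHf [a Ha] /IHg [b Hb]]; exists (a + b).+1 => N; have := Ha N; have := Hb N; lia.
move=> /andP [we /IHf [a Ha]]; have [c Hc] := expr_bound_poly e.
exists (a + 2 + 2 * c.+2) => N.
suff : trunc_log 2 (eval (input_env N) e).+1.*2 <= c.+2 * (trunc_log 2 N).+2 by have := Ha N; nia.
rewrite -(@trunc_expnK 2 (c.+2 * _)) //; apply: leq_trunc_log.
apply: leq_trans (pow_log_bound N c.+2).
have b0 : 0 < (N + 2) ^ c by rewrite expn_gt0 addnC.
by have := eval_input_le N we; have := Hc N; rewrite !expnS; nia.
Qed.

(* [K] rounds, each of which replaces a table of [M] Booleans by the values of
   [f], where variable 3 is the index of the entry to be computed. *)
Definition fprog (M K : expr) (f : fo_form) : gprog :=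
  let l := form_last f in
  let blk := EMul M (succ l) in
  PSeq (PFor blk (PEmit (XConst false)))
    (PFor K (PFor M (fcompile M (EMul (EVar 1) blk) l f 5
       (EAdd (EMul (succ (EVar 1)) blk) (EMul (EVar 3) (succ l)))))).

Lemma fprog_wf M K f : expr_wf 1 M -> expr_wf 1 K -> form_wf 5 f -> gprog_wf 1 (fprog M K f).
Proof.
move=> wM wK wf; have wl := form_last_wf wf.
have wM5 := @expr_wfW 1 5 M isT wM; have wl5 := @expr_wfW 1 5 _ isT wl.
rewrite /= wM wK wl (@expr_wfW 1 3 M isT wM) /=.
by apply: fcompile_wf => //=; rewrite wM5 wl5.
Qed.

Section Rounds.
Variables (x : seq bool) (N : nat) (M K : expr) (f : fo_form).
Variable step : (nat -> bool) -> nat -> bool.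
Hypotheses (wM : expr_wf 1 M) (wK : expr_wf 1 K) (wf : form_wf 5 f).
Let cst e := eval (input_env N) e.
Let l := form_last f.
Let blk := cst M * (cst l).+1.
Hypothesis satE : forall T env, env 0 = N -> sat x (cst M) T f 5 env = step T (env 3).
Let T k := iter k step (fun=> false).

Let rnd (k : nat) : seq gate :=
  gsem (PFor M (fcompile M (EMul (EVar 1) (EMul M (succ l))) l f 5
       (EAdd (EMul (succ (EVar 1)) (EMul M (succ l))) (EMul (EVar 3) (succ l))))) 3
    (upd (upd (input_env N) 2 (cst K)) 1 k).

Lemma rnd_runs s k : size s.1 = size s.2 -> size s.1 = k.+1 * blk ->
  table_at N M l (T k) (k * blk) s (k * form_depth N f) ->
  runs x s (rnd k) blk (k.+1 * form_depth N f)
    (fun vs => forall z, z < cst M -> nth false vs (z * (cst l).+1 + cst l) = T k.+1 z).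
Proof.
move=> Es sz tab; have wl : expr_wf 1 l := form_last_wf wf.
rewrite /rnd /=; set env := upd (upd (input_env N) 2 _) 1 k.
have EM : eval env M = cst M by apply: eval_input.
rewrite EM; apply: runs_blocks => // i s1 lt ext sz1.
have E0 : upd (upd env 4 (cst M)) 3 i 0 = N by [].
have Ev e : expr_wf 1 e -> eval (upd (upd env 4 (cst M)) 3 i) e = cst e by move=> we; apply: eval_input.
have wb : expr_wf 5 (EAdd (EMul (succ (EVar 1)) (EMul M (succ l))) (EMul (EVar 3) (succ l))).
  by rewrite /= (@expr_wfW 1 5 M isT wM) (@expr_wfW 1 5 _ isT wl).
have wt : expr_wf 5 (EMul (EVar 1) (EMul M (succ l))).
  by rewrite /= (@expr_wfW 1 5 M isT wM) (@expr_wfW 1 5 _ isT wl).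
have := @fcompile_run x N M (EMul (EVar 1) (EMul M (succ l))) l (T k) wM wl f 5 _
  (upd (upd env 4 (cst M)) 3 i) s1 (k * form_depth N f) wf wb wt isT E0.
rewrite -mulSnr satE // => R; apply: R.
- by case: ext => ? [? [_ ->]].
- by rewrite /= !Ev // !addn1 -/blk sz1 sz.
- by rewrite /= !Ev // addn1 -/blk; apply: table_at_ext ext tab.
Qed.

(** The constant gates at the start have the shape of the table of a round, so table [k] begins at
    gate [k * blk] for every [k], and its entry [z] is the last gate of its block [z]. *)
Lemma rounds_run k : exists vs ds,
  [/\ grun x ([::], [::]) (nseq blk (GConst false) ++ flatten [seq rnd j | j <- iota 0 k]) = (vs, ds),
      size vs = k.+1 * blk, size ds = k.+1 * blk, all (leq^~ (k * form_depth N f)) ds &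
      forall z, z < cst M -> nth false vs (k * blk + (z * (cst l).+1 + cst l)) = T k z].
Proof.
elim: k => [|k [vs [ds [E sv sd aD HT]]]].
  exists (nseq blk false), (nseq blk 0); rewrite /= cats0 !size_nseq mul1n; split=> //.
  - suff gen m vs ds : grun x (vs, ds) (nseq m (GConst false)) = (vs ++ nseq m false, ds ++ nseq m 0).
      exact: gen.
    elim: m vs ds => [|m IH] vs ds /=; first by rewrite !cats0.
    by rewrite IH !cat_rcons.
  - by rewrite all_nseq orbT.
  - by move=> z lt; rewrite nth_nseq; case: ifP.
have -> : iota 0 k.+1 = rcons (iota 0 k) k by rewrite -cats1 -[k.+1]addn1 iotaD.
rewrite map_rcons flatten_rcons catA grun_cat E.
have [|||vs' [ds' [E' sv' sd' aD' HT']]] := @rnd_runs (vs, ds) k.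
- by rewrite /= sv sd.
- by [].
- move=> z lt /=; have leb : z.+1 * (cst l).+1 <= blk by rewrite leq_mul2r lt orbT.
  have lti : k * blk + (z * (cst l).+1 + cst l) < k.+1 * blk.
    by rewrite mulSnr ltn_add2l (leq_trans _ leb) // mulSnr addnS.
  split; [by rewrite sv | exact: HT | ].
  by apply: (all_nthP 0 aD); rewrite sd.
exists (vs ++ vs'), (ds ++ ds'); rewrite !size_cat sv sd sv' sd' -mulSnr; split=> //.
- rewrite all_cat aD' andbT; apply: sub_all aD => d le; apply: leq_trans le _.
  by rewrite leq_mul2r leqnSn orbT.
- by move=> z lt; rewrite nth_cat sv ltnNge leq_addr /= addKn HT'.
Qed.

Lemma fprog_gates : gsem (fprog M K f) 1 (input_env N) =
  nseq blk (GConst false) ++ flatten [seq rnd j | j <- iota 0 (cst K)].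
Proof.
rewrite /fprog [gsem _ _ _]/=; congr (_ ++ _).
rewrite addn1 -/(cst M) -/(cst _) -/l -/blk.
by elim: blk {1}0 => //= m IH i; rewrite IH.
Qed.

(** The output of a circuit is its last gate, which belongs to the last entry of the last round;
    this is where the answer must be stored. *)
Lemma fprog_eval : 0 < cst M ->
  circuit_eval (gsem (fprog M K f) 1 (input_env N)) x = T (cst K) (cst M).-1.
Proof.
move=> M0; rewrite fprog_gates /circuit_eval -grun_vals.
have [vs [ds [-> sv _ _ HT]]] := rounds_run (cst K).
rewrite /= -HT; last by rewrite prednK.
have Eb : blk = (cst M).-1 * (cst l).+1 + (cst l).+1 by rewrite -mulSnr prednK.
by rewrite -nth_last sv mulSnr {2}Eb !addnS.
Qed.

Lemma fprog_size : size (gsem (fprog M K f) 1 (input_env N)) = (cst K).+1 * blk.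
Proof.
rewrite fprog_gates; have [vs [ds [E sv _ _ _]]] := rounds_run (cst K); rewrite -sv.
have : size (grun x ([::], [::]) (nseq blk (GConst false) ++ flatten [seq rnd j | j <- iota 0 (cst K)])).1 = size vs by rewrite E.
move=> <-; set C := _ ++ _; suff gen s : size (grun x s C).1 = size s.1 + size C by rewrite gen.
by elim: C s => [|g C IH] s /=; rewrite ?addn0 // IH size_rcons addSnnS.
Qed.

Lemma fprog_depth :
  circuit_depth (gsem (fprog M K f) 1 (input_env N)) <= cst K * form_depth N f.
Proof.
rewrite fprog_gates /circuit_depth -(grun_depths x).
have [vs [ds [-> _ _ aD _]]] := rounds_run (cst K).
by apply/bigmax_leqP_seq => d /(allP aD).
Qed.
End Rounds.

Theorem in_NC_of_form (M K : expr) (f : fo_form) (kc : nat)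
    (step : nat -> seq bool -> (nat -> bool) -> nat -> bool) (L : seq bool -> Prop) :
  expr_wf 1 M -> expr_wf 1 K -> form_wf 5 f ->
  (forall N, 0 < eval (input_env N) M) ->
  (forall N, eval (input_env N) K <= kc * (trunc_log 2 N).+1) ->
  (forall N x T env, env 0 = N ->
     sat x (eval (input_env N) M) T f 5 env = step N x T (env 3)) ->
  (forall x, let N := size x in
     iter (eval (input_env N) K) (step N x) (fun=> false) (eval (input_env N) M).-1 <-> L x) ->
  in_NC L.
Proof.
move=> wM wK wf M0 Klog satE LE.
have [dc Hd] := form_depth_log wf.
pose S := EMul (succ K) (EMul M (succ (form_last f))).
have wS : expr_wf 1 S by rewrite /= wK wM (form_last_wf wf).
have [c Hc] := expr_bound_poly S.
(* [3 ^ c] pays for the lengths 0 and 1; from length 2 on, [n + 2 <= n ^ 2] turns [(n + 2) ^ c] into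
   [n ^ (2 * c)]. For the depth, [kc * dc] is the factor, and the exponent 2 comes from
   logarithmically many rounds of logarithmic depth. *)
exists (fun n => gsem (fprog M K f) 1 (input_env n)), (3 ^ c + 2 * c + kc * dc + 2); split.
- move=> N; rewrite (@fprog_size [::] N M K f _ wM wf (satE N [::])).
  have -> : (eval (input_env N) K).+1 * (eval (input_env N) M * (eval (input_env N) (form_last f)).+1) =
    eval (input_env N) S by rewrite /= !addn1.
  apply: leq_trans (eval_input_le N wS) _; apply: leq_trans (Hc N) _.
  case: N => [|[|N]].
  + rewrite (leq_trans _ (leq_addl _ _)) //.
    have le23 : 2 ^ c <= 3 ^ c by case: (c) => // c'; rewrite leq_exp2r.
    by rewrite add0n (leq_trans le23) // -!addnA leq_addr.
  + by rewrite (leq_trans _ (leq_addl _ _)) // -!addnA leq_addr.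
  rewrite (leq_trans _ (leq_addr _ _)) //.
  have le2 : N.+2 + 2 <= N.+2 ^ 2 by rewrite expnS expn1; nia.
  apply: (@leq_trans ((N.+2 ^ 2) ^ c)); first by case: (c) => // c'; rewrite leq_exp2r.
  by rewrite -expnM leq_pexp2l //; lia.
- move=> N; apply: leq_trans (fprog_depth K wM wf (satE N [::])) _.
  have := leq_mul (Klog N) (Hd N); set t := (trunc_log 2 N).+1 => le.
  apply: leq_trans le _; rewrite mulnACA; apply: leq_mul; first by lia.
  by rewrite -[t * t]/(t ^ 2) leq_pexp2l //; lia.
- by apply: gprog_logspace; apply: fprog_wf.
move=> x; rewrite (fprog_eval K wM wf (satE (size x) x)) //; exact: LE.
Qed.

(** * The formula for the sandpile problems *)

Inductive mode := Core | Path | Rect.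

(** Two comparisons, because [FLe] is the only arithmetic atom of [fo_form]. *)
Definition eqb2 (a b : nat) := (a <= b) && (b <= a).
Definition existsb (e : nat) (P : nat -> bool) := has P (iota 0 e.+1).

Lemma eqb2E a b : eqb2 a b = (a == b).
Proof. by rewrite /eqb2 -eqn_leq. Qed.

Lemma existsbP e (P : nat -> bool) : reflect (exists2 v, v <= e & P v) (existsb e P).
Proof.
apply: (iffP hasP) => [[v]|[v le Pv]]; last by exists v; rewrite ?mem_iota.
by rewrite mem_iota /= add0n ltnS; exists v.
Qed.

Section Semantics.
Variables (md : mode) (A : seq nat) (N : nat) (x : seq bool).

(** The digits of items are coordinates and their successors, directions below 4, and walk lengths
    up to [N + 1]; all are less than this base. *)
Definition base := 4 * N + 8.
Definition umax := base * base * base * base.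
Definition usize := umax + 1.
Definition tsize := 4 * (base * (base * (base * (usize * usize)))).
(** Tag 0, with digits [p], [v], [q], says that the input encodes [v] from position [p] up to [q];
    tag 1 that item [t] is derivable; tag 2 that [t] is derivable up to the gap [u]; tag 3 is the
    answer. Items carry [n], [m] and the start [h] of the body, which a circuit for length [N]
    cannot know. *)
Definition code tag n m h t u :=
  tag + 4 * (n + base * (m + base * (h + base * (t + usize * u)))).
Definition item a b c d := a + base * (b + base * (c + base * d)).
Definition it1 t := t %% base.
Definition it2 t := (t %/ base) %% base.
Definition it3 t := (t %/ base %/ base) %% base.
Definition it4 t := t %/ base %/ base %/ base.

Definition lit (b : bool) p := if b then nth false x p else ~~ nth false x p.
Definition cellb n m h a b v :=
  let p := h + 3 * (a * m + b) in
  (a + 1 <= n) && ((b + 1 <= m) && (lit (odd v) p && (lit (odd v./2) (p + 1) && lit (odd (v %/ 4)) (p + 2)))).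

(** Directions 0 to 3 increase [b], increase [a], decrease [b], decrease [a], so adding 2 modulo 4
    gives the opposite one. Expressions have no subtraction, so a decrease is written as an increase
    on the other side. *)
Definition nxt dir a b a' b' :=
  (eqb2 dir 0 && (eqb2 a' a && eqb2 b' (b + 1))) ||
  ((eqb2 dir 1 && (eqb2 a' (a + 1) && eqb2 b' b)) ||
  ((eqb2 dir 2 && (eqb2 a' a && eqb2 b (b' + 1))) ||
  (eqb2 dir 3 && (eqb2 a (a' + 1) && eqb2 b' b)))).
Definition adj a b a' b' :=
  (eqb2 a' a && eqb2 b' (b + 1)) || ((eqb2 a' (a + 1) && eqb2 b' b) ||
  ((eqb2 a' a && eqb2 b (b' + 1)) || (eqb2 a (a' + 1) && eqb2 b' b))).
Definition exits n m a b dir :=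
  (eqb2 dir 0 && (m <= b + 1)) || ((eqb2 dir 1 && (n <= a + 1)) ||
  ((eqb2 dir 2 && (b <= 0)) || (eqb2 dir 3 && (a <= 0)))).
Definition ismin z a b := (eqb2 z a && (a <= b)) || (eqb2 z b && (b <= a)).
Definition ismax z a b := (eqb2 z a && (b <= a)) || (eqb2 z b && (a <= b)).
(** Distance at most [g] between the intervals [[a, b]] and [[a', b']]: 0 means that they meet, 1
    that they meet or are adjacent, 2 that at most one point lies between them. *)
Definition gap g a b a' b' := (a' <= b + g) && (a <= b' + g).

Definition ax n m h t :=
  match md with
  | Core => exits n m (it1 t) (it2 t) (it3 t) || eqb2 (it4 t) 0
  | Path => cellb n m h (it1 t) (it2 t) 4
  | Rect => (eqb2 (it1 t) (it2 t) && (eqb2 (it3 t) (it4 t) && cellb n m h (it2 t) (it3 t) 4)) ||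
            (eqb2 (it1 t) (it2 t + 1) && (eqb2 (it3 t) (it4 t) && cellb n m h (it2 t) (it3 t) 3))
  end.

(* In mode [Core], item [(a, b, dir, k)] stands for a walk of length [k] leaving
   cell [(a, b)] in direction [dir]; in mode [Path], item [(a, b, _, _)] for cell
   [(a, b)]; in mode [Rect], item [(a, b, c, d)] for the rectangle with rows [a..b]
   and columns [c..d] if [a <= b], and for the cell [(b, c)] of value 3 if
   [a = b + 1]. The second premise of a rule is idle in the first two modes. *)
Definition rule n m h t1 t2 t :=
  match md with
  | Core =>
      ax n m h t2 && (nxt (it3 t) (it1 t) (it2 t) (it1 t1) (it2 t1) && (eqb2 (it4 t) (it4 t1 + 1) &&
      (cellb n m h (it1 t1) (it2 t1) 0 ||
        (cellb n m h (it1 t1) (it2 t1) 1 && ~~ eqb2 (it3 t1) ((it3 t + 2) %% 4)))))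
  | Path => ax n m h t2 && (adj (it1 t) (it2 t) (it1 t1) (it2 t1) && cellb n m h (it1 t) (it2 t) 3)
  | Rect =>
      (it1 t1 <= it2 t1) && (((it1 t2 <= it2 t2) &&
       ((ismin (it1 t) (it1 t1) (it1 t2) && (ismax (it2 t) (it2 t1) (it2 t2) &&
        (ismin (it3 t) (it3 t1) (it3 t2) && ismax (it4 t) (it4 t1) (it4 t2)))) &&
        ((gap 0 (it1 t1) (it2 t1) (it1 t2) (it2 t2) && gap 2 (it3 t1) (it4 t1) (it3 t2) (it4 t2)) ||
         ((gap 1 (it1 t1) (it2 t1) (it1 t2) (it2 t2) && gap 1 (it3 t1) (it4 t1) (it3 t2) (it4 t2)) ||
          (gap 2 (it1 t1) (it2 t1) (it1 t2) (it2 t2) && gap 0 (it3 t1) (it4 t1) (it3 t2) (it4 t2)))))) ||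
       (eqb2 (it1 t2) (it2 t2 + 1) &&
       ((ismin (it1 t) (it1 t1) (it2 t2) && (ismax (it2 t) (it2 t1) (it2 t2) &&
        (ismin (it3 t) (it3 t1) (it3 t2) && ismax (it4 t) (it4 t1) (it3 t2)))) &&
        ((gap 0 (it1 t1) (it2 t1) (it2 t2) (it2 t2) && gap 1 (it3 t1) (it4 t1) (it3 t2) (it3 t2)) ||
         (gap 1 (it1 t1) (it2 t1) (it2 t2) (it2 t2) && gap 0 (it3 t1) (it4 t1) (it3 t2) (it3 t2))))))
  end.

(** Membership in [A] is a constant of the formula, written as a comparison of numbers to be an
    atom. *)
Definition inA n m h a b :=
  ((1 <= (0 \in A)) && cellb n m h a b 0) || (((1 <= (1 \in A)) && cellb n m h a b 1) ||
  (((1 <= (2 \in A)) && cellb n m h a b 2) || (((1 <= (3 \in A)) && cellb n m h a b 3) ||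
  ((1 <= (4 \in A)) && cellb n m h a b 4)))).

Section Step.
Variable T : nat -> bool.
Definition look c := (c < tsize) && T c.

(** [W dir] certifies that no grain ever comes from direction [dir]. A cell of value 1 topples
    unless two directions are so certified, one of value 0 unless one is. In mode [Path] a cell of
    value 0 asks for its four neighbours; adding [4 * N + 7] modulo [base] subtracts 1. *)
Definition ans n m h i j t :=
  let D t := look (code 1 n m h t 0) in
  match md with
  | Core =>
      let W dir := D (item i j dir (N + 1)) in
      cellb n m h i j 4 ||
      ((cellb n m h i j 1 && ~~ ((W 0 && (W 1 || (W 2 || W 3))) || ((W 1 && (W 2 || W 3)) || (W 2 && W 3)))) ||
       (cellb n m h i j 0 && ~~ (W 0 || (W 1 || (W 2 || W 3)))))
  | Path =>
      ((cellb n m h i j 3 || cellb n m h i j 4) && D (item i j 0 0)) ||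
      (cellb n m h i j 0 && ((1 <= i) && ((1 <= j) &&
       ((D (item i (j + 1) 0 0) && D (item (i + 1) j 0 0)) &&
        (D (item i ((j + (4 * N + 7)) %% base) 0 0) && D (item ((i + (4 * N + 7)) %% base) j 0 0))))))
  | Rect => ((it1 t <= i) && (i <= it2 t)) && (((it3 t <= j) && (j <= it4 t)) && D t)
  end.

(** One pair of equal bits is consumed per round, so decoding takes one round per binary digit and
    one for the terminator. *)
Definition stepE p v q := (p + 2 <= N) && (
  (eqb2 v 0 && (eqb2 q (p + 2) && (lit false p && lit true (p + 1)))) ||
  ((1 <= v) && (((1 <= v %% 2) && (lit true p && lit true (p + 1)) ||
                ((v %% 2 <= 0) && (lit false p && lit false (p + 1)))) &&
                look (code 0 (p + 2) (v %/ 2) q 0 0)))).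

(** The heavy path of [t] is cut at [s]: a gap derivation leads from [t] to [s], and one rule
    application with premises [s1], [s2] closes it. The disjunct [look z] keeps earlier entries. *)
Definition stepD z n m h t :=
  look z || (ax n m h t ||
  existsb umax (fun s => existsb umax (fun s1 => existsb umax (fun s2 =>
    look (code 2 n m h t s) && (rule n m h s1 s2 s &&
    (look (code 1 n m h s1 0) && look (code 1 n m h s2 0))))))).

(** The path from [t] to the gap [u] is cut at [w]: the premise [w1] continues towards the gap, [y]
    is the side branch. *)
Definition stepG z n m h t u :=
  look z || (eqb2 t u ||
  existsb umax (fun w => existsb umax (fun w1 => existsb umax (fun y =>
    look (code 2 n m h t w) && ((rule n m h w1 y w || rule n m h y w1 w) &&
    (look (code 1 n m h y 0) && look (code 2 n m h w1 u))))))).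

(** Guesses the four numbers, the positions where their codes end, and an item [t] offered to
    [ans]. *)
Definition stepA :=
  existsb N (fun n => existsb N (fun m => existsb N (fun i => existsb N (fun j =>
  existsb N (fun q1 => existsb N (fun q2 => existsb N (fun q3 => existsb N (fun h =>
  existsb umax (fun t =>
    (look (code 0 0 n q1 0 0) && (look (code 0 q1 m q2 0 0) &&
     (look (code 0 q2 i q3 0 0) && look (code 0 q3 j h 0 0)))) &&
    (((i + 1 <= n) && ((j + 1 <= m) && eqb2 (h + 3 * (n * m)) N)) &&
     ((~~ existsb N (fun a => existsb N (fun b =>
         ~~ ((n <= a) || ((m <= b) || inA n m h a b))))) &&
      ans n m h i j t))))))))))).

Definition step z :=
  let n := (z %/ 4) %% base in
  let m := (z %/ 4 %/ base) %% base in
  let h := (z %/ 4 %/ base %/ base) %% base in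
  let t := (z %/ 4 %/ base %/ base %/ base) %% usize in
  let u := z %/ 4 %/ base %/ base %/ base %/ usize in
  (eqb2 (z %% 4) 0 && stepE n m h) || ((eqb2 (z %% 4) 1 && stepD z n m h t) ||
  ((eqb2 (z %% 4) 2 && stepG z n m h t u) || (eqb2 (z %% 4) 3 && stepA))).
End Step.
End Semantics.

(* The formulas below are written so that [sat] of each of them is convertible
   to its Boolean counterpart above. *)
Declare Scope expr_scope.
Delimit Scope expr_scope with X.
Bind Scope expr_scope with expr.
Coercion ECst : nat >-> expr.
Notation "a + b" := (EAdd a b) : expr_scope.
Notation "a * b" := (EMul a b) : expr_scope.
Notation "a %/ b" := (EDiv a b) : expr_scope.
Notation "a %% b" := (EMod a b) : expr_scope.
Declare Scope fo_scope.
Delimit Scope fo_scope with Fm.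
Bind Scope fo_scope with fo_form.
Notation "f && g" := (FAnd f g) : fo_scope.
Notation "f || g" := (FOr f g) : fo_scope.
Notation "~~ f" := (FNot f) : fo_scope.
Notation "a <= b" := (FLe a%X b%X) : fo_scope.

Section Formulas.
Variables (md : mode) (A : seq nat).
Local Open Scope fo_scope.
Local Notation NX := (EVar 0).

Definition fEq (a b : expr) : fo_form := (a <= b) && (b <= a).
Definition xbase : expr := (4 * NX + 8)%X.
Definition xumax : expr := (xbase * xbase * xbase * xbase)%X.
Definition xusize : expr := (xumax + 1)%X.
Definition xtsize : expr := (4 * (xbase * (xbase * (xbase * (xusize * xusize)))))%X.
Definition xcode (tag n m h t u : expr) : expr :=
  (tag + 4 * (n + xbase * (m + xbase * (h + xbase * (t + xusize * u)))))%X.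
Definition xitem (a b c d : expr) : expr := (a + xbase * (b + xbase * (c + xbase * d)))%X.
Definition x1 (t : expr) : expr := (t %% xbase)%X.
Definition x2 (t : expr) : expr := ((t %/ xbase) %% xbase)%X.
Definition x3 (t : expr) : expr := ((t %/ xbase %/ xbase) %% xbase)%X.
Definition x4 (t : expr) : expr := (t %/ xbase %/ xbase %/ xbase)%X.

Definition fLit (b : bool) (p : expr) : fo_form := if b then FBit p else ~~ FBit p.
Definition fCell (n m h a b : expr) (v : nat) : fo_form :=
  let p := (h + 3 * (a * m + b))%X in
  (a + 1 <= n) && ((b + 1 <= m) && (fLit (odd v) p && (fLit (odd v./2) (p + 1)%X && fLit (odd (v %/ 4)%N) (p + 2)%X))).

Definition fNxt (dir a b a' b' : expr) : fo_form :=
  (fEq dir 0 && (fEq a' a && fEq b' (b + 1)%X)) ||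
  ((fEq dir 1 && (fEq a' (a + 1)%X && fEq b' b)) ||
  ((fEq dir 2 && (fEq a' a && fEq b (b' + 1)%X)) ||
  (fEq dir 3 && (fEq a (a' + 1)%X && fEq b' b)))).
Definition fAdj (a b a' b' : expr) : fo_form :=
  (fEq a' a && fEq b' (b + 1)%X) || ((fEq a' (a + 1)%X && fEq b' b) ||
  ((fEq a' a && fEq b (b' + 1)%X) || (fEq a (a' + 1)%X && fEq b' b))).
Definition fExits (n m a b dir : expr) : fo_form :=
  (fEq dir 0 && (m <= b + 1)) || ((fEq dir 1 && (n <= a + 1)) ||
  ((fEq dir 2 && (b <= 0)) || (fEq dir 3 && (a <= 0)))).
Definition fMin (z a b : expr) : fo_form := (fEq z a && (a <= b)) || (fEq z b && (b <= a)).
Definition fMax (z a b : expr) : fo_form := (fEq z a && (b <= a)) || (fEq z b && (a <= b)).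
Definition fGap (g a b a' b' : expr) : fo_form := (a' <= b + g) && (a <= b' + g).

Definition fAx (n m h t : expr) : fo_form :=
  match md with
  | Core => fExits n m (x1 t) (x2 t) (x3 t) || fEq (x4 t) 0
  | Path => fCell n m h (x1 t) (x2 t) 4
  | Rect => (fEq (x1 t) (x2 t) && (fEq (x3 t) (x4 t) && fCell n m h (x2 t) (x3 t) 4)) ||
            (fEq (x1 t) (x2 t + 1)%X && (fEq (x3 t) (x4 t) && fCell n m h (x2 t) (x3 t) 3))
  end.

Definition fRule (n m h t1 t2 t : expr) : fo_form :=
  match md with
  | Core =>
      fAx n m h t2 && (fNxt (x3 t) (x1 t) (x2 t) (x1 t1) (x2 t1) && (fEq (x4 t) (x4 t1 + 1)%X &&
      (fCell n m h (x1 t1) (x2 t1) 0 ||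
        (fCell n m h (x1 t1) (x2 t1) 1 && ~~ fEq (x3 t1) ((x3 t + 2) %% 4)%X))))
  | Path => fAx n m h t2 && (fAdj (x1 t) (x2 t) (x1 t1) (x2 t1) && fCell n m h (x1 t) (x2 t) 3)
  | Rect =>
      (x1 t1 <= x2 t1) && (((x1 t2 <= x2 t2) &&
       ((fMin (x1 t) (x1 t1) (x1 t2) && (fMax (x2 t) (x2 t1) (x2 t2) &&
        (fMin (x3 t) (x3 t1) (x3 t2) && fMax (x4 t) (x4 t1) (x4 t2)))) &&
        ((fGap 0 (x1 t1) (x2 t1) (x1 t2) (x2 t2) && fGap 2 (x3 t1) (x4 t1) (x3 t2) (x4 t2)) ||
         ((fGap 1 (x1 t1) (x2 t1) (x1 t2) (x2 t2) && fGap 1 (x3 t1) (x4 t1) (x3 t2) (x4 t2)) ||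
          (fGap 2 (x1 t1) (x2 t1) (x1 t2) (x2 t2) && fGap 0 (x3 t1) (x4 t1) (x3 t2) (x4 t2)))))) ||
       (fEq (x1 t2) (x2 t2 + 1)%X &&
       ((fMin (x1 t) (x1 t1) (x2 t2) && (fMax (x2 t) (x2 t1) (x2 t2) &&
        (fMin (x3 t) (x3 t1) (x3 t2) && fMax (x4 t) (x4 t1) (x3 t2)))) &&
        ((fGap 0 (x1 t1) (x2 t1) (x2 t2) (x2 t2) && fGap 1 (x3 t1) (x4 t1) (x3 t2) (x3 t2)) ||
         (fGap 1 (x1 t1) (x2 t1) (x2 t2) (x2 t2) && fGap 0 (x3 t1) (x4 t1) (x3 t2) (x3 t2))))))
  end.

Definition fInA (n m h a b : expr) : fo_form :=
  ((1 <= (0%N \in A : nat)) && fCell n m h a b 0) || (((1 <= (1%N \in A : nat)) && fCell n m h a b 1) ||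
  (((1 <= (2 \in A : nat)) && fCell n m h a b 2) || (((1 <= (3 \in A : nat)) && fCell n m h a b 3) ||
  ((1 <= (4 \in A : nat)) && fCell n m h a b 4)))).

Definition fAns (n m h i j t : expr) : fo_form :=
  let D t := FTab (xcode 1 n m h t 0) in
  match md with
  | Core =>
      let W (dir : nat) := D (xitem i j dir (NX + 1)%X) in
      fCell n m h i j 4 ||
      ((fCell n m h i j 1 && ~~ ((W 0 && (W 1 || (W 2 || W 3))) || ((W 1 && (W 2 || W 3)) || (W 2 && W 3)))) ||
       (fCell n m h i j 0 && ~~ (W 0 || (W 1 || (W 2 || W 3)))))
  | Path =>
      ((fCell n m h i j 3 || fCell n m h i j 4) && D (xitem i j 0 0)) ||
      (fCell n m h i j 0 && ((1 <= i) && ((1 <= j) &&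
       ((D (xitem i (j + 1)%X 0 0) && D (xitem (i + 1)%X j 0 0)) &&
        (D (xitem i ((j + (4 * NX + 7)) %% xbase)%X 0 0) && D (xitem ((i + (4 * NX + 7)) %% xbase)%X j 0 0))))))
  | Rect => ((x1 t <= i) && (i <= x2 t)) && (((x3 t <= j) && (j <= x4 t)) && D t)
  end.

Definition fStepE (p v q : expr) : fo_form := (p + 2 <= NX) && (
  (fEq v 0 && (fEq q (p + 2)%X && (fLit false p && fLit true (p + 1)%X))) ||
  ((1 <= v) && (((1 <= v %% 2) && (fLit true p && fLit true (p + 1)%X) ||
                ((v %% 2 <= 0) && (fLit false p && fLit false (p + 1)%X))) &&
                FTab (xcode 0 (p + 2)%X (v %/ 2)%X q 0 0)))).

Definition fStepD (z n m h t : expr) : fo_form :=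
  let s := EVar 5 in let s1 := EVar 7 in let s2 := EVar 9 in
  FTab z || (fAx n m h t ||
  FEx xumax (FEx xumax (FEx xumax (
    FTab (xcode 2 n m h t s) && (fRule n m h s1 s2 s &&
    (FTab (xcode 1 n m h s1 0) && FTab (xcode 1 n m h s2 0))))))).

Definition fStepG (z n m h t u : expr) : fo_form :=
  let w := EVar 5 in let w1 := EVar 7 in let y := EVar 9 in
  FTab z || (fEq t u ||
  FEx xumax (FEx xumax (FEx xumax (
    FTab (xcode 2 n m h t w) && ((fRule n m h w1 y w || fRule n m h y w1 w) &&
    (FTab (xcode 1 n m h y 0) && FTab (xcode 2 n m h w1 u))))))).

Definition fStepA : fo_form :=
  let n := EVar 5 in let m := EVar 7 in let i := EVar 9 in let j := EVar 11 in
  let q1 := EVar 13 in let q2 := EVar 15 in let q3 := EVar 17 in let h := EVar 19 in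
  let t := EVar 21 in let a := EVar 23 in let b := EVar 25 in
  FEx NX (FEx NX (FEx NX (FEx NX (FEx NX (FEx NX (FEx NX (FEx NX (FEx xumax (
    (FTab (xcode 0 0 n q1 0 0) && (FTab (xcode 0 q1 m q2 0 0) &&
     (FTab (xcode 0 q2 i q3 0 0) && FTab (xcode 0 q3 j h 0 0)))) &&
    (((i + 1 <= n) && ((j + 1 <= m) && fEq (h + 3 * (n * m))%X NX)) &&
     ((~~ FEx NX (FEx NX (
         ~~ ((n <= a) || ((m <= b) || fInA n m h a b))))) &&
      fAns n m h i j t))))))))))).

Definition fStep : fo_form :=
  let z := EVar 3 in
  let n := ((z %/ 4) %% xbase)%X in
  let m := ((z %/ 4 %/ xbase) %% xbase)%X in
  let h := ((z %/ 4 %/ xbase %/ xbase) %% xbase)%X in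
  let t := ((z %/ 4 %/ xbase %/ xbase %/ xbase) %% xusize)%X in
  let u := (z %/ 4 %/ xbase %/ xbase %/ xbase %/ xusize)%X in
  (fEq (z %% 4)%X 0 && fStepE n m h) || ((fEq (z %% 4)%X 1 && fStepD z n m h t) ||
  ((fEq (z %% 4)%X 2 && fStepG z n m h t u) || (fEq (z %% 4)%X 3 && fStepA))).
End Formulas.

Lemma fStep_wf md A : form_wf 5 (fStep md A).
Proof. by case: md. Qed.


(** * The formula defines one step of the table *)

Section Sat.
Variables (md : mode) (A : seq nat) (N : nat) (x : seq bool) (T : nat -> bool).

Lemma sat_fAx d env n m h t : env 0 = N -> sat x (tsize N) T (fAx md n m h t) d env =
  ax md N x (eval env n) (eval env m) (eval env h) (eval env t).
Proof. by move=> <-; case: md; exact: erefl. Qed.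

Lemma sat_fRule d env n m h t1 t2 t : env 0 = N ->
  sat x (tsize N) T (fRule md n m h t1 t2 t) d env =
  rule md N x (eval env n) (eval env m) (eval env h) (eval env t1) (eval env t2) (eval env t).
Proof. by move=> <-; case: md; exact: erefl. Qed.

Lemma sat_fAns d env n m h i j t : env 0 = N -> sat x (tsize N) T (fAns md n m h i j t) d env =
  ans md N x T (eval env n) (eval env m) (eval env h) (eval env i) (eval env j) (eval env t).
Proof. by move=> <-; case: md; exact: erefl. Qed.

Lemma sat_fStepE d env p v q : env 0 = N -> sat x (tsize N) T (fStepE p v q) d env =
  stepE N x T (eval env p) (eval env v) (eval env q).
Proof. by move=> <-; exact: erefl. Qed.

Lemma sat_fTab d env e : sat x (tsize N) T (FTab e) d env = look N T (eval env e).
Proof. exact: erefl. Qed.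

Lemma sat_fAnd M d env f g : sat x M T (FAnd f g) d env = sat x M T f d env && sat x M T g d env.
Proof. exact: erefl. Qed.

Lemma sat_fOr M d env f g : sat x M T (FOr f g) d env = sat x M T f d env || sat x M T g d env.
Proof. exact: erefl. Qed.

Lemma sat_fNot M d env f : sat x M T (FNot f) d env = ~~ sat x M T f d env.
Proof. exact: erefl. Qed.

Lemma sat_fEx M d env e f : sat x M T (FEx e f) d env =
  existsb (eval env e) (fun v => sat x M T f d.+2 (upd (upd env d.+1 (eval env e).+1) d v)).
Proof. exact: erefl. Qed.

Lemma eq_existsb e P Q : P =1 Q -> existsb e P = existsb e Q.
Proof. by move=> E; apply: eq_has. Qed.

Ltac sat_eq := rewrite ?(sat_fAnd, sat_fOr, sat_fTab, sat_fAx, sat_fRule, sat_fAns, sat_fStepE) //.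

Lemma eval_upd2 v e : expr_wf v e -> forall d env m i, v <= d ->
  eval (upd (upd env d.+1 m) d i) e = eval env e.
Proof. by move=> we d env m i le; apply: eval_ext we _ => r lt; rewrite !updN //; lia. Qed.

Lemma sat_existsU d env f (P : nat -> bool) : env 0 = N ->
  (forall v, sat x (tsize N) T f d.+2 (upd (upd env d.+1 (umax N).+1) d v) = P v) ->
  sat x (tsize N) T (FEx xumax f) d env = existsb (umax N) P.
Proof. by move=> E H; rewrite sat_fEx (_ : eval env xumax = umax N) -?E //; apply: eq_existsb => v; rewrite E. Qed.

Lemma sat_existsN d env f (P : nat -> bool) : env 0 = N ->
  (forall v, sat x (tsize N) T f d.+2 (upd (upd env d.+1 N.+1) d v) = P v) ->
  sat x (tsize N) T (FEx (EVar 0) f) d env = existsb N P.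
Proof. by move=> E H; rewrite sat_fEx /= E; apply: eq_existsb. Qed.

Lemma eval_xcode env tag n m h t u : env 0 = N -> eval env (xcode tag n m h t u) =
  code N (eval env tag) (eval env n) (eval env m) (eval env h) (eval env t) (eval env u).
Proof. by move=> <-; exact: erefl. Qed.

Lemma sat_fStepD env n m h t z : env 0 = N -> all (expr_wf 5) [:: n; m; h; t; z] ->
  sat x (tsize N) T (fStepD md z n m h t) 5 env =
  stepD md N x T (eval env z) (eval env n) (eval env m) (eval env h) (eval env t).
Proof.
move=> E /and5P [wn wm wh wt _].
rewrite /fStepD; sat_eq; congr (_ || (_ || _)).
apply: sat_existsU => // s; apply: sat_existsU => // s1; apply: sat_existsU => // s2.
by sat_eq; rewrite !eval_xcode // !(eval_upd2 wn) // !(eval_upd2 wm) // !(eval_upd2 wh) // !(eval_upd2 wt).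
Qed.

Lemma sat_fStepG env n m h t u z : env 0 = N -> all (expr_wf 5) [:: n; m; h; t; u] ->
  sat x (tsize N) T (fStepG md z n m h t u) 5 env =
  stepG md N x T (eval env z) (eval env n) (eval env m) (eval env h) (eval env t) (eval env u).
Proof.
move=> E /and5P [wn wm wh wt /andP [wu _]].
rewrite /fStepG; sat_eq; congr (_ || (_ || _)).
apply: sat_existsU => // w; apply: sat_existsU => // w1; apply: sat_existsU => // y.
by sat_eq; rewrite !eval_xcode // !(eval_upd2 wn) // !(eval_upd2 wm) // !(eval_upd2 wh) // !(eval_upd2 wt) // !(eval_upd2 wu).
Qed.

Lemma sat_fStepA env : env 0 = N -> sat x (tsize N) T (fStepA md A) 5 env = stepA md A N x T.
Proof.
move=> E; rewrite /fStepA.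
do 8!(apply: sat_existsN => // ?); apply: sat_existsU => // t.
sat_eq; rewrite !eval_xcode //; congr (_ && (_ && (_ && _))); first by rewrite -E.
rewrite sat_fNot; apply: (congr1 negb); apply: sat_existsN => // a; by apply: sat_existsN.
Qed.

Lemma sat_fStep env : env 0 = N ->
  sat x (tsize N) T (fStep md A) 5 env = step md A N x T (env 3).
Proof.
move=> E; rewrite /fStep sat_fOr sat_fAnd sat_fStepE //.
apply: (congr2 orb); first by rewrite -E.
rewrite sat_fOr sat_fAnd sat_fStepD //; apply: (congr2 orb); first by rewrite -E.
rewrite sat_fOr sat_fAnd sat_fStepG //; apply: (congr2 orb); first by rewrite -E.
by rewrite sat_fAnd sat_fStepA // -E.
Qed.
End Sat.

(** Needed are two rounds per doubling of the derivation size, which is linear in [N], and one for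
    the answer; the factor 20 also absorbs the additive constants. *)
Definition xrounds : expr := (20 * (ELog (EVar 0) + 1))%X.
Definition rounds (N : nat) := 20 * (trunc_log 2 N.+1 + 1).

Definition table md A N x k := iter k (step md A N x) (fun=> false).
Arguments table : simpl never.

Lemma in_NC_of_table md A (L : seq bool -> Prop) :
  (forall x, table md A (size x) x (rounds (size x)) (tsize (size x)).-1 <-> L x) -> in_NC L.
Proof.
(* 40 is 20 doubled: [log (N + 1) + 1] is at most [2 * (log N + 1)]. *)
move=> H; apply: (@in_NC_of_form xtsize xrounds (fStep md A) 40 (step md A)) => //.
- exact: fStep_wf.
- by move=> N; rewrite /= !muln_gt0 !addnS /=.
- move=> N; rewrite /= /input_env updE.
  suff : trunc_log 2 N.+1 <= (trunc_log 2 N).+1 by lia.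
  rewrite -[leqRHS](@trunc_expnK 2) //; apply: leq_trunc_log; exact: trunc_log_ltn.
by move=> N x T env E; exact: sat_fStep.
Qed.

(** * Derivations of polynomial size *)

Section Derivations.
Variables (ax : nat -> bool) (rule : nat -> nat -> nat -> bool) (U : nat).

(* The second argument counts the leaves of the derivation. *)
Inductive der : nat -> nat -> Prop :=
| DerAx t : ax t -> t <= U -> der t 1
| DerRule t1 t2 t s1 s2 : rule t1 t2 t -> t <= U -> der t1 s1 -> der t2 s2 ->
    der t (s1 + s2).

(* Derivations of [t] with one missing subderivation, that of [u]. *)
Inductive gap_der : nat -> nat -> nat -> Prop :=
| GapNil t : t <= U -> gap_der t t 0
| GapRule w w1 y u s1 s2 : rule w1 y w || rule y w1 w -> w <= U ->
    gap_der w1 u s1 -> der y s2 -> gap_der w u (s1 + s2).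

Lemma der_le t s : der t s -> t <= U. Proof. by case. Qed.
Lemma der_gt0 t s : der t s -> 0 < s. Proof. by elim=> // *; rewrite addn_gt0; apply/orP; left. Qed.
Lemma gap_der0 t u s : gap_der t u s -> s = 0 -> t = u.
Proof. by case=> // w w1 y u0 s1 s2 _ _ _ /der_gt0; lia. Qed.
Lemma gap_der_le t u s : gap_der t u s -> t <= U. Proof. by case. Qed.

Lemma gap_der_le_r t u s : gap_der t u s -> u <= U. Proof. by elim. Qed.

Lemma gap_fill t u s s' : gap_der t u s -> der u s' -> exists s'', der t s''.
Proof.
elim=> [t0 le0 d|w w1 y u0 s1 s2 ru lew _ IH dy /IH [s'' d]]; first by exists s'.
by case/orP: ru => ru; [exists (s'' + s2) | exists (s2 + s'')]; apply: DerRule ru _ _ _.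
Qed.

Lemma gap_comp t w u s s' : gap_der t w s -> gap_der w u s' -> exists s'', gap_der t u s''.
Proof.
elim=> [t0 le0 d|w0 w1 y u0 s1 s2 ru lew _ IH dy /IH [s'' d]]; first by exists s'.
by exists (s'' + s2); apply: GapRule ru _ d dy.
Qed.

(* The lowest node of the heavy path with more than [m] leaves. *)
Lemma der_split t s m : 0 < m -> der t s -> m < s ->
  exists x x1 x2 s0 s1 s2, [/\ gap_der t x s0, rule x1 x2 x, der x1 s1, der x2 s2 &
    [&& s0 + (s1 + s2) == s, s1 <= m, s2 <= m & m < s1 + s2]].
Proof.
move=> m0; elim=> {t s} [t _ _|t1 t2 t s1 s2 ru le d1 IH1 d2 IH2 lt]; first by case: m m0.
case: (leqP s1 m) => [le1|gt1]; last first.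
  have [x [x1 [x2 [r0 [r1 [r2 [g rx dx1 dx2 /and4P [/eqP e l1 l2 l3]]]]]]]] := IH1 gt1.
  exists x, x1, x2, (r0 + s2), r1, r2; split=> //; first by apply: GapRule g d2; rewrite ?ru.
  by rewrite l1 l2 l3; lia.
case: (leqP s2 m) => [le2|gt2]; last first.
  have [x [x1 [x2 [r0 [r1 [r2 [g rx dx1 dx2 /and4P [/eqP e l1 l2 l3]]]]]]]] := IH2 gt2.
  exists x, x1, x2, (r0 + s1), r1, r2; split=> //; first by apply: GapRule g d1; rewrite ?ru ?orbT.
  by rewrite l1 l2 l3; lia.
exists t, t1, t2, 0, s1, s2; split=> //; first exact: GapNil.
by rewrite le1 le2 lt eqxx.
Qed.

(** Only the part towards the gap falls below the threshold; the side branch [y] may hold most of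
    the leaves and is treated as a derivation in its own right. *)
Lemma gap_split t u s m : gap_der t u s -> m < s ->
  exists w w1 y s0 s1 s2, [/\ gap_der t w s0, rule w1 y w || rule y w1 w,
    gap_der w1 u s1, der y s2 & [&& s0 + (s1 + s2) == s, s1 <= m & m < s1 + s2]].
Proof.
elim=> {t u s} [//|w w1 y u s1 s2 ru le g IH d lt].
case: (leqP s1 m) => [le1|gt1].
  exists w, w1, y, 0, s1, s2; split=> //; first exact: GapNil.
  by rewrite le1 lt eqxx.
have [w' [w1' [y' [r0 [r1 [r2 [g' ru' g1' d' /and3P [/eqP e l1 l2]]]]]]]] := IH gt1.
exists w', w1', y', (r0 + s2), r1, r2; split=> //; first exact: GapRule ru _ g' d.
by rewrite l1 l2; lia.
Qed.
End Derivations.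

Lemma radix_mod b a c : a < b -> (a + b * c) %% b = a.
Proof. by move=> lt; rewrite mulnC addnC modnMDl modn_small. Qed.

Lemma radix_div b a c : a < b -> (a + b * c) %/ b = c.
Proof. by move=> lt; rewrite mulnC addnC divnMDl ?divn_small ?addn0 //; case: b lt. Qed.

Lemma radix_lt b a c B : a < b -> c < B -> a + b * c < b * B.
Proof.
move=> la lc; apply: (@leq_trans (b * c.+1)); first by rewrite mulnS ltn_add2r.
by rewrite leq_mul2l lc orbT.
Qed.

Lemma radix_pred b c : 0 < b -> 0 < c -> (b * c).-1 = b.-1 + b * c.-1.
Proof. by case: b c => [|b] // [|c] // _ _; rewrite mulnS. Qed.

(** * Soundness and completeness of the computed table *)

Section Table.
Variables (md : mode) (A : seq nat) (x : seq bool).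
Let N := size x.
Local Notation base := (base N).
Local Notation umax := (umax N).
Local Notation usize := (usize N).
Local Notation tsize := (tsize N).
Local Notation code := (code N).
Local Notation T := (table md A N x).
Local Notation step := (step md A N x).

Lemma base_gt : N < base. Proof. by rewrite /base; lia. Qed.

Lemma usizeE : usize = umax.+1. Proof. exact: addn1. Qed.

Lemma code_lt tag n m h t u : tag < 4 -> n < base -> m < base -> h < base ->
  t <= umax -> u <= umax -> code tag n m h t u < tsize.
Proof. by move=> *; do !apply: radix_lt => //; rewrite usizeE. Qed.

Lemma step_code T' tag n m h t u : tag < 4 -> n < base -> m < base -> h < base -> t <= umax ->
  step T' (code tag n m h t u) =
  [|| (tag == 0) && stepE N x T' n m h, (tag == 1) && stepD md N x T' (code tag n m h t u) n m h t,
      (tag == 2) && stepG md N x T' (code tag n m h t u) n m h t u | (tag == 3) && stepA md A N x T'].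
Proof.
move=> l0 ln lm lh lt; have ltU : t < usize by rewrite usizeE.
set z := code tag n m h t u.
have E0 : z %% 4 = tag by rewrite radix_mod.
have E1 : (z %/ 4) %% base = n by rewrite radix_div ?radix_mod.
have E2 : (z %/ 4 %/ base) %% base = m by rewrite !radix_div ?radix_mod.
have E3 : (z %/ 4 %/ base %/ base) %% base = h by rewrite !radix_div ?radix_mod.
have E4 : (z %/ 4 %/ base %/ base %/ base) %% usize = t by rewrite !radix_div ?radix_mod.
have E5 : z %/ 4 %/ base %/ base %/ base %/ usize = u by rewrite !radix_div.
by rewrite /step !eqb2E E0 E1 E2 E3 E4 E5.
Qed.

(** The largest index has all digits maximal, in particular tag 3; so the answer is the last entry,
    which the circuit outputs. *)
Lemma step_last T' : step T' tsize.-1 = stepA md A N x T'.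
Proof.
have -> : tsize.-1 = code 3 base.-1 base.-1 base.-1 umax umax.
  have b0 : 0 < base by rewrite /base addnS.
  rewrite /code /tsize usizeE.
  by rewrite !radix_pred ?muln_gt0 ?b0.
have b1 : base.-1 < base by rewrite /base addnS.
by rewrite step_code.
Qed.

Lemma look_code T' tag n m h t u : tag < 4 -> n < base -> m < base -> h < base ->
  t <= umax -> u <= umax -> look N T' (code tag n m h t u) = T' (code tag n m h t u).
Proof. by move=> *; rewrite /look code_lt. Qed.

Lemma tableS k z : T k.+1 z = step (T k) z.
Proof. by []. Qed.

Definition enc_at (p v q : nat) : Prop :=
  q = p + size (enc_nat v) /\ forall i, i < size (enc_nat v) -> nth false x (p + i) = nth false (enc_nat v) i.

Lemma enc_nat0 : enc_nat 0 = [:: false; true]. Proof. by []. Qed.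

Lemma enc_natS v : 0 < v -> enc_nat v = odd v :: odd v :: enc_nat (v %/ 2).
Proof. by case: v => // v _; rewrite /enc_nat bits_ofE divn2. Qed.

Lemma enc_atS p v q : 0 < v -> enc_at p v q <->
  [/\ nth false x p = odd v, nth false x p.+1 = odd v & enc_at p.+2 (v %/ 2) q].
Proof.
move=> v0; rewrite /enc_at enc_natS //=; split=> [[-> H]|[E0 E1 [-> H]]].
  split; [by have := H 0 isT; rewrite addn0 | by have := H 1 isT; rewrite addn1 |].
  split; first by lia.
  by move=> i lt; have := H i.+2 lt; rewrite !addnS !addSn.
split; first by lia.
case=> [|[|i]] lt; rewrite ?addn0 ?addn1 //= !addnS -!addSn; exact: H.
Qed.

Lemma enc_at0 p q : enc_at p 0 q <->
  [/\ q = p + 2, nth false x p = false & nth false x (p + 1) = true].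
Proof.
rewrite /enc_at enc_nat0 /=; split=> [[-> H]|[-> E0 E1]].
  by split=> //; [have := H 0 isT; rewrite addn0 | have := H 1 isT].
by split=> // -[|[|i]] //=; rewrite ?addn0.
Qed.

Lemma stepE_spec T' p v q : stepE N x T' p v q = (p + 2 <= N) &&
  (if v == 0 then [&& q == p + 2, ~~ nth false x p & nth false x p.+1]
   else [&& nth false x p == odd v, nth false x p.+1 == odd v & look N T' (code 0 p.+2 (v %/ 2) q 0 0)]).
Proof.
rewrite /stepE !eqb2E /lit; congr (_ && _).
case: (posnP v) => [->|v0]; first by rewrite /= orbF addn1.
rewrite ?(gtn_eqF v0) ?v0 /= modn2 addn1 addn2.
by case: (odd v); case: (nth _ _ p); case: (nth _ _ p.+1).
Qed.

Lemma enc_sound k p v q : p < base -> v < base -> q < base ->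
  T k (code 0 p v q 0 0) -> enc_at p v q.
Proof.
elim: k p v q => // k IH p v q lp lv lq.
rewrite tableS step_code //= !orbF stepE_spec => /andP [lep].
have lt2 : p.+2 < base by have := base_gt; lia.
case: (posnP v) => [->|v0].
  by move=> /and3P [/eqP -> /negbTE E0 E1]; apply/enc_at0; rewrite addn1.
move=> /and3P [/eqP E0 /eqP E1].
have lv2 : v %/ 2 < base by apply: leq_ltn_trans lv; apply: leq_div.
rewrite look_code // => /IH H; apply/enc_atS => //; split=> //; exact: H.
Qed.

Lemma enc_complete k p v q : q <= N -> v <= N -> v < 2 ^ k -> enc_at p v q ->
  T k.+1 (code 0 p v q 0 0).
Proof.
have lb := base_gt; elim: k p v q => [|k IH] p v q lq lvN lv enc.
all: have lpq : p + 2 <= q by case: enc => -> _; rewrite leq_add2l /enc_nat size_cat /= leq_addl.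
all: rewrite tableS step_code /= ?(leq_ltn_trans _ lb) //; try lia.
all: rewrite !orbF stepE_spec (leq_trans lpq lq) /=.
  have E : v = 0 by move: lv; rewrite expn0; case: (v).
  by move: enc; rewrite E => /enc_at0 [-> E0]; rewrite addn1 E0 => ->; rewrite !eqxx.
case: (posnP v) => [E|v0].
  by move: enc; rewrite E => /enc_at0 [-> E0]; rewrite addn1 E0 => ->; rewrite !eqxx.
have [E0 E1 enc'] := (enc_atS _ _ v0).1 enc; rewrite E0 E1 !eqxx /=.
have lv2 : v %/ 2 < 2 ^ k by rewrite ltn_divLR // mulnC -expnS.
have lvN2 : v %/ 2 <= N by apply: leq_trans (leq_div _ _) lvN.
rewrite look_code ?(leq_ltn_trans _ lb) //; [exact: IH | lia].
Qed.

Section Params.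
Variables (n m h : nat).
Hypotheses (ln : n < base) (lm : m < base) (lh : h < base).
Local Notation axm := (ax md N x n m h).
Local Notation rulem := (rule md N x n m h).
Local Notation derm := (der axm rulem umax).
Local Notation gapm := (gap_der axm rulem umax).

Lemma table_sound k t u : t <= umax ->
  (T k (code 1 n m h t u) -> exists s, derm t s) /\
  (u <= umax -> T k (code 2 n m h t u) -> exists s, gapm t u s).
Proof.
elim: k t u => [|k IH] t u lt; first by split.
split; rewrite !tableS step_code //= !orbF.
  rewrite /stepD => /or3P [|axt|].
  - by rewrite /look => /andP [_ /(IH t u lt).1].
  - by exists 1; apply: DerAx.
  move=> /existsbP [s ls /existsbP [s1 l1 /existsbP [s2 l2]]].
  rewrite !look_code // => /and4P [G ru D1 D2].
  have [r1 d1] := (IH s1 0 l1).1 D1; have [r2 d2] := (IH s2 0 l2).1 D2.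
  have [r g] := (IH t s lt).2 ls G.
  exact: gap_fill g (DerRule ru ls d1 d2).
move=> lu; rewrite /stepG => /or3P [||].
- by rewrite /look => /andP [_ /((IH t u lt).2 lu)].
- by rewrite eqb2E => /eqP <-; exists 0; apply: GapNil.
move=> /existsbP [w lw /existsbP [w1 l1 /existsbP [y ly]]].
rewrite !look_code // => /and4P [G ru D1 G1].
have [r1 d1] := (IH y 0 ly).1 D1; have [r g] := (IH t w lt).2 lw G.
have [r2 g1] := (IH w1 u l1).2 lu G1.
exact: gap_comp g (GapRule ru lw g1 d1).
Qed.

Lemma table_mono k j tag t u : tag \in [:: 1; 2] -> t <= umax -> u <= umax -> k <= j ->
  T k (code tag n m h t u) -> T j (code tag n m h t u).
Proof.
move=> tg lt lu /subnK <-; elim: (j - k) => // i IH /IH H.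
rewrite addSn tableS step_code //; last by move: tg; rewrite !inE => /orP [] /eqP ->.
by move: tg H; rewrite !inE => /orP [] /eqP -> H; rewrite /= ?orbF /stepD /stepG look_code // H.
Qed.

(** A derivation with at most [2 ^ k.+1] leaves splits at threshold [2 ^ k] into a gap derivation
    and two premises of at most [2 ^ k] leaves each. A gap derivation is halved above and below its
    cut, but its side branch may keep up to [2 ^ k.+1] leaves and so waits for the derivations of
    that size. This makes two rounds per doubling. *)
Lemma table_complete k :
  (forall t s, derm t s -> s <= 2 ^ k -> T k.*2.+1 (code 1 n m h t 0)) /\
  (forall t u s, gapm t u s -> u <= umax -> s <= 2 ^ k ->
     T k.*2.+2 (code 2 n m h t u)).
Proof.
have refl j t : t <= umax -> T j.+1 (code 2 n m h t t).
  by move=> lt; rewrite tableS step_code //= orbF /stepG eqb2E eqxx /= orbT.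
have axs j t : t <= umax -> axm t -> T j.+1 (code 1 n m h t 0).
  by move=> lt at'; rewrite tableS step_code //= orbF /stepD at' orbT.
(* With threshold [a], more than [a] leaves lie at or below the cut, so at most [D - a - 1] lie
   above it, and [D <= a.*2.+1] bounds this by [a]. *)
have gap_step D a j : D <= a.*2.+1 ->
    (forall t s, derm t s -> s <= D -> T j (code 1 n m h t 0)) ->
    (forall t u s, gapm t u s -> u <= umax -> s <= a -> T j (code 2 n m h t u)) ->
    forall t u s, gapm t u s -> u <= umax -> s <= D -> T j.+1 (code 2 n m h t u).
  move=> leD HD HG t u s g lu le; have lt := gap_der_le g.
  case: (leqP s a) => [les|gts].
    by apply: table_mono (leqnSn j) _ => //; apply: HG les.
  have [w [w1 [y [s0 [s1 [s2 [g0 ru g1 d /and3P [/eqP e l1 l2]]]]]]]] := gap_split g gts.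
  have [lw lw1 ly] : [/\ w <= umax, w1 <= umax & y <= umax].
    by split; [exact: gap_der_le_r g0 | exact: gap_der_le g1 | exact: der_le d].
  rewrite tableS step_code //= orbF; apply/or3P/Or33/existsbP; exists w => //.
  apply/existsbP; exists w1 => //; apply/existsbP; exists y => //.
  rewrite !look_code // ru; apply/and4P; split=> //.
  - by apply: HG g0 lw _; lia.
  - by apply: HD d _; lia.
  - exact: HG g1 lu l1.
elim: k => [|k [IHD IHG]].
  have D0 t s : derm t s -> s <= 2 ^ 0 -> T 1 (code 1 n m h t 0).
    rewrite expn0; case=> {t s} [t at' lt|t1 t2 t s1 s2 _ _ /der_gt0 p1 /der_gt0 p2]; last by lia.
    by move=> _; apply: axs.
  split=> //; apply: (gap_step _ 0) => // t u s g lu; rewrite leqn0 => /eqP s0.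
  by have <- := gap_der0 g s0; apply: refl; apply: gap_der_le g.
have D1 t s : derm t s -> s <= 2 ^ k.+1 -> T k.*2.+3 (code 1 n m h t 0).
  move=> d le; have lt := der_le d.
  case: (leqP s (2 ^ k)) => [les|gts].
    by apply: table_mono (IHD t s d les) => //; lia.
  have [|y [y1 [y2 [s0 [s1 [s2 [g ru d1 d2 /and4P [/eqP e l1 l2 l3]]]]]]]] := der_split _ d gts.
    by rewrite expn_gt0.
  have [l4 l5] := (der_le d1, der_le d2).
  have ly : y <= umax by exact: gap_der_le_r g.
  rewrite tableS step_code //= orbF; apply/or3P/Or33/existsbP; exists y => //.
  apply/existsbP; exists y1 => //; apply/existsbP; exists y2 => //.
  rewrite !look_code // ru; apply/and4P; split=> //.
  - by apply: IHG g ly _; move: le; rewrite expnS; lia.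
  - by apply: table_mono (IHD _ _ d1 l1) => //; lia.
  - by apply: table_mono (IHD _ _ d2 l2) => //; lia.
rewrite !doubleS; split; first exact: D1.
apply: (gap_step _ (2 ^ k) _ _ D1); first by rewrite expnS; lia.
move=> t u s g lu le; apply: table_mono (IHG t u s g lu le) => //.
exact: gap_der_le g.
Qed.
End Params.
End Table.

(** * Decoding the input *)

(* [look] is the table of derivable items in the last but one round. *)
Definition mode_correct (md : mode) (A : seq nat) : Prop :=
  forall N x n m h (g : nat -> nat -> nat) i j T,
    h + 3 * (n * m) = N -> i < n -> j < m ->
    (forall a b, a < n -> b < m -> g a b \in A) ->
    (forall a b v, v <= 4 -> cellb x n m h a b v = [&& a < n, b < m & g a b == v]) ->
    (forall t, t <= umax N -> look N T (code N 1 n m h t 0) ->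
       exists s, der (ax md N x n m h) (rule md N x n m h) (umax N) t s) ->
    (forall t s, der (ax md N x n m h) (rule md N x n m h) (umax N) t s ->
       s <= 8 * N.+1 -> look N T (code N 1 n m h t 0)) ->
    (exists2 t, t <= umax N & ans md N x T n m h i j t) <->
    fspp_yes (finite_config n m g) i%:Z j%:Z.

Lemma nth_flatten_const (T : Type) (z : T) k ss i e :
  all (fun s => size s == k) ss -> e < k -> i < size ss ->
  nth z (flatten ss) (k * i + e) = nth z (nth [::] ss i) e.
Proof.
elim: ss i => // s ss IH [|i] /= /andP [/eqP sz al] lt.
  by rewrite muln0 nth_cat sz lt.
by move=> li; rewrite nth_cat sz mulnS -addnA ltnNge leq_addr /= addKn IH.
Qed.

Lemma size_flatten_const (T : Type) k (ss : seq (seq T)) :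
  all (fun s => size s == k) ss -> size (flatten ss) = k * size ss.
Proof.
elim: ss => [|s ss IH] /=; first by rewrite muln0.
by move=> /andP [/eqP sz /IH E]; rewrite size_cat sz E mulnS.
Qed.

Section Body.
Variables (n m : nat) (g : nat -> nat -> nat).
Let cells := [seq enc_cell (g a b) | a <- iota 0 n, b <- iota 0 m].

Lemma size_cells : size cells = n * m.
Proof. by rewrite size_allpairs !size_iota. Qed.

Lemma cells_size3 : all (fun s => size s == 3) cells.
Proof. by apply/allP => s /allpairsP [[a b] [_ _ ->]]. Qed.

Lemma nth_cells a b : a < n -> b < m -> nth [::] cells (a * m + b) = enc_cell (g a b).
Proof.
move=> la lb; rewrite /cells /allpairs_dep mulnC.
rewrite (nth_flatten_const [::]) ?size_map ?size_iota //; last first.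
  by apply/allP => s /mapP [a' _ ->]; rewrite size_map size_iota.
rewrite (nth_map 0) ?size_iota // (nth_map 0) ?size_iota //.
by rewrite !nth_iota.
Qed.

Lemma size_body : size (flatten cells) = 3 * (n * m).
Proof. by rewrite (size_flatten_const cells_size3) size_cells. Qed.

Lemma nth_body a b e : a < n -> b < m -> e < 3 ->
  nth false (flatten cells) (3 * (a * m + b) + e) = nth false (enc_cell (g a b)) e.
Proof.
move=> la lb le; rewrite (nth_flatten_const false cells_size3) ?nth_cells //.
by rewrite size_cells (leq_trans (n := a.+1 * m)) ?leq_mul2r ?la ?orbT // mulSn addnC ltn_add2r.
Qed.
End Body.

Lemma enc_at_cat (x pre post : seq bool) p v : x = pre ++ enc_nat v ++ post -> p = size pre ->
  enc_at x p v (p + size (enc_nat v)).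
Proof.
move=> -> ->; split=> // i lt.
by rewrite nth_cat ltnNge leq_addr /= addKn nth_cat lt.
Qed.

Section Reduction.
Variables (md : mode) (A : seq nat).
Hypothesis A4 : all (leq^~ 4) A.
Hypothesis correct : mode_correct md A.
Variable x : seq bool.
Let N := size x.
Let K := (rounds N).-1.
Let T := table md A N x K.

Lemma rounds_gt k : k <= 19 * (trunc_log 2 N.+1).+1 -> k <= K.
Proof. by rewrite /K /rounds addn1; lia. Qed.

Lemma table_last : table md A N x (rounds N) (tsize N).-1 = stepA md A N x T.
Proof.
have -> : rounds N = K.+1 by rewrite /K prednK // /rounds; lia.
by rewrite /table iterS step_last.
Qed.

Lemma look_enc p v q : p <= N -> v <= N -> q <= N ->
  look N T (code N 0 p v q 0 0) <-> enc_at x p v q.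
Proof.
move=> lp lv lq; have lb := base_gt x; rewrite look_code ?(leq_ltn_trans _ lb) //; split.
  by apply: enc_sound; apply: leq_ltn_trans lb.
move=> enc; have -> : T = table md A N x K.-1.+1 by rewrite /T prednK // rounds_gt.
apply: enc_complete => //; apply: leq_ltn_trans lv _.
have := trunc_log_ltn N.+1 (isT : 1 < 2) => lt; apply: leq_trans (ltnW lt) _.
rewrite leq_pexp2l //; suff : (trunc_log 2 N.+1).+2 <= K by lia.
by apply: rounds_gt; lia.
Qed.

Lemma look_der n m h t : n <= N -> m <= N -> h <= N -> t <= umax N ->
  (look N T (code N 1 n m h t 0) ->
     exists s, der (ax md N x n m h) (rule md N x n m h) (umax N) t s) /\
  (forall s, der (ax md N x n m h) (rule md N x n m h) (umax N) t s -> s <= 8 * N.+1 ->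
     look N T (code N 1 n m h t 0)).
Proof.
move=> ln lm lh lt; have lb := base_gt x.
have [ln' lm' lh'] : [/\ n < base N, m < base N & h < base N].
  by split; apply: leq_ltn_trans lb.
rewrite look_code //; split; first exact: (table_sound md A ln' lm' lh' K 0 lt).1.
(* [8 * N.+1] is less than [2 ^ k] for this [k], and [k.*2.+1] rounds are available. In every mode
   the derivations to be found have at most [N + 2] leaves. *)
move=> s d le; set k := (trunc_log 2 N.+1 + 4).
have le2 : s <= 2 ^ k.
  apply: leq_trans le _; rewrite /k addnS expnS !addnS !expnS addn0.
  by have := trunc_log_ltn N.+1 (isT : 1 < 2); rewrite expnS; lia.
have D := (table_complete md A ln' lm' lh' k).1 t s d le2.
apply: table_mono D => //; apply: rounds_gt; rewrite /k; lia.
Qed.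

Lemma cellb_bits n m h (g : nat -> nat -> nat) a b v : v <= 4 ->
  (a < n -> b < m -> g a b <= 4 /\ forall e, e < 3 ->
     nth false x (h + (3 * (a * m + b) + e)) = nth false (enc_cell (g a b)) e) ->
  cellb x n m h a b v = [&& a < n, b < m & g a b == v].
Proof.
move=> lv H; rewrite /cellb !addn1; case: (ltnP a n) => //= la; case: (ltnP b m) => //= lb.
have [lg {}H] := H la lb.
move: (H 0 isT) (H 1 isT) (H 2 isT); rewrite !addnA addn0 addn1 => E0 E1 E2.
rewrite /lit E0 E1 E2 /=.
by move: (g a b) v lg lv {E0 E1 E2 H} => [|[|[|[|[|]]]]] // [|[|[|[|[|]]]]].
Qed.

Lemma inA_P n m h a b : inA A x n m h a b <-> exists2 v, v \in A & cellb x n m h a b v.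
Proof.
rewrite /inA !lt0b; split=> [|[v vA c]].
  by do 4?(case/orP); case/andP => vA c; eexists; eauto.
have := allP A4 v vA; move: v vA c => [|[|[|[|[|]]]]] // -> ->; rewrite ?orbT //.
Qed.

Lemma enc_at_drop p v q : q <= N -> enc_at x p v q -> drop p x = enc_nat v ++ drop q x.
Proof.
move=> lq [Eq H]; apply: (@eq_from_nth _ false) => [|k].
  by rewrite size_cat !size_drop; move: lq; rewrite /N; lia.
rewrite size_drop => lt; rewrite nth_drop nth_cat nth_drop; case: ltnP => [lk|gk]; first exact: H.
by congr nth; lia.
Qed.

Lemma FSPP_table : table md A N x (rounds N) (tsize N).-1 <-> FSPP A x.
Proof.
rewrite table_last; split.
  rewrite /stepA => /existsbP [n ln /existsbP [m lm /existsbP [i li /existsbP [j lj]]]].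
  move=> /existsbP [q1 l1 /existsbP [q2 l2 /existsbP [q3 l3 /existsbP [h lh /existsbP [t lt]]]]].
  move=> /and3P [/and4P [e1 e2 e3 e4] /and3P [lin ljm eN] /andP [al an]].
  move/look_enc: e1 => /(_ (leq0n _) ln l1) e1; move/look_enc: e2 => /(_ l1 lm l2) e2.
  move/look_enc: e3 => /(_ l2 li l3) e3; move/look_enc: e4 => /(_ l3 lj lh) e4.
  move: lin ljm eN; rewrite !addn1 eqb2E => lin ljm /eqP eN.
  (* The only candidate: each value is reassembled from its three bits. *)
  pose g a b := let p := h + 3 * (a * m + b) in
    nth false x p + 2 * nth false x (p + 1) + 4 * nth false x (p + 2).
  have gA a b : a < n -> b < m -> g a b \in A.
    move=> la lb; case: (boolP (inA A x n m h a b)) => [/inA_P [v vA]|nA]; last first.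
      case/negP: al; apply/existsbP; exists a; first by lia.
      apply/existsbP; exists b; first by lia.
      by rewrite negb_or -ltnNge la negb_or -ltnNge lb.
    have := allP A4 v vA; rewrite /cellb /g !addn1 la lb /= /lit.
    set p := h + 3 * (a * m + b); move: (nth _ _ p) (nth _ _ p.+1) (nth _ _ (p + 2)) => b0 b1 b2.
    by move: v vA => [|[|[|[|[|]]]]] //= vA _; case: b0; case: b1; case: b2.
  have gbit a b e : e < 3 ->
      nth false x (h + (3 * (a * m + b) + e)) = nth false (enc_cell (g a b)) e.
    have -> : enc_cell (g a b) = let p := h + 3 * (a * m + b) in
        [:: nth false x p; nth false x (p + 1); nth false x (p + 2)].
      rewrite /g /=; set p := h + _.
      by case: (nth false x p); case: (nth false x (p + 1)); case: (nth false x (p + 2)).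
    by rewrite addnA; case: e => [|[|[|]]] // _; rewrite ?addn0.
  exists n, m, i, j, g; split=> //.
    (* The four codes are stripped one after the other; by [eN] exactly [3 * (n * m)] bits remain
       for the body. *)
    rewrite -[x in LHS]drop0 (enc_at_drop l1 e1) (enc_at_drop l2 e2) (enc_at_drop l3 e3).
    rewrite (enc_at_drop lh e4) /enc_instance; do 4!congr (_ ++ _).
    apply: (@eq_from_nth _ false); first by rewrite size_drop size_body -/N -eN addKn.
    move=> k; rewrite size_drop -/N -eN addKn nth_drop => lk.
    have m0 : 0 < m by case: (m) ljm.
    have Ek : k = 3 * (k %/ 3 %/ m * m + k %/ 3 %% m) + k %% 3.
      by rewrite -divn_eq mulnC -divn_eq.
    have lk3 : k %/ 3 < n * m by rewrite ltn_divLR // mulnC.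
    have la : k %/ 3 %/ m < n by rewrite ltn_divLR.
    by rewrite Ek gbit ?nth_body // ltn_mod.
  apply/(correct (N := N) (x := x) (h := h) (T := T)) => //.
  - move=> a b v lv; apply: cellb_bits => // la lb; split; last exact: gbit.
    exact: (allP A4 _ (gA a b la lb)).
  - by move=> s ls; apply: (look_der ln lm lh ls).1.
  - by move=> s r d; apply: (look_der ln lm lh (der_le d)).2.
  - by exists t.
case=> n [m [i [j [g [gA lin ljm Ex fy]]]]].
set h := size (enc_nat n ++ enc_nat m ++ enc_nat i ++ enc_nat j).
have eN : h + 3 * (n * m) = N by rewrite /N Ex /enc_instance /h -(size_body n m g) !size_cat !addnA.
have [ln lm] : n <= N /\ m <= N.
  have : n <= n * m by rewrite leq_pmulr //; lia.
  have : m <= n * m by rewrite leq_pmull //; lia.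
  by lia.
have lh : h <= N by lia.
have [li lj] : i <= N /\ j <= N by lia.
have body a b e : a < n -> b < m -> e < 3 ->
    nth false x (h + (3 * (a * m + b) + e)) = nth false (enc_cell (g a b)) e.
  move=> la lb le; have -> : x = (enc_nat n ++ enc_nat m ++ enc_nat i ++ enc_nat j) ++
      flatten [seq enc_cell (g a b) | a <- iota 0 n, b <- iota 0 m].
    by rewrite Ex /enc_instance -!catA.
  by rewrite nth_cat -/h ltnNge leq_addr /= addKn nth_body.
have [t lt an] : exists2 t, t <= umax N & ans md N x T n m h i j t.
  apply/(correct (g := g)) => //.
  - move=> a b v lv; apply: cellb_bits => // la lb; split; last by move=> e; apply: body.
    exact: (allP A4 _ (gA a b la lb)).
  - by move=> s ls; apply: (look_der ln lm lh ls).1.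
  - by move=> s r d; apply: (look_der ln lm lh (der_le d)).2.
set q1 := size (enc_nat n); set q2 := q1 + size (enc_nat m); set q3 := q2 + size (enc_nat i).
have eh : q3 + size (enc_nat j) = h by rewrite /h /q3 /q2 /q1 !size_cat !addnA.
have e1 : enc_at x 0 n q1.
  by apply: (@enc_at_cat x [::] (enc_nat m ++ enc_nat i ++ enc_nat j ++ flatten [seq enc_cell (g a b) | a <- iota 0 n, b <- iota 0 m])).
have e2 : enc_at x q1 m q2.
  by apply: (@enc_at_cat x (enc_nat n) (enc_nat i ++ enc_nat j ++ flatten [seq enc_cell (g a b) | a <- iota 0 n, b <- iota 0 m])).
have e3 : enc_at x q2 i q3.
  apply: (@enc_at_cat x (enc_nat n ++ enc_nat m) (enc_nat j ++ flatten [seq enc_cell (g a b) | a <- iota 0 n, b <- iota 0 m])).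
    by rewrite Ex /enc_instance -!catA.
  by rewrite /q2 /q1 size_cat.
have e4 : enc_at x q3 j h.
  rewrite -eh; apply: (@enc_at_cat x (enc_nat n ++ enc_nat m ++ enc_nat i) (flatten [seq enc_cell (g a b) | a <- iota 0 n, b <- iota 0 m])).
    by rewrite Ex /enc_instance -!catA.
  by rewrite /q3 /q2 /q1 !size_cat !addnA.
have lq3 : q3 <= N by apply: leq_trans lh; rewrite -eh leq_addr.
have lq2 : q2 <= N by apply: leq_trans lq3; apply: leq_addr.
have lq1 : q1 <= N by apply: leq_trans lq2; apply: leq_addr.
rewrite /stepA; apply/existsbP; exists n => //; apply/existsbP; exists m => //.
apply/existsbP; exists i => //; apply/existsbP; exists j => //.
apply/existsbP; exists q1 => //.
apply/existsbP; exists q2 => //.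
apply/existsbP; exists q3 => //.
apply/existsbP; exists h => //; apply/existsbP; exists t => //.
rewrite an !addn1 lin ljm eqb2E eN eqxx /= andbT; apply/andP; split.
  by apply/and4P; split; apply/look_enc.
apply/negP => /existsbP [a la /existsbP [b lb]]; rewrite negb_or -ltnNge negb_or -ltnNge => /and3P [lan lbm /negP []].
apply: (inA_P n m h a b).2; exists (g a b); first exact: gA.
rewrite (@cellb_bits n m h g) ?lan ?lbm ?eqxx //; first exact: (allP A4 _ (gA a b lan lbm)).
move=> _ _; split; last by move=> e; apply: body.
exact: (allP A4 _ (gA a b lan lbm)).
Qed.
End Reduction.

Lemma in_NC_FSPP md A : all (leq^~ 4) A -> mode_correct md A -> in_NC (FSPP A).
Proof. by move=> A4 cor; apply: (@in_NC_of_table md A) => x; apply: FSPP_table. Qed.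

(** * The toppled cells *)

Section Toppling.
Variables (n m : nat) (g : nat -> nat -> nat).

(* [top t a b]: cell [(a, b)] is active at some time before [t]. Since a cell
   topples at most once, this is bootstrap percolation with threshold [4 - g]. *)
Fixpoint top (t a b : nat) : bool :=
  if t is t'.+1 then
    top t' a b || [&& a < n, b < m &
      4 <= g a b + (top t' a b.+1 + top t' a.+1 b + ((0 < b) && top t' a b.-1) + ((0 < a) && top t' a.-1 b))]
  else false.
Arguments top : simpl never.

Definition top_nbr (t a b dir : nat) : bool :=
  match dir with
  | 0 => top t a b.+1
  | 1 => top t a.+1 b
  | 2 => (0 < b) && top t a b.-1
  | 3 => (0 < a) && top t a.-1 b
  | _ => false
  end.

Definition top_sum (t a b : nat) : nat :=
  top_nbr t a b 0 + top_nbr t a b 1 + top_nbr t a b 2 + top_nbr t a b 3.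

Lemma topS t a b : top t.+1 a b = top t a b || [&& a < n, b < m & 4 <= g a b + top_sum t a b].
Proof. by []. Qed.

Lemma top_in t a b : top t a b -> (a < n) && (b < m).
Proof. by elim: t => // t IH; rewrite topS => /orP [/IH|/and3P [-> ->]]. Qed.

Lemma top_mono t t' a b : t <= t' -> top t a b -> top t' a b.
Proof. by move/subnK <-; elim: (t' - t) => // k IH /IH; rewrite addSn topS => ->. Qed.

(** A cell that has not toppled holds its initial grains and one for each neighbour toppled before.
    To be active at time [t] is to enter [top] between [t] and [t.+1], so the contributions
    telescope. *)
Lemma iter_F t i j : iter t F (finite_config n m g) i j =
  match i, j with
  | Posz a, Posz b => if (a < n) && (b < m) then
      if top t a b then None else Some (g a b + top_sum t a b) else None
  | _, _ => None
  end.
Proof.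
elim: t i j => [|t IH] i j.
  case: i j => a [b|b] //=; case: ifP => // _; congr Some.
  by rewrite /top_sum /= /top !andbF !addn0.
rewrite iterS /F IH.
have act a b : active (iter t F (finite_config n m g) (Posz a) (Posz b)) = top t.+1 a b && ~~ top t a b.
  rewrite IH topS; case: (boolP (top t a b)) => [tt|_]; first by case: ifP; rewrite andbF.
  by case: (a < n); case: (b < m); rewrite /= ?andbT.
have actN1 a b : active (iter t F (finite_config n m g) (Posz a) (Posz b - 1)%R) =
    (0 < b) && (top t.+1 a b.-1 && ~~ top t a b.-1).
  case: b => [|b]; first by rewrite IH.
  by rewrite -act; congr (active (iter _ _ _ _ _)); lia.
have actN2 a b : active (iter t F (finite_config n m g) (Posz a - 1)%R (Posz b)) =
    (0 < a) && (top t.+1 a.-1 b && ~~ top t a.-1 b).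
  case: a => [|a]; first by rewrite IH.
  by rewrite -act; congr (active (iter _ _ _ _ _)); lia.
case: i j => a [b|b] //=; case: (boolP ((a < n) && (b < m))) => // /andP [la lb].
rewrite topS la lb; case: (boolP (top t a b)) => //= _.
case: ifP => // _; congr Some.
have -> : (Posz b + 1)%R = Posz b.+1 by lia.
have -> : (Posz a + 1)%R = Posz a.+1 by lia.
rewrite !act actN1 actN2 -!addnA; congr (_ + _).
have E c d : (top t.+1 c d : nat) = top t c d + (top t.+1 c d && ~~ top t c d).
  by rewrite topS; case: (top t c d); case: [&& _, _ & _].
rewrite /top_sum /top_nbr.
rewrite (E a b.+1) (E a.+1 b).
have E2 : ((0 < b) && top t.+1 a b.-1 : nat) = ((0 < b) && top t a b.-1) + ((0 < b) && (top t.+1 a b.-1 && ~~ top t a b.-1)).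
  by case: (0 < b) => //; exact: E.
have E3 : ((0 < a) && top t.+1 a.-1 b : nat) = ((0 < a) && top t a.-1 b) + ((0 < a) && (top t.+1 a.-1 b && ~~ top t a.-1 b)).
  by case: (0 < a) => //; exact: E.
rewrite E2 E3; lia.
Qed.

Lemma fspp_top a b : fspp_yes (finite_config n m g) a%:Z b%:Z <-> exists t, top t a b.
Proof.
split=> [[t]|[t]].
  rewrite iter_F; case: ifP => // /andP [la lb]; case: ifP => [tt _|_ /= ge]; first by exists t.
  by exists t.+1; rewrite topS la lb ge orbT.
elim: t => // t IH; rewrite topS => /orP [/IH //|/and3P [la lb ge]].
case: (boolP (top t a b)) => [/IH //|ntop].
by exists t; rewrite iter_F la lb (negPf ntop).
Qed.

(** The toppled sets increase, and once two consecutive ones agree they stay constant; with [n * m]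
    cells this happens within [n * m] steps. *)
Lemma top_stable t a b : top t a b -> top (n * m) a b.
Proof.
pose S t := [set p : 'I_n * 'I_m | top t p.1 p.2].
have St p t' : (p \in S t') = top t' p.1 p.2 by rewrite inE.
have sub t' : S t' \subset S t'.+1 by apply/subsetP => p; rewrite !St; apply: top_mono.
have fix_ k : S k.+1 = S k -> forall j a b, top (k + j) a b = top k a b.
  move=> E j; elim: j => [|j IH] a' b'; first by rewrite addn0.
  have -> : top (k + j.+1) a' b' = top k.+1 a' b'.
    by rewrite addnS !topS /top_sum /top_nbr !IH.
  apply/idP/idP; last exact: top_mono.
  move=> tk; have /andP [la lb] := top_in tk.
  by move/setP: E => /(_ (Ordinal la, Ordinal lb)); rewrite !St /= => <-.
have grow k : (exists2 k0, k0 < k & S k0.+1 = S k0) \/ k <= #|S k|.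
  elim: k => [|k [[k0 lt E]|IH]]; first by right.
    by left; exists k0 => //; lia.
  case: (eqVneq (S k.+1) (S k)) => [E|ne]; first by left; exists k.
  right; apply: leq_ltn_trans IH _; apply: proper_card.
  by rewrite properEneq eq_sym ne sub.
have [k0 lek E] : exists2 k0, k0 <= n * m & S k0.+1 = S k0.
  case: (grow (n * m).+1) => [[k0 lt E]|le]; first by exists k0.
  by have := max_card (S (n * m).+1); rewrite card_prod !card_ord; lia.
move=> tt; apply: top_mono lek _; rewrite -(fix_ k0 E t); apply: top_mono tt; exact: leq_addl.
Qed.

Lemma fsppE a b : fspp_yes (finite_config n m g) a%:Z b%:Z <-> top (n * m) a b.
Proof. by rewrite fspp_top; split=> [[t /top_stable]|]; last exists (n * m). Qed.

Lemma top_lim a b : a < n -> b < m ->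
  4 <= g a b + top_sum (n * m) a b -> top (n * m) a b.
Proof. by move=> la lb ge; apply: (@top_stable (n * m).+1); rewrite topS la lb ge orbT. Qed.

(** Isolates the step at which the cell topples; the neighbours that cause it have toppled earlier,
    which gives later inductions their decreasing time. *)
Lemma top_first t a b : top t a b ->
  exists s, [/\ s < t, ~~ top s a b, top s.+1 a b & 4 <= g a b + top_sum s a b].
Proof.
elim: t => // t IH; case: (boolP (top t a b)) => [tt _|nt tS].
  by have [s [lt H1 H2 H3]] := IH tt; exists s; split=> //; lia.
by exists t; split=> //; move: tS; rewrite topS (negPf nt) => /and3P [].
Qed.

Lemma nxt_top t dir a b a' b' : nxt dir a b a' b' -> top_nbr t a b dir = top t a' b'.
Proof.
rewrite /nxt !eqb2E !addn1.
by case/or4P => /and3P [/eqP -> /eqP E1 /eqP E2]; subst => //=.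
Qed.

Lemma nxt_opp t dir a b a' b' : nxt dir a b a' b' ->
  dir < 4 /\ top_nbr t a' b' ((dir + 2) %% 4) = top t a b.
Proof.
rewrite /nxt !eqb2E !addn1.
by case/or4P => /and3P [/eqP -> /eqP E1 /eqP E2]; subst => //=.
Qed.

Lemma exits_top t dir a b : exits n m a b dir -> top_nbr t a b dir = false.
Proof.
rewrite /exits !eqb2E !addn1; case/or4P => /andP [/eqP -> le] /=.
all: try by apply/negbTE/negP => /top_in; lia.
all: by move: le; rewrite leqn0 => /eqP ->.
Qed.

Lemma exits_or_nxt dir a b : dir < 4 -> a < n -> b < m -> ~~ exits n m a b dir ->
  exists a' b', [/\ nxt dir a b a' b', a' < n & b' < m].
Proof.
rewrite /exits /nxt !eqb2E !addn1; case: dir => [|[|[|[|]]]] //= _ la lb; rewrite ?orbF => lt.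
- by exists a, b.+1; rewrite !eqb2E ?addn1 /= ?eqxx ?orbT; split=> //; lia.
- by exists a.+1, b; rewrite !eqb2E ?addn1 /= ?eqxx ?orbT; split=> //; lia.
- by exists a, b.-1; rewrite !eqb2E ?addn1 /= ?eqxx ?orbT; split=> //; lia.
- by exists a.-1, b; rewrite !eqb2E ?addn1 /= ?eqxx ?orbT; split=> //; lia.
Qed.

Lemma exits_nxt dir a b a' b' : nxt dir a b a' b' -> exits n m a b dir -> ~~ ((a' < n) && (b' < m)).
Proof.
rewrite /exits /nxt !eqb2E !addn1.
by case/or4P => /and3P [/eqP -> /eqP E1 /eqP E2] /=; lia.
Qed.
End Toppling.
Arguments top : simpl never.

(** * Values 0, 1, 4 *)

Section Items.
Variables (N a b c d : nat).
Hypotheses (la : a < base N) (lb : b < base N) (lc : c < base N).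

Lemma it1_item : it1 N (item N a b c d) = a. Proof. exact: radix_mod. Qed.
Lemma it2_item : it2 N (item N a b c d) = b.
Proof. by rewrite /it2 radix_div // radix_mod. Qed.
Lemma it3_item : it3 N (item N a b c d) = c.
Proof. by rewrite /it3 !radix_div // radix_mod. Qed.
Lemma it4_item : it4 N (item N a b c d) = d.
Proof. by rewrite /it4 !radix_div. Qed.
Lemma item_le : d < base N -> item N a b c d <= umax N.
Proof. by move=> ld; apply: ltnW; rewrite /umax -!mulnA; do 3!apply: radix_lt => //. Qed.
End Items.

Section DirectionSums.
Variables (n m : nat) (g : nat -> nat -> nat) (t a b : nat).
Local Notation nb := (top_nbr n m g t a b).
Local Notation sum := (top_sum n m g t a b).

Lemma top_sum_lt4 d : d < 4 -> ~~ nb d -> sum < 4.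
Proof.
rewrite /top_sum; case: d => [|[|[|[|]]]] // _ /negPf ->;
  by case: (nb 0); case: (nb 1); case: (nb 2); case: (nb 3).
Qed.

Lemma top_sum_lt3 d e : d < 4 -> e < 4 -> d != e -> ~~ nb d -> ~~ nb e -> sum < 3.
Proof.
rewrite /top_sum; case: d => [|[|[|[|]]]] // _; case: e => [|[|[|[|]]]] // _ _ /negPf -> /negPf ->;
  by case: (nb 0); case: (nb 1); case: (nb 2); case: (nb 3).
Qed.

Lemma ex_top_nbrN : sum < 4 -> exists2 d, d < 4 & ~~ nb d.
Proof.
rewrite /top_sum => lt.
case: (boolP (nb 0)) => E0; last by exists 0.
case: (boolP (nb 1)) => E1; last by exists 1.
case: (boolP (nb 2)) => E2; last by exists 2.
by exists 3 => //; move: lt; rewrite E0 E1 E2; case: (nb 3).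
Qed.

Lemma ex_top_nbrN2 e : sum < 3 -> exists2 d, d < 4 & (d != e) && ~~ nb d.
Proof.
rewrite /top_sum => lt.
case: (eqVneq e 0) => [->|e0].
  case: (boolP (nb 1)) => E1; last by exists 1.
  case: (boolP (nb 2)) => E2; last by exists 2.
  by exists 3 => //; move: lt; rewrite E1 E2; case: (nb 3); case: (nb 0).
case: (boolP (nb 0)) => E0; last by exists 0; rewrite // eq_sym e0.
case: (eqVneq e 1) => [->|e1].
  case: (boolP (nb 2)) => E2; last by exists 2.
  by exists 3 => //; move: lt; rewrite E0 E2; case: (nb 3); case: (nb 1).
case: (boolP (nb 1)) => E1; last by exists 1; rewrite // eq_sym e1.
by move: lt; rewrite E0 E1; case: (eqVneq e 2) => [->|e2]; [exists 3 | exists 2];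
  rewrite // 1?eq_sym ?e2 //; move: lt; case: (nb 2); case: (nb 3).
Qed.
End DirectionSums.

Lemma nxt_fun dir a b a1 b1 a2 b2 : nxt dir a b a1 b1 -> nxt dir a b a2 b2 -> a1 = a2 /\ b1 = b2.
Proof.
rewrite /nxt !eqb2E !addn1.
by case: dir => [|[|[|[|]]]] //=; rewrite ?orbF => /andP [/eqP ? /eqP ?] /andP [/eqP ? /eqP ?]; lia.
Qed.

Section Core.
Variables (n m : nat) (g : nat -> nat -> nat).
Local Notation top := (top n m g).
Local Notation M := (n * m).

(* A walk leaving [(a, b)] in direction [dir] that can be continued for [k] steps,
   or until it leaves the grid, turning back only at cells of value 0. *)
Inductive walk : nat -> nat -> nat -> nat -> Prop :=
| WalkExit a b dir k : exits n m a b dir -> walk a b dir k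
| Walk0 a b dir : walk a b dir 0
| WalkS a b dir a' b' dir' k : nxt dir a b a' b' ->
    (g a' b' == 0) || ((g a' b' == 1) && (dir' != (dir + 2) %% 4)) ->
    walk a' b' dir' k -> walk a b dir k.+1.

(* Along a walk, each toppled cell has received grains from the next one, so
   toppling times decrease. *)
Lemma walk_le t a b dir k a' b' : nxt dir a b a' b' -> top t a' b' -> ~~ top t a b ->
  walk a b dir k -> k <= t.
Proof.
elim/ltn_ind: t a b dir k a' b' => t IH a b dir k a' b' nx tw ntu wk.
have [s [lts ntw _ ge]] := top_first tw.
have ntu' : ~~ top s a b by apply: contra ntu; apply: top_mono; apply: ltnW.
(* [(a', b')] topples at step [s], when [(a, b)], its neighbour backwards, has not: at most three of
   its neighbours have toppled by then. *)
have [ld opp] := nxt_opp n m g s nx.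
have lo : (dir + 2) %% 4 < 4 by rewrite ltn_mod.
have nopp : ~~ top_nbr n m g s a' b' ((dir + 2) %% 4) by rewrite opp.
have lt4 := top_sum_lt4 lo nopp.
case: wk nx ntu' lo nopp {ntu opp ld} => // [a0 b0 dir0 k0 ex|a0 b0 dir0 a1 b1 dir' k0 nx1 cond wk] nx ntu' lo nopp.
  by have := exits_nxt nx ex; rewrite (top_in tw).
have [Ea Eb] := nxt_fun nx1 nx; subst a1 b1.
case/orP: cond => [/eqP g0|/andP [/eqP g1 ne]].
  by move: ge; rewrite g0 add0n leqNgt lt4.
(* If [dir'] is not a direction, only a walk of length 0 can continue. *)
case: (ltnP dir' 4) => [ld'|gd']; last first.
  have -> : k0 = 0; last by lia.
  by case: wk gd' => // [? ? ? ? +|? ? ? ? ? ? ? + _ _]; rewrite ?/exits ?/nxt !eqb2E => /or4P [] /andP [/eqP -> _].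
(* A cell of value 1 needs three neighbours and the one backwards is missing, so the one ahead has
   toppled by time [s]. *)
have nb' : top_nbr n m g s a' b' dir'.
  apply: contraT => nnb; have := top_sum_lt3 lo ld' _ nopp nnb.
  by rewrite eq_sym ne => /(_ isT); move: ge; rewrite g1; lia.
have /andP [la lb] := top_in tw.
case: (boolP (exits n m a' b' dir')) => [ex|nex].
  by move: nb'; rewrite (exits_top g s ex).
have [a2 [b2 [nx2 _ _]]] := exits_or_nxt ld' la lb nex.
apply: leq_trans (lts); rewrite ltnS.
by apply: (IH s lts a' b' dir' k0 a2 b2 nx2) => //; rewrite -(nxt_top n m g s nx2).
Qed.

Variables (N h : nat) (x : seq bool).
Hypothesis eN : h + 3 * (n * m) = N.
Hypothesis gA : forall a b, a < n -> b < m -> g a b \in [:: 0; 1; 4].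
Hypothesis cellE : forall a b v, v <= 4 -> cellb x n m h a b v = [&& a < n, b < m & g a b == v].
Local Notation der := (der (ax Core N x n m h) (rule Core N x n m h) (umax N)).

Lemma der_walk t s : der t s -> walk (it1 N t) (it2 N t) (it3 N t) (it4 N t).
Proof.
elim=> {t s} [t|t1 t2 t s1 s2] /=.
  by rewrite eqb2E => /orP [ex|/eqP ->] _; [apply: WalkExit | apply: Walk0].
rewrite !eqb2E !cellE // addn1 => /and4P [_ nx /eqP -> cond] _ _ w1 _ _.
apply: WalkS nx _ w1; case/orP: cond => [/and3P [_ _ ->] //|].
by case/andP=> /and3P [_ _ ->] ->; rewrite orbT.
Qed.

Lemma dims_lt a b : a < n -> b < m -> a < base N /\ b < base N.
Proof.
move=> la lb; have : n <= n * m by rewrite leq_pmulr //; lia.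
have : m <= n * m by rewrite leq_pmull //; lia.
by rewrite /base; lia.
Qed.

(** A never toppling cell of value 0 has a never toppling neighbour, and one of value 1 has two, so
    the walk goes on without a forbidden turn; a 4 is excluded. Each step costs one leaf for the
    idle premise. *)
Lemma nontop_der k a b dir : a < n -> b < m -> dir < 4 -> ~~ top_nbr n m g M a b dir ->
  k < base N -> exists2 s, s <= k.+1 & der (item N a b dir k) s.
Proof.
have b8 d : d < 4 -> d < base N by rewrite /base; lia.
elim: k a b dir => [|k IH] a b dir la lb ld nt lk; have [la' lb'] := dims_lt la lb.
  exists 1 => //; apply: DerAx; last by apply: item_le => //; exact: b8.
  by rewrite /= it4_item ?eqb2E ?eqxx ?orbT //; exact: b8.
have li : item N a b dir k.+1 <= umax N by apply: item_le => //; exact: b8.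
case: (boolP (exits n m a b dir)) => [ex|nex].
  exists 1 => //; apply: DerAx => //=.
  by rewrite it1_item ?it2_item ?it3_item ?ex //; exact: b8.
have [a1 [b1 [nx la1 lb1]]] := exits_or_nxt ld la lb nex.
have [la1' lb1'] := dims_lt la1 lb1.
have nt1 : ~~ top M a1 b1 by rewrite -(nxt_top n m g M nx).
have lt4 : g a1 b1 + top_sum n m g M a1 b1 < 4.
  by rewrite ltnNge; apply: contra nt1; apply: top_lim.
have [d1 ld1 [nt2 cond]] : exists2 d1, d1 < 4 & ~~ top_nbr n m g M a1 b1 d1 /\
    ((g a1 b1 == 0) || ((g a1 b1 == 1) && (d1 != (dir + 2) %% 4))).
  have := gA la1 lb1; rewrite !inE => /or3P [] /eqP gv; rewrite gv in lt4 *.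
  - by have [d1 l1 nt2] := ex_top_nbrN lt4; exists d1.
  - by have [d1 l1 /andP [ne nt2]] := @ex_top_nbrN2 n m g M a1 b1 ((dir + 2) %% 4) lt4; exists d1.
  - by [].
have [s les d] := IH a1 b1 d1 la1 lb1 ld1 nt2 (ltnW lk).
have dy : der (item N 0 0 0 0) 1.
  by apply: DerAx; [rewrite /= it4_item ?eqb2E ?eqxx ?orbT ?b8 | apply: item_le; exact: b8].
exists (s + 1); first by lia.
apply: DerRule li d dy => /=.
rewrite !it1_item ?it2_item ?it3_item ?it4_item ?eqb2E ?eqxx ?orbT ?nx ?addn1 ?eqxx //=; try exact: b8.
by rewrite !cellE // la1 lb1.
Qed.
End Core.

Lemma Core_correct A : {subset A <= [:: 0; 1; 4]} -> mode_correct Core A.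
Proof.
move=> sA N x n m h g i j T eN li lj gA cellE sound complete; rewrite fsppE.
have gA' a b : a < n -> b < m -> g a b \in [:: 0; 1; 4] by move=> la lb; apply/sA/gA.
have b8 d : d < 4 -> d < base N by rewrite /base; lia.
have [li' lj'] := dims_lt eN li lj.
have lM : n * m <= N by lia.
pose W dir := look N T (code N 1 n m h (item N i j dir (N + 1)) 0).
have itle dir : dir < 4 -> item N i j dir (N + 1) <= umax N.
  by move=> ld; apply: item_le => //; [exact: b8 | rewrite /base; lia].
have W1 dir : dir < 4 -> ~~ top_nbr n m g (n * m) i j dir -> W dir.
  move=> ld nt; have [|s le d] := @nontop_der n m g N h x eN gA' cellE (N + 1) i j dir li lj ld nt.
    by rewrite /base; lia.
  by apply: complete d _; lia.
(* A walk of length [N + 1] towards a cell toppled by time [s] would give [N + 1 <= s] by [walk_le],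
   although [s < n * m <= N]. *)
have W2 s dir : dir < 4 -> s < n * m -> ~~ top n m g s i j -> W dir -> ~~ top_nbr n m g s i j dir.
  move=> ld ls nt /sound [|s' d]; first exact: itle.
  have := der_walk cellE d; rewrite it1_item ?it2_item ?it3_item ?it4_item //; try exact: b8.
  case: (boolP (exits n m i j dir)) => [ex _|nex wk]; first by rewrite (exits_top g s ex).
  have [a1 [b1 [nx la1 lb1]]] := exits_or_nxt ld li lj nex.
  rewrite (nxt_top n m g s nx); apply/negP => tt.
  by have := walk_le nx tt nt wk; lia.
have ansE : (exists2 t, t <= umax N & ans Core N x T n m h i j t) <->
    (g i j == 4) || ((g i j == 1) && ~~ ((W 0 && (W 1 || (W 2 || W 3))) || ((W 1 && (W 2 || W 3)) || (W 2 && W 3))) ||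
    ((g i j == 0) && ~~ (W 0 || (W 1 || (W 2 || W 3))))).
  have E t : ans Core N x T n m h i j t = (g i j == 4) || ((g i j == 1) && ~~ ((W 0 && (W 1 || (W 2 || W 3))) || ((W 1 && (W 2 || W 3)) || (W 2 && W 3))) ||
    ((g i j == 0) && ~~ (W 0 || (W 1 || (W 2 || W 3))))).
    by rewrite /ans !cellE // li lj.
  by split=> [[t _]|H]; [rewrite E | exists 0 => //; rewrite E].
rewrite ansE {ansE}.
have := gA' i j li lj; rewrite !inE => /or3P [] /eqP gv; rewrite gv /= ?orbF.
- split=> [nW|tt].
    apply: contraT => nt; have lt : g i j + top_sum n m g (n * m) i j < 4.
      by rewrite ltnNge; apply: contra nt; apply: top_lim.
    rewrite gv in lt; have [d ld nd] := ex_top_nbrN lt.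
    have Wd := W1 d ld nd; move: nW; rewrite !negb_or => /and4P [].
    by case: d ld Wd {nd} => [|[|[|[|]]]] // _ ->.
  have [s [ls nt _ ge]] := top_first tt; rewrite gv in ge.
  have one d : d < 4 -> W d -> False.
    by move=> ld Wd; have := top_sum_lt4 ld (W2 s d ld ls nt Wd); rewrite ltnNge -[top_sum _ _ _ _ _ _]add0n ge.
  by apply/negP => /or4P []; apply: one.
- split=> [nW|tt].
    apply: contraT => nt; have lt : g i j + top_sum n m g (n * m) i j < 4.
      by rewrite ltnNge; apply: contra nt; apply: top_lim.
    (* 4 is no direction, so the first call excludes nothing; the second excludes [d] and yields
       another blocked direction. *)
    rewrite gv add1n ltnS in lt; have [d ld /andP [_ nd]] := @ex_top_nbrN2 n m g _ i j 4 lt.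
    have [e le /andP [ne nde]] := @ex_top_nbrN2 n m g _ i j d lt.
    have two d' e' : d' < 4 -> e' < 4 -> e' != d' -> W d' -> W e' ->
        (W 0 && (W 1 || (W 2 || W 3))) || ((W 1 && (W 2 || W 3)) || (W 2 && W 3)).
      by case: d' => [|[|[|[|]]]] // _; case: e' => [|[|[|[|]]]] // _ _ -> ->;
        rewrite ?(orbT, orTb, andbT, andTb).
    by rewrite (two d e) ?W1 in nW.
  have [s [ls nt _ ge]] := top_first tt; rewrite gv in ge.
  have two d e : d < 4 -> e < 4 -> d != e -> W d -> W e -> False.
    move=> ld le ne Wd We; have := top_sum_lt3 ld le ne (W2 s d ld ls nt Wd) (W2 s e le ls nt We).
    by move: ge; clear; lia.
  apply/negP; case/orP=> [/andP [w /or3P []]|/orP [/andP [w /orP []]|/andP [w]]]; by apply: two w.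
- split=> // _; apply: top_lim => //; by rewrite gv.
Qed.

(** * Values 0, 3, 4 *)

Lemma adj_nxt a b a' b' : adj a b a' b' <-> exists2 dir, dir < 4 & nxt dir a b a' b'.
Proof.
rewrite /adj /nxt; split.
  by case/or4P => H; [exists 0 | exists 1 | exists 2 | exists 3]; rewrite // H ?orbT.
by case=> -[|[|[|[|]]]] // _; rewrite /= ?orbF => ->; rewrite ?orbT.
Qed.

Section Path.
Variables (n m : nat) (g : nat -> nat -> nat).
Local Notation top := (top n m g).
Local Notation M := (n * m).

Lemma top_nbr_gt0 t a b dir : dir < 4 -> top_nbr n m g t a b dir -> 0 < top_sum n m g t a b.
Proof.
by rewrite /top_sum; case: dir => [|[|[|[|]]]] // _ ->; rewrite ?addn_gt0 ?orbT.
Qed.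

Lemma ex_top_nbr t a b : 0 < top_sum n m g t a b -> exists2 dir, dir < 4 & top_nbr n m g t a b dir.
Proof.
rewrite /top_sum => gt.
case: (boolP (top_nbr n m g t a b 0)) => E0; first by exists 0.
case: (boolP (top_nbr n m g t a b 1)) => E1; first by exists 1.
case: (boolP (top_nbr n m g t a b 2)) => E2; first by exists 2.
case: (boolP (top_nbr n m g t a b 3)) => E3; first by exists 3.
by move: gt; rewrite (negPf E0) (negPf E1) (negPf E2) (negPf E3).
Qed.

Lemma top_nbr_nxt t a b dir : dir < 4 -> a < n -> b < m -> top_nbr n m g t a b dir ->
  exists a' b', nxt dir a b a' b' /\ top t a' b'.
Proof.
move=> ld la lb nb; case: (boolP (exits n m a b dir)) => [ex|nex].
  by move: nb; rewrite (exits_top g t ex).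
have [a' [b' [nx _ _]]] := exits_or_nxt ld la lb nex.
by exists a', b'; split=> //; rewrite -(nxt_top n m g t nx).
Qed.

(** A 0-cell waits for all its four neighbours, hence it never causes one of them to topple. *)
Lemma zero_nbrs t a b a' b' dir : g a' b' = 0 -> top t a' b' -> nxt dir a b a' b' -> top t a b.
Proof.
move=> g0 tt nx; have [s [lt _ _ ge]] := top_first tt; rewrite g0 add0n in ge.
have [ld opp] := nxt_opp n m g s nx; apply: (top_mono (ltnW lt)); rewrite -opp.
apply: contraT => nnb; have lo : (dir + 2) %% 4 < 4 by rewrite ltn_mod.
have := top_sum_lt4 lo nnb.
by rewrite ltnNge ge.
Qed.

Variables (N h : nat) (x : seq bool).
Hypothesis eN : h + 3 * (n * m) = N.
Hypothesis gA : forall a b, a < n -> b < m -> g a b \in [:: 0; 3; 4].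
Hypothesis cellE : forall a b v, v <= 4 -> cellb x n m h a b v = [&& a < n, b < m & g a b == v].
Local Notation der := (der (ax Path N x n m h) (rule Path N x n m h) (umax N)).

Lemma path_top t s : der t s -> top M (it1 N t) (it2 N t).
Proof.
elim=> {t s} [t|t1 t2 t s1 s2] /=.
  by rewrite cellE // => /and3P [la lb /eqP gv] _; apply: top_lim => //; rewrite gv.
rewrite !cellE // => /and3P [_ /adj_nxt [dir ld nx] /and3P [la lb /eqP gv]] _ _ tt _ _.
apply: top_lim => //; rewrite gv add3n !ltnS; apply: top_nbr_gt0 ld _.
by rewrite (nxt_top n m g M nx).
Qed.

Lemma der_ax t s : der t s -> exists2 y, y <= umax N & ax Path N x n m h y.
Proof. by elim=> {t s} // t at' lt; exists t. Qed.

(** The neighbour that triggers a 3-cell is not a 0-cell, which would have had to wait for the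
    3-cell; so one goes back in time through nonzero cells until a 4 is met. *)
Lemma top_path t a b : top t a b -> g a b != 0 -> exists2 s, s <= t.+1 & der (item N a b 0 0) s.
Proof.
elim/ltn_ind: t a b => t IH a b tt gn0.
have /andP [la lb] := top_in tt; have [la' lb'] := dims_lt eN la lb.
have b0 : 0 < base N by rewrite /base addn_gt0 orbT.
have li : item N a b 0 0 <= umax N by apply: item_le.
have := gA la lb; rewrite !inE (negPf gn0) /= => /orP [] /eqP gv; last first.
  by exists 1 => //; apply: DerAx => //=; rewrite it1_item ?it2_item // cellE // la lb gv.
have [s [lts nts _ ge]] := top_first tt; rewrite gv add3n !ltnS in ge.
have [dir ld nb] := ex_top_nbr ge.
have [a1 [b1 [nx t1]]] := top_nbr_nxt ld la lb nb.
have [|s1 le1 d1] := IH s lts a1 b1 t1.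
  by apply: contra nts => /eqP g0; apply: zero_nbrs g0 t1 nx.
have /andP [la1 lb1] := top_in t1; have [la1' lb1'] := dims_lt eN la1 lb1.
(* The idle second premise must be an axiom, that is a cell of value 4; any leaf of [d1] is one. *)
have [y ly ay] := der_ax d1.
exists (s1 + 1); first by lia.
have dy : der y 1 by apply: DerAx.
apply: DerRule li d1 dy; rewrite /= !it1_item ?it2_item //.
move: ay => /= ->; rewrite cellE // la lb gv eqxx !andbT /=.
by apply/adj_nxt; exists dir.
Qed.
End Path.

Lemma Path_correct A : {subset A <= [:: 0; 3; 4]} -> mode_correct Path A.
Proof.
move=> sA N x n m h g i j T eN li lj gA cellE sound complete; rewrite fsppE.
have gA' a b : a < n -> b < m -> g a b \in [:: 0; 3; 4] by move=> la lb; apply/sA/gA.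
have [li' lj'] := dims_lt eN li lj.
have lM : n * m <= N by lia.
have b0 : 0 < base N by rewrite /base addn_gt0 orbT.
pose D a b := look N T (code N 1 n m h (item N a b 0 0) 0).
have D1 a b : a < base N -> b < base N -> D a b -> top n m g (n * m) a b.
  move=> la lb /sound [|s d]; first exact: item_le.
  by have := path_top cellE d; rewrite it1_item ?it2_item.
have D2 a b : top n m g (n * m) a b -> g a b != 0 -> D a b.
  move=> tt gn0; have [s le d] := top_path eN gA' cellE tt gn0.
  by apply: complete d _; lia.
have sub c : 0 < c -> c < base N -> (c + (4 * N + 7)) %% base N = c.-1.
  move=> c0 lc; have -> : c + (4 * N + 7) = c.-1 + base N by rewrite /base; lia.
  by rewrite modnDr modn_small //; lia.
have lts : i.+1 < base N /\ j.+1 < base N.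
  have : n <= n * m by rewrite leq_pmulr //; lia.
  have : m <= n * m by rewrite leq_pmull //; lia.
  by rewrite /base; lia.
have ansE : (exists2 t, t <= umax N & ans Path N x T n m h i j t) <->
    (((g i j == 3) || (g i j == 4)) && D i j) || ((g i j == 0) && [&& 0 < i, 0 < j,
      D i j.+1 && D i.+1 j & D i j.-1 && D i.-1 j]).
  have E t : ans Path N x T n m h i j t =
    (((g i j == 3) || (g i j == 4)) && D i j) || ((g i j == 0) && [&& 0 < i, 0 < j,
      D i j.+1 && D i.+1 j & D i j.-1 && D i.-1 j]).
    rewrite /ans !cellE // li lj /= !addn1; congr (_ || (_ && _)).
    case: (posnP i) => // i0; case: (posnP j) => // j0.
    by rewrite !sub.
  by split=> [[t _]|H]; [rewrite E | exists 0 => //; rewrite E].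
rewrite ansE {ansE}.
case: (eqVneq (g i j) 0) => [g0|gn0] /=; last first.
  have := gA' i j li lj; rewrite !inE (negPf gn0) /= orbF => -> /=.
  by split=> [|tt]; [apply: D1 | apply: D2].
rewrite g0 /=; split=> [/and4P [i0 j0 /andP [d0 d1] /andP [d2 d3]]|tt].
  have [ls1 ls2] := lts.
  apply: top_lim => //; rewrite g0 /top_sum /top_nbr i0 j0.
  by rewrite !D1 //; lia.
have [s [lt nt _ ge]] := top_first tt; rewrite g0 add0n in ge.
(* The neighbours topple before [(i, j)], and none of them is a 0-cell, for it would have waited for
   [(i, j)]; so [top_path] applies to each. *)
have nb dir a b : nxt dir i j a b -> D a b.
  move=> nx; have [ld _] := nxt_opp n m g s nx.
  have ts : top n m g s a b.
    rewrite -(nxt_top n m g s nx); apply: contraT => nnb.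
    by have := top_sum_lt4 ld nnb; rewrite ltnNge ge.
  apply: D2; first exact: top_mono (ltnW lt) ts.
  by apply: contra nt => /eqP gv; apply: zero_nbrs gv ts nx.
have [i0 j0] : 0 < i /\ 0 < j.
  have nnb dir : dir < 4 -> top_nbr n m g s i j dir.
    by move=> ld; apply: contraT => nnb; have := top_sum_lt4 ld nnb; rewrite ltnNge ge.
  by move: (nnb 2 isT) (nnb 3 isT) => /= /andP [-> _] /andP [-> _].
rewrite i0 j0 !andTb; apply/andP; split; apply/andP; split.
- by apply: (nb 0); rewrite /nxt !eqb2E !addn1 ?prednK // !eqxx /= ?orbT.
- by apply: (nb 1); rewrite /nxt !eqb2E !addn1 ?prednK // !eqxx /= ?orbT.
- by apply: (nb 2); rewrite /nxt !eqb2E !addn1 ?prednK // !eqxx /= ?orbT.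
- by apply: (nb 3); rewrite /nxt !eqb2E !addn1 ?prednK // !eqxx /= ?orbT.
Qed.

(** * Values 2, 3, 4 *)

(** Closure under two-neighbour bootstrap percolation. The border of the board does not appear,
    since a cell with two such neighbours on the board is itself on the board. *)
Definition fills (X : nat -> nat -> bool) : Prop :=
  [/\ forall a b, X a b -> X a b.+2 -> X a b.+1,
      forall a b, X a b -> X a.+2 b -> X a.+1 b,
      forall a b, X a b.+1 -> X a.+1 b -> X a b && X a.+1 b.+1 &
      forall a b, X a b -> X a.+1 b.+1 -> X a b.+1 && X a.+1 b].

Lemma fills_tr X : fills X -> fills (fun a b => X b a).
Proof.
case=> C1 C2 C3 C4; split=> a b; [exact: C2 | exact: C1 | |].
  by move=> H1 H2; apply: C3.
by move=> H1 H2; rewrite andbC; apply: C4.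
Qed.

Definition rect_in (X : nat -> nat -> bool) (a b c d : nat) : Prop :=
  forall r q, a <= r <= b -> c <= q <= d -> X r q.

Lemma rect_in_tr X a b c d : rect_in X a b c d -> rect_in (fun a b => X b a) c d a b.
Proof. by move=> H r q lr lq; apply: H. Qed.

Section Fill.
Variable X : nat -> nat -> bool.
Hypothesis fX : fills X.

(** One cell beside the rectangle fills the whole side: the next cell of the column has it and a
    cell of the rectangle as neighbours, and so on both ways. *)
Lemma rect_right1 a b c d r : rect_in X a b c d -> c <= d -> a <= r <= b -> X r d.+1 ->
  rect_in X a b c d.+1.
Proof.
case: fX => [_ _ C3 C4] H lcd lr x0.
have up k : r + k <= b -> X (r + k) d.+1.
  elim: k => [|k IH] le; first by rewrite addn0.
  have H1 : X (r + k) d.+1 by apply: IH; lia.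
  have H2 : X (r + k).+1 d by apply: H; lia.
  by rewrite addnS; have /andP [] := C3 _ _ H1 H2.
have down k : a + k <= r -> X (r - k) d.+1.
  elim: k => [|k IH] le; first by rewrite subn0.
  have E : (r - k.+1).+1 = r - k by lia.
  have H1 : X (r - k.+1) d by apply: H; lia.
  have H2 : X (r - k.+1).+1 d.+1 by rewrite E; apply: IH; lia.
  by have /andP [] := C4 _ _ H1 H2.
move=> r' q /andP [l1 l2] /andP [l3 l4].
case: (ltngtP q d.+1) l4 => // [lt _|-> _]; first by apply: H; lia.
case: (leqP r r') => le.
  by rewrite -(subnKC le); apply: up; lia.
by have -> : r' = r - (r - r') by [lia]; apply: down; lia.
Qed.

Lemma rect_left1 a b c d r : rect_in X a b c.+1 d -> c < d -> a <= r <= b -> X r c ->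
  rect_in X a b c d.
Proof.
case: fX => [_ _ C3 C4] H lcd lr x0.
have up k : r + k <= b -> X (r + k) c.
  elim: k => [|k IH] le; first by rewrite addn0.
  have H1 : X (r + k) c by apply: IH; lia.
  have H2 : X (r + k).+1 c.+1 by apply: H; lia.
  by rewrite addnS; have /andP [] := C4 _ _ H1 H2.
have down k : a + k <= r -> X (r - k) c.
  elim: k => [|k IH] le; first by rewrite subn0.
  have E : (r - k.+1).+1 = r - k by lia.
  have H1 : X (r - k.+1) c.+1 by apply: H; lia.
  have H2 : X (r - k.+1).+1 c by rewrite E; apply: IH; lia.
  by have /andP [] := C3 _ _ H1 H2.
move=> r' q /andP [l1 l2] /andP [l3 l4].
case: (ltngtP c q) l3 => // [lt _|<- _]; first by apply: H; lia.
case: (leqP r r') => le.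
  by rewrite -(subnKC le); apply: up; lia.
by have -> : r' = r - (r - r') by [lia]; apply: down; lia.
Qed.

(** Grows one column at a time along a filled piece of row [r]; the last two inequalities say that
    this piece meets or adjoins the columns of the rectangle. *)
Lemma rect_cols a b c d c' d' r : rect_in X a b c d -> c <= d -> a <= r <= b ->
  (forall q, c' <= q <= d' -> X r q) -> c' <= d.+1 -> c <= d'.+1 ->
  rect_in X a b (minn c c') (maxn d d').
Proof.
move=> H lcd lr xr le1 le2.
have right k : d + k <= maxn d d' -> rect_in X a b c (d + k).
  elim: k => [|k IH] le; first by rewrite addn0.
  rewrite addnS; apply: (rect_right1 (r := r)) => //; [by apply: IH; lia | by lia |].
  by apply: xr; lia.
have H1 : rect_in X a b c (maxn d d').
  by have := right (maxn d d' - d); rewrite subnKC ?leq_maxl //; apply.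
have left k : k <= c - minn c c' -> rect_in X a b (c - k) (maxn d d').
  elim: k => [|k IH] le; first by rewrite subn0.
  have E : (c - k.+1).+1 = c - k by lia.
  apply: (rect_left1 (r := r)) => //; rewrite ?E; [by apply: IH; lia | by lia |].
  by apply: xr; lia.
by have := left (c - minn c c') (leqnn _); have -> : c - (c - minn c c') = minn c c' by lia.
Qed.
End Fill.

(** Distance at most 2 in the 1-norm, the classical condition under which two rectangles fill their
    hull in two-neighbour percolation. *)
Definition near (a b c d a' b' c' d' : nat) : bool :=
  (gap 0 a b a' b' && gap 2 c d c' d') ||
  ((gap 1 a b a' b' && gap 1 c d c' d') || (gap 2 a b a' b' && gap 0 c d c' d')).

(** In a common row at most one column separates the rectangles, and it fills. That row extends the
    first rectangle to all columns of the hull; then a column of the second extends it, after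
    transposition, to all rows. *)
Lemma rect_hull0 X a b c d a' b' c' d' : fills X ->
  rect_in X a b c d -> rect_in X a' b' c' d' -> a <= b -> c <= d -> a' <= b' -> c' <= d' ->
  gap 0 a b a' b' -> gap 2 c d c' d' ->
  rect_in X (minn a a') (maxn b b') (minn c c') (maxn d d').
Proof.
move=> fX H H' lab lcd lab' lcd'; rewrite /gap !addn0 => /andP [g1 g2] /andP [g3 g4].
have [C1 _ _ _] := fX; pose r := maxn a a'.
have lr : a <= r <= b by rewrite /r; lia.
have lr' : a' <= r <= b' by rewrite /r; lia.
have row q : minn c c' <= q <= maxn d d' -> X r q.
  move=> lq; case: (boolP (c <= q <= d)) => [in1|out1]; first exact: H.
  case: (boolP (c' <= q <= d')) => [in2|out2]; first exact: H'.
  case: q lq out1 out2 => [|q] lq out1 out2; first by lia.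
  apply: C1.
    case: (boolP (c <= q <= d)) => [in1|out]; first exact: H.
    by apply: H' => //; lia.
  case: (boolP (c <= q.+2 <= d)) => [in1|out]; first exact: H.
  by apply: H' => //; lia.
have cols : rect_in X a b (minn c c') (maxn d d').
  have := @rect_cols X fX a b c d (minn c c') (maxn d d') r H lcd lr row.
  have -> : minn c (minn c c') = minn c c' by lia.
  have -> : maxn d (maxn d d') = maxn d d' by lia.
  by apply; lia.
have := @rect_cols _ (fills_tr fX) _ _ _ _ a' b' c' (rect_in_tr cols) lab.
move=> Hr; apply: rect_in_tr; apply: Hr; try lia.
by move=> q lq; apply: H'; lia.
Qed.

(** Common columns become common rows by transposition, and contact at a corner becomes overlap once
    one rectangle is widened by a column. *)
Lemma rect_hull X a b c d a' b' c' d' : fills X ->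
  rect_in X a b c d -> rect_in X a' b' c' d' -> a <= b -> c <= d -> a' <= b' -> c' <= d' ->
  near a b c d a' b' c' d' ->
  rect_in X (minn a a') (maxn b b') (minn c c') (maxn d d').
Proof.
move=> fX H H' lab lcd lab' lcd'.
case/or3P => /andP [g1 g2]; first exact: rect_hull0.
  have [C1 C2 C3 C4] := fX; move: g1 g2; rewrite /gap => /andP [g1 g2] /andP [g3 g4].
  case: (boolP (gap 0 a b a' b')) => [g0|ng1].
    by apply: rect_hull0 => //; rewrite /gap; lia.
  case: (boolP (gap 0 c d c' d')) => [g0|ng2].
    by apply: rect_in_tr; apply: rect_hull0 (fills_tr fX) (rect_in_tr H) (rect_in_tr H') _ _ _ _ _ _ => //; rewrite /gap; lia.
  (* The rectangles touch at a corner, and the common neighbours of the corner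
     cells extend the first one by a column. *)
  move: ng1 ng2; rewrite /gap !addn0 => ng1 ng2.
  have [lt|gt] : c' = d.+1 \/ c = d'.+1 by lia.
    have xd : exists2 r, a <= r <= b & X r d.+1.
      have [e|e] : a' = b.+1 \/ a = b'.+1 by lia.
        have H1 : X b d by apply: H; lia.
        have H2 : X b.+1 d.+1 by apply: H'; lia.
        by exists b; [lia | have /andP [] := C4 _ _ H1 H2].
      have H1 : X b' d.+1 by apply: H'; lia.
      have H2 : X b'.+1 d by apply: H; lia.
      by exists a; [lia | rewrite e; have /andP [] := C3 _ _ H1 H2].
    have [r lr xr] := xd; have Hd := rect_right1 fX H lcd lr xr.
    have := rect_hull0 (fills_tr fX) (rect_in_tr Hd) (rect_in_tr H').
    have -> : maxn d.+1 d' = maxn d d' by lia.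
    by move=> R; apply: rect_in_tr; apply: R; rewrite /gap; lia.
  have xd : exists2 r, a <= r <= b & X r d'.
    have [e|e] : a' = b.+1 \/ a = b'.+1 by lia.
      have H1 : X b d'.+1 by apply: H; lia.
      have H2 : X b.+1 d' by apply: H'; lia.
      by exists b; [lia | have /andP [] := C3 _ _ H1 H2].
    have H1 : X b' d' by apply: H'; lia.
    have H2 : X b'.+1 d'.+1 by apply: H; lia.
    by exists a; [lia | rewrite e; have /andP [] := C4 _ _ H1 H2].
  rewrite gt in H lcd *; have [r lr xr] := xd; have Hd := rect_left1 fX H lcd lr xr.
  have := rect_hull0 (fills_tr fX) (rect_in_tr Hd) (rect_in_tr H').
  have -> : minn d' c' = minn d'.+1 c' by lia.
  by move=> R; apply: rect_in_tr; apply: R; rewrite /gap; lia.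
by apply: rect_in_tr; apply: rect_hull0 (fills_tr fX) (rect_in_tr H) (rect_in_tr H') _ _ _ _ _ _.
Qed.

Lemma isminE z a b : ismin z a b -> z = minn a b.
Proof. by rewrite /ismin !eqb2E => /orP [] /andP [/eqP -> le]; lia. Qed.

Lemma ismaxE z a b : ismax z a b -> z = maxn a b.
Proof. by rewrite /ismax !eqb2E => /orP [] /andP [/eqP -> le]; lia. Qed.

Lemma ismin_minn a b : ismin (minn a b) a b.
Proof. by rewrite /ismin !eqb2E; case: leqP => le; rewrite ?eqxx ?(ltnW le) ?orbT. Qed.

Lemma ismax_maxn a b : ismax (maxn a b) a b.
Proof. by rewrite /ismax !eqb2E; case: leqP => le; rewrite ?eqxx ?(ltnW le) ?orbT. Qed.

(** The cell lies in the rectangle or shares a side with it. *)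
Definition touches (a b c d r q : nat) : bool :=
  (gap 0 a b r r && gap 1 c d q q) || (gap 1 a b r r && gap 0 c d q q).

Lemma touches_near a b c d r q : touches a b c d r q -> near a b c d r r q q.
Proof. by rewrite /touches /near /gap; lia. Qed.

Section Rect.
Variables (n m : nat) (g : nat -> nat -> nat).
Local Notation M := (n * m).
Local Notation top := (top n m g).
Hypothesis gA : forall a b, a < n -> b < m -> g a b \in [:: 2; 3; 4].

Lemma g_ge2 a b : a < n -> b < m -> 2 <= g a b.
Proof. by move=> la lb; have := gA la lb; rewrite !inE => /or3P [] /eqP ->. Qed.

Lemma top_two a b : a < n -> b < m -> 2 <= top_sum n m g M a b -> top M a b.
Proof. by move=> la lb ge; apply: top_lim => //; have := g_ge2 la lb; lia. Qed.

Lemma fills_top : fills (top M).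
Proof.
split=> a b t1 t2; have /andP [la1 lb1] := top_in t1; have /andP [la2 lb2] := top_in t2.
- apply: top_two => //; first exact: ltnW.
  by rewrite /top_sum /top_nbr /= t1 t2 addnAC -addnA; lia.
- apply: top_two => //; first exact: ltnW.
  by rewrite /top_sum /top_nbr /= t1 t2; lia.
- rewrite !top_two //; try exact: ltnW.
    by rewrite /top_sum /top_nbr /= t1 t2; lia.
  by rewrite /top_sum /top_nbr /= t1 t2; lia.
- rewrite !top_two //; try exact: ltnW.
    by rewrite /top_sum /top_nbr /= t1 t2; lia.
  by rewrite /top_sum /top_nbr /= t1 t2; lia.
Qed.

Lemma top_touch a b c d r q : rect_in (top M) a b c d -> a <= b -> c <= d -> r < n -> q < m ->
  g r q = 3 -> touches a b c d r q -> top M r q.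
Proof.
move=> H lab lcd lr lq gv to.
case: (boolP ((a <= r <= b) && (c <= q <= d))) => [/andP [i1 i2]|out]; first exact: H.
have sum : 0 < top_sum n m g M r q -> top M r q by move=> s0; apply: top_lim => //; rewrite gv; lia.
have : [\/ a <= r <= b /\ q = d.+1, a <= r <= b /\ c = q.+1, r = b.+1 /\ c <= q <= d | a = r.+1 /\ c <= q <= d].
  have : (a <= r <= b /\ q = d.+1) \/ (a <= r <= b /\ c = q.+1) \/ (r = b.+1 /\ c <= q <= d) \/ (a = r.+1 /\ c <= q <= d).
    by move: to out; rewrite /touches /gap; lia.
  by case=> [|[|[|]]] H0; [constructor 1|constructor 2|constructor 3|constructor 4].
case=> [[l1 e]|[l1 e]|[e l2]|[e l2]]; apply: sum.
- by apply: (@top_nbr_gt0 _ _ _ _ _ _ 2) => //; rewrite e /=; apply: H; lia.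
- by apply: (@top_nbr_gt0 _ _ _ _ _ _ 0) => //; rewrite /= -e; apply: H; lia.
- by apply: (@top_nbr_gt0 _ _ _ _ _ _ 3) => //; rewrite e /=; apply: H; lia.
- by apply: (@top_nbr_gt0 _ _ _ _ _ _ 1) => //; rewrite /= -e; apply: H; lia.
Qed.

Variables (N h : nat) (x : seq bool).
Hypothesis eN : h + 3 * (n * m) = N.
Hypothesis cellE : forall a b v, v <= 4 -> cellb x n m h a b v = [&& a < n, b < m & g a b == v].
Local Notation der := (der (ax Rect N x n m h) (rule Rect N x n m h) (umax N)).

(** An item for a 3-cell asserts only the value of the cell; that the cell topples follows when a
    toppled rectangle touching it is the other premise. *)
Lemma rect_sound t s : der t s ->
  (it1 N t <= it2 N t -> [/\ it2 N t < n, it3 N t <= it4 N t, it4 N t < m &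
     rect_in (top M) (it1 N t) (it2 N t) (it3 N t) (it4 N t)]) /\
  (it1 N t = (it2 N t).+1 -> [/\ it2 N t < n, it3 N t < m & g (it2 N t) (it3 N t) = 3]).
Proof.
elim=> {t s} [t|t1 t2 t s1 s2].
  rewrite /ax !eqb2E !cellE // addn1 => /orP [] /and5P [/eqP E1 /eqP E2 la lb /eqP gv] _.
    split=> [_|e]; last by lia.
    rewrite -E2 E1; split=> // r q lr lq.
    have [-> ->] : r = it2 N t /\ q = it3 N t by lia.
    by apply: top_lim => //; rewrite gv.
  by split=> [le|e]; [lia | split].
rewrite /rule => /andP [le1 ru] _ _ [IH1 _] _ [IH2 IH2'].
have [l2 l34 l4 R1] := IH1 le1.
case/orP: ru => [/andP [le2 /andP [/and4P [/isminE -> /ismaxE -> /isminE -> /ismaxE ->] nr]]|].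
  have [k2 k34 k4 R2] := IH2 le2.
  split=> [_|]; last by lia.
  split; try lia.
  exact: (rect_hull fills_top R1 R2).
rewrite eqb2E addn1 => /andP [/eqP e /andP [/and4P [/isminE -> /ismaxE -> /isminE -> /ismaxE ->] to]].
have [k2 k3 gv] := IH2' e.
split=> [_|]; last by lia.
split; try lia.
apply: (rect_hull fills_top R1 _) => //; last exact: touches_near.
move=> r q lr lq; have [-> ->] : r = it2 N t2 /\ q = it3 N t2 by lia.
exact: top_touch R1 le1 l34 k2 k3 gv to.
Qed.

(* A rectangle [(a, b, c, d)] comes with the size [s] of a derivation of it. *)
Definition covers (f : nat * nat * nat * nat * nat) (r q : nat) : bool :=
  let: (a, b, c, d, s) := f in (a <= r <= b) && (c <= q <= d).
Definition covered (F : seq (nat * nat * nat * nat * nat)) (r q : nat) : bool :=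
  has (fun f => covers f r q) F.
Definition uncovered F : {set 'I_n * 'I_m} := [set p : 'I_n * 'I_m | ~~ covered F p.1 p.2].
Definition valid (f : nat * nat * nat * nat * nat) : Prop :=
  let: (a, b, c, d, s) := f in
  [/\ a <= b, b < n, c <= d, d < m & der (item N a b c d) s].
Definition weight (F : seq (nat * nat * nat * nat * nat)) : nat := \sum_(f <- F) f.2.
Definition near2 (f f' : nat * nat * nat * nat * nat) : bool :=
  let: (a, b, c, d, s) := f in let: (a', b', c', d', s') := f' in near a b c d a' b' c' d'.
Definition touches2 (f : nat * nat * nat * nat * nat) (r q : nat) : bool :=
  let: (a, b, c, d, s) := f in touches a b c d r q.
Definition closed_fam F : Prop :=
  [/\ forall r q, r < n -> q < m -> g r q = 4 -> covered F r q,
      forall f f', f \in F -> f' \in F -> near2 f f' -> f = f' &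
      forall f r q, f \in F -> r < n -> q < m -> g r q = 3 -> touches2 f r q -> covered F r q].

Lemma uncovered_mono F F' : (forall r q, covered F r q -> covered F' r q) ->
  #|uncovered F'| <= #|uncovered F|.
Proof.
move=> sub; apply: subset_leq_card; apply/subsetP => p; rewrite !inE.
by apply: contra; apply: sub.
Qed.

Lemma uncovered_lt F F' r q : (forall r q, covered F r q -> covered F' r q) ->
  r < n -> q < m -> ~~ covered F r q -> covered F' r q -> #|uncovered F'| < #|uncovered F|.
Proof.
move=> sub lr lq nc c'; apply: proper_card; apply/properP; split.
  by apply/subsetP => p; rewrite !inE; apply: contra; apply: sub.
by exists (Ordinal lr, Ordinal lq); rewrite !inE /= ?nc ?c'.
Qed.

Lemma base_dims a b : a < n -> b < m -> [/\ a.+1 < base N, b.+1 < base N & a * m + b < base N].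
Proof.
move=> la lb.
have : n <= n * m by rewrite leq_pmulr //; lia.
have : m <= n * m by rewrite leq_pmull //; lia.
have : a.+1 * m <= n * m by rewrite leq_mul2r la orbT.
by rewrite /base mulSn; split; lia.
Qed.

Lemma der_cell r q v : r < n -> q < m -> v = 3 \/ v = 4 -> g r q = v ->
  der (item N (if v == 3 then r.+1 else r) r q q) 1.
Proof.
move=> lr lq vE gv; have [lr' lq' _] := base_dims lr lq.
have la : (if v == 3 then r.+1 else r) < base N by case: ifP => // _; apply: ltnW.
apply: DerAx; last by apply: item_le => //; apply: ltnW.
rewrite /ax !it1_item ?it2_item ?it3_item ?it4_item ?(ltnW lr') ?(ltnW lq') //.
rewrite !eqb2E !cellE // lr lq eqxx /=.
by case: vE gv => -> ->; rewrite /= ?addn1 eqxx ?orbT.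
Qed.

Lemma valid_lt a b c d : a <= b -> b < n -> c <= d -> d < m ->
  [/\ a < base N, b < base N, c < base N & d < base N].
Proof. by move=> lab lb lcd ld; have [] := base_dims lb ld; split; lia. Qed.

Lemma valid_merge f f' : valid f -> valid f' -> near2 f f' ->
  exists f'', [/\ valid f'', f''.2 = f.2 + f'.2 &
    forall r q, covers f r q || covers f' r q -> covers f'' r q].
Proof.
case: f => [[[[a b] c] d] s]; case: f' => [[[[a' b'] c'] d'] s'].
move=> [lab lb lcd ld D] [lab' lb' lcd' ld' D'] nr.
exists (minn a a', maxn b b', minn c c', maxn d d', s + s'); split=> //=; last by lia.
split; try lia.
have [lta ltb ltc ltd] := valid_lt lab lb lcd ld; have [lta' ltb' ltc' ltd'] := valid_lt lab' lb' lcd' ld'.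
have [h1 h2 h3 h4] : [/\ minn a a' < base N, maxn b b' < base N, minn c c' < base N & maxn d d' < base N].
  by rewrite !gtn_min !gtn_max lta ltb ltb' ltc ltd ltd'.
apply: DerRule _ _ D D'; last exact: item_le.
rewrite /rule !it1_item // !it2_item // !it3_item // !it4_item //.
rewrite lab lab' !ismin_minn !ismax_maxn !andTb.
by move: nr; rewrite /near2 /near => ->.
Qed.

Lemma valid_absorb f r q : valid f -> r < n -> q < m -> g r q = 3 -> touches2 f r q ->
  exists f'', [/\ valid f'', f''.2 = f.2 + 1, covers f'' r q &
    forall r q, covers f r q -> covers f'' r q].
Proof.
case: f => [[[[a b] c] d] s] [lab lb lcd ld D] lr lq gv to.
exists (minn a r, maxn b r, minn c q, maxn d q, s + 1); split=> //=; try lia.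
split; try lia.
have [lta ltb ltc ltd] := valid_lt lab lb lcd ld; have [ltr ltr' ltq _] := valid_lt (leqnn r) lr (leqnn q) lq.
have ltr1 : r.+1 < base N by have [] := base_dims lr lq.
have [h1 h2 h3 h4] : [/\ minn a r < base N, maxn b r < base N, minn c q < base N & maxn d q < base N].
  by rewrite !gtn_min !gtn_max lta ltb ltr ltc ltd ltq.
have Dc : der (item N r.+1 r q q) 1 := der_cell lr lq (or_introl erefl) gv.
apply: DerRule _ _ D Dc; last exact: item_le.
rewrite /rule !it1_item // !it2_item // !it3_item // !it4_item //.
rewrite lab !ismin_minn !ismax_maxn !andTb eqb2E addn1 eqxx !andTb.
by move: to; rewrite /touches2 /touches => ->; rewrite orbT.
Qed.

Lemma covered_mem F f r q : f \in F -> covers f r q -> covered F r q.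
Proof. by move=> fF c; apply/hasP; exists f. Qed.

(** Three moves are iterated: add an uncovered 4, merge two near members, absorb a 3-cell. Merging
    makes the family smaller and keeps its weight; the others add one leaf, cover a new cell and
    enlarge the family by at most one. So weight plus uncovered cells never grows, and size plus
    twice the uncovered cells decreases. *)
Lemma closed_family F : (forall f, f \in F -> valid f) -> weight F + #|uncovered F| <= n * m ->
  exists F', [/\ forall f, f \in F' -> valid f, weight F' <= n * m & closed_fam F'].
Proof.
have [k] := ubnP (size F + 2 * #|uncovered F|); elim: k F => // k IH F ltk vF wF.
case: (boolP [exists p : 'I_n * 'I_m, (g p.1 p.2 == 4) && ~~ covered F p.1 p.2]) => [/existsP|no4].
  case=> -[r q] /= /andP [/eqP gv nc]; pose f := (nat_of_ord r, nat_of_ord r, nat_of_ord q, nat_of_ord q, 1).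
  have lt : #|uncovered (f :: F)| < #|uncovered F|.
    apply: (@uncovered_lt F _ r q) => //; last by rewrite /covered /= !leqnn.
    by move=> r' q' c; apply/orP; right.
  apply: (IH (f :: F)); [by move: lt ltk; rewrite /=; lia | | ].
    move=> f'; rewrite inE => /predU1P [->|]; last exact: vF.
    by split; rewrite ?leqnn ?ltn_ord //; apply: (der_cell (ltn_ord r) (ltn_ord q) (or_intror erefl)).
  have wE : weight (f :: F) = (weight F).+1 by rewrite /weight big_cons.
  by rewrite wE; move: lt wF; clear; lia.
case: (boolP (has (fun f => has (fun f' => near2 f f' && (f != f')) F) F)) => [|nonear].
  case/hasP=> f fF /hasP [f' f'F /andP [nr ne]].
  have [f'' [vf'' wf'' cf'']] := valid_merge (vF f fF) (vF f' f'F) nr.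
  have f'R : f' \in rem f F by rewrite rem_mem // eq_sym.
  pose F' := f'' :: rem f' (rem f F).
  have sub r q : covered F r q -> covered F' r q.
    case/hasP=> e eF ce; rewrite /covered /=.
    case: (eqVneq e f) => [E|nef]; first by rewrite cf'' // -E ce.
    case: (eqVneq e f') => [E|nef']; first by rewrite cf'' // -E ce orbT.
    by apply/orP; right; apply/hasP; exists e => //; rewrite !rem_mem.
  have szF : size F' < size F.
    have [s1 s2] := (size_rem fF, size_rem f'R).
    have p1 : 0 < size (rem f F) by case: (rem f F) f'R.
    by rewrite /= s2 prednK // s1 ltn_predL; case: (F) fF.
  have unc := uncovered_mono sub.
  have wE : weight F' = weight F.
    by rewrite /weight big_cons (big_rem f fF) (big_rem f' f'R) /= wf'' addnA.
  apply: (IH F').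
  - rewrite -ltnS; apply: leq_ltn_trans ltk; rewrite -addSn.
    by apply: leq_add szF _; rewrite leq_mul2l unc.
  - by move=> e; rewrite inE => /predU1P [->//|] /mem_rem /mem_rem; apply: vF.
  - by rewrite wE; apply: leq_trans wF; rewrite leq_add2l.
case: (boolP (has (fun f => [exists p : 'I_n * 'I_m, [&& g p.1 p.2 == 3, touches2 f p.1 p.2 & ~~ covered F p.1 p.2]]) F)) => [|no3].
  case/hasP=> f fF /existsP [[r q]] /= /and3P [/eqP gv to nc].
  have [f'' [vf'' wf'' cf'' sf'']] := valid_absorb (vF f fF) (ltn_ord r) (ltn_ord q) gv to.
  pose F' := f'' :: rem f F.
  have lt : #|uncovered F'| < #|uncovered F|.
    apply: (@uncovered_lt F _ r q) => //; last by rewrite /covered /= cf''.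
    move=> r' q' /hasP [e eF ce]; rewrite /covered /=.
    case: (eqVneq e f) => [E|nef]; first by rewrite sf'' // -E.
    by apply/orP; right; apply/hasP; exists e => //; rewrite rem_mem.
  have szF : size F' = size F.
    by rewrite /= size_rem // prednK //; case: (F) fF.
  have wE : weight F' = (weight F).+1.
    by rewrite /weight big_cons (big_rem f fF) /= wf''; lia.
  apply: (IH F').
  - rewrite -ltnS; apply: leq_ltn_trans ltk; rewrite -addnS szF leq_add2l.
    by move: lt; clear; lia.
  - by move=> e; rewrite inE => /predU1P [->//|] /mem_rem; apply: vF.
  - by rewrite wE; apply: leq_trans wF; rewrite addSn -addnS leq_add2l.
exists F; split=> //; first by apply: leq_trans wF; apply: leq_addr.
split.
- move=> r q lr lq gv; apply: contraNT no4 => nc.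
  by apply/existsP; exists (Ordinal lr, Ordinal lq); rewrite /= gv.
- move=> f f' fF f'F nr; apply/eqP; apply: contraNT nonear => ne.
  by apply/hasP; exists f => //; apply/hasP; exists f' => //; rewrite nr.
- move=> f r q fF lr lq gv to; apply: contraNT no3 => nc.
  by apply/hasP; exists f => //; apply/existsP; exists (Ordinal lr, Ordinal lq); rewrite /= gv to.
Qed.

(** The union of a closed family is stable under toppling. Two covered neighbours of a cell lie in
    near members, hence in one member, and a rectangle with two neighbours of a cell contains the
    cell. A 3-cell with a covered neighbour touches a member. *)
Lemma top_covered F : (forall f, f \in F -> valid f) -> closed_fam F ->
  forall t a b, top t a b -> covered F a b.
Proof.
move=> vF [cl4 cln cl3]; elim=> // t IH a b tS.
have /andP [la lb] := top_in tS; move: tS; rewrite topS la lb /= => /orP [/IH //|ge].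
have nbc dir : dir < 4 -> top_nbr n m g t a b dir ->
    exists a' b', nxt dir a b a' b' /\ covered F a' b'.
  move=> ld nb; have [a' [b' [nx tt]]] := top_nbr_nxt ld la lb nb.
  by exists a', b'; split=> //; apply: IH.
have := gA la lb; rewrite !inE => /or3P [] /eqP gv; rewrite gv in ge; last exact: cl4.
  have ge2 : 1 < top_sum n m g t a b by lia.
  have [d1 l1 nb1] := ex_top_nbr (ltnW ge2).
  have [d2 l2 [ne nb2]] : exists2 d2, d2 < 4 & d2 != d1 /\ top_nbr n m g t a b d2.
    move: ge2; rewrite /top_sum; clear - l1 nb1.
    case E0 : (top_nbr n m g t a b 0); case E1 : (top_nbr n m g t a b 1);
    case E2 : (top_nbr n m g t a b 2); case E3 : (top_nbr n m g t a b 3) => //= _;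
    case: d1 l1 nb1 => [|[|[|[|]]]] // _; rewrite ?E0 ?E1 ?E2 ?E3 // => _;
    by [exists 0; rewrite ?E0 | exists 1; rewrite ?E1 | exists 2; rewrite ?E2 | exists 3; rewrite ?E3].
  have [a1 [b1 [nx1 /hasP [f1 f1F c1]]]] := nbc d1 l1 nb1.
  have [a2 [b2 [nx2 /hasP [f2 f2F c2]]]] := nbc d2 l2 nb2.
  have nr : near2 f1 f2.
    have [vf1 vf2] := (vF f1 f1F, vF f2 f2F); clear f1F f2F vF.
    case: f1 c1 vf1 => [[[[x1 y1] z1] w1] s1] c1 [v1 v2 v3 v4 _].
    case: f2 c2 vf2 => [[[[x2 y2] z2] w2] s2] c2 [u1 u2 u3 u4 _].
    move: nx1 nx2 c1 c2; rewrite /= /nxt !eqb2E !addn1 /near /gap.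
    case: d1 l1 ne {nb1} => [|[|[|[|]]]] // _; case: d2 l2 {nb2} => [|[|[|[|]]]] // _ _ /=; rewrite ?orbF;
      move=> /andP [/eqP ? /eqP ?] /andP [/eqP ? /eqP ?] ? ?; lia.
  have E := cln f1 f2 f1F f2F nr; subst f2.
  apply: (covered_mem f1F).
  case: f1 c1 c2 {f1F f2F nr} => [[[[x1 y1] z1] w1] s1] /=.
  move: nx1 nx2; rewrite /nxt !eqb2E !addn1.
  case: d1 l1 ne {nb1} => [|[|[|[|]]]] // _; case: d2 l2 {nb2} => [|[|[|[|]]]] // _ _ /=; rewrite ?orbF;
    move=> /andP [/eqP ? /eqP ?] /andP [/eqP ? /eqP ?]; lia.
have [|d1 l1 nb1] := @ex_top_nbr n m g t a b; first by move: ge; clear; lia.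
have [a1 [b1 [nx1 /hasP [f1 f1F c1]]]] := nbc d1 l1 nb1.
apply: (cl3 f1) => //; have v := vF f1 f1F; clear f1F vF.
case: f1 c1 v => [[[[x1 y1] z1] w1] s1] c1 [v1 v2 v3 v4 _].
move: nx1 c1; rewrite /= /nxt !eqb2E !addn1 /touches /gap.
case: d1 l1 {nb1} => [|[|[|[|]]]] // _ /=; rewrite ?orbF;
  move=> /andP [/eqP ? /eqP ?] ?; lia.
Qed.

(** The empty family has weight 0 and at most [n * m] uncovered cells, so every rectangle reached
    has a derivation with at most [n * m] leaves. *)
Lemma top_rect a b : top M a b -> exists f, [/\ valid f, covers f a b & f.2 <= n * m].
Proof.
move=> tt; have [||F [vF wF cF]] := @closed_family [::].
- by [].
- by rewrite /weight big_nil add0n (leq_trans (max_card _)) // card_prod !card_ord.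
have /hasP [f fF c] := top_covered vF cF tt; exists f; split=> //; first exact: vF.
by apply: leq_trans wF; rewrite /weight (big_rem f fF) leq_addr.
Qed.
End Rect.

Lemma Rect_correct A : {subset A <= [:: 2; 3; 4]} -> mode_correct Rect A.
Proof.
move=> sA N x n m h g i j T eN li lj gA cellE sound complete; rewrite fsppE.
have gA' a b : a < n -> b < m -> g a b \in [:: 2; 3; 4] by move=> la lb; apply/sA/gA.
split=> [[t lt /and3P [/andP [l1 l2] l34 D]]|tt].
  have [s d] := sound t lt D; have [H _] := rect_sound gA' eN cellE d.
  by have [_ _ _ R] := H (leq_trans l1 l2); apply: R; rewrite ?l1.
have [[[[[a b] c] d] s] [[lab lb lcd ld D] cov le]] := top_rect gA' eN cellE tt.
have [lta ltb ltc ltd] := valid_lt eN lab lb lcd ld.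
exists (item N a b c d); first exact: item_le.
rewrite /ans it1_item // it2_item // it3_item // it4_item //.
move: cov => /= /andP [-> ->] /=; apply: complete D _.
by move: le => /=; lia.
Qed.

Theorem theorem1 :
  forall A : seq nat,
    A \in [:: [:: 0; 4]; [:: 1; 4]; [:: 0; 1; 4]; [:: 2; 4]; [:: 0; 3; 4];
              [:: 2; 3; 4]] ->
    in_NC (FSPP A).
Proof.
move=> A; rewrite !inE => /or4P [/eqP ->|/eqP ->|/eqP ->|/or3P [] /eqP ->].
- by apply: (@in_NC_FSPP Core) => //; apply: Core_correct; apply/allP.
- by apply: (@in_NC_FSPP Core) => //; apply: Core_correct; apply/allP.
- by apply: (@in_NC_FSPP Core) => //; apply: Core_correct; apply/allP.
- by apply: (@in_NC_FSPP Rect) => //; apply: Rect_correct; apply/allP.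
- by apply: (@in_NC_FSPP Path) => //; apply: Path_correct; apply/allP.
by apply: (@in_NC_FSPP Rect) => //; apply: Rect_correct; apply/allP.
Qed.
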